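(* Protocol $\mathcal{P}_{GInd}$ privately computes (with respect to semi-honest parties) the function $GInd$ with work $O\left(\sum_{\ell=1}^{c}W_{\mathrm{OT}}(w_\ell,k)\right)$ and communication $O\left(\sum_{\ell=1}^{c}C_{\mathrm{OT}}(w_\ell,k)\right)$, where $k$ is the security parameter.
   Context: **Generalized indirect indexing.** Let $c$ be even and let $w_1,\dots,w_c$ be powers of $2$. Alice holds lists $\hat x=(\bar x_2,\bar x_4,\dots,\bar x_c)$ and Bob holds lists $\hat y=(\bar y_1,\bar y_3,\dots,\bar y_{c-1})$, where the list with index $\ell$ has $w_\ell$ entries. Entries satisfy $0\le y_\ell[i]<w_{\ell+1}$ for $\ell$ odd, $0\le x_\ell[i]<w_{\ell+1}$ for $\ell$ even with $\ell\ne c$, and $x_c[i]\in\{0,1\}^{X_c}$. For an initial index $0\le j_0<w_1$ let $j_\ell=y_\ell[j_{\ell-1}]$ for $\ell$ odd and $j_\ell=x_\ell[j_{\ell-1}]$ for $\ell$ even ($1\le\ell\le c$), so $j_c=x_c[y_{c-1}[\cdots x_2[y_1[j_0]]\cdots]]$. With $\pi\in\{0,1\}^{\log w_1}$ arbitrary, $$GInd((\pi\oplus j_0,\hat x),(\pi,\hat y))=(\pi'\oplus j_c,\pi'),\qquad \pi'\in_R\{0,1\}^{X_c}\text{ uniform}.$$ **Single-level protocols.** $\mathcal{P}_{Ind_{AB}}(\pi\oplus j,(\pi,\bar y))$, for $\bar y=y[0],\dots,y[w-1]$ with $y[i]\in\{0,1\}^Y$: Bob picks $\pi'\in_R\{0,1\}^Y$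 and sets $\mathcal{Y}[\pi\oplus i]=\pi'\oplus y[i]$ for all $i$; Alice (chooser) and Bob (sender) run the 1-out-of-$w$ OT protocol so that Alice learns $\mathcal{Y}[\pi\oplus j]$; Alice outputs this value ($=\pi'\oplus y[j]$) and Bob outputs $\pi'$. $\mathcal{P}_{Ind_{BA}}((\pi,\bar x),\pi\oplus j)$ is the same with the roles of Alice and Bob exchanged. **Protocol $\mathcal{P}_{GInd}$.** Initially Alice holds $\pi_0\oplus j_0$ and Bob holds $\pi_0=\pi$. For $\ell=1,\dots,c$ in order: if $\ell$ is odd, they run $\mathcal{P}_{Ind_{AB}}(\pi_{\ell-1}\oplus j_{\ell-1},(\pi_{\ell-1},\bar y_\ell))$, with output denoted $(\pi_\ell,\pi_\ell\oplus j_\ell)$; if $\ell$ is even, they run $\mathcal{P}_{Ind_{BA}}((\pi_{\ell-1},\bar x_\ell),\pi_{\ell-1}\oplus j_{\ell-1})$, with output denoted $(\pi_\ell\oplus j_\ell,\pi_\ell)$. The outputs of step $c$ are the outputs of the protocol. **Privacy (semi-honest).** For a (possibly randomized) functionality $g(x,y)=(g_1(x,y),g_2(x,y))$, a protocol $\mathcal{P}$ privately computes $g$ if there are probabilistic polynomial-time simulators $S_1,S_2$ with $\{(S_1(x,g_1(x,y)),g_2(x,y))\}\stackrel{c}{\equiv}\{(\mathrm{VIEW}_1^{\mathcal{P}}(x,y),\mathrm{OUT}_2^{\mathcal{P}}(x,y))\}$ and $\{(S_2(y,g_2(x,y)),g_1(x,y))\}\stackrel{c}{\equiv}\{(\mathrm{VIEW}_2^{\mathcal{P}}(x,y),\mathrm{OUT}_1^{\mathcal{P}}(x,y))\}$.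 Here $\mathrm{VIEW}_i$ is party $i$'s view (input, private coins and received messages) when both follow $\mathcal{P}$, $\mathrm{OUT}_i$ is its output, and $\stackrel{c}{\equiv}$ is computational indistinguishability by polynomial-size circuits. The security parameter $k$ is chosen so that the parties' work does not suffice to break the primitives in use. **Oblivious transfer.** A 1-out-of-$w$ OT protocol, i.e. one privately computing $((x[0],\dots,x[w-1]),j)\mapsto(\bot,x[j])$, is assumed given, with work $W_{\mathrm{OT}}(w,k)=\Omega(w)$ and communication $C_{\mathrm{OT}}(w,k)$; the dependence on the string length is suppressed, all strings having length $O(\max(k,\log w))$. *)

(* Defs.v *)
From mathcomp Require Import all_boot all_order all_algebra.

Set Implicit Arguments.
Unset Strict Implicit.
Unset Printing Implicit Defensive.

Import Order.TTheory GRing.Theory Num.Theory.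

(* [Coin n f] draws r uniformly from {0,1}^n, read as 0 <= r < 2^n. *)
Inductive rtree (T : Type) : Type :=
| Leaf of T
| Coin (n : nat) of (nat -> rtree T).

Fixpoint rbind T U (t : rtree T) (k : T -> rtree U) : rtree U :=
  match t with
  | Leaf x => k x
  | Coin n f => Coin n (fun r => rbind (f r) k)
  end.

Fixpoint prob T (P : T -> bool) (t : rtree T) : rat :=
  match t with
  | Leaf x => ((P x)%:R)%R
  | Coin n f => ((\sum_(r < 2 ^ n) prob P (f r)) / (2 ^ n)%:R)%R
  end.

Fixpoint every T (Q : T -> Prop) (t : rtree T) : Prop :=
  match t with
  | Leaf x => Q x
  | Coin n f => forall r, r < 2 ^ n -> every Q (f r)
  end.

(* A structured probabilistic word RAM with word length b.  A word is a natural
   number below 2^b; a variable holds a growable array of words.  Every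
   instruction and every node of an expression costs one unit, so the cost of a
   run is its number of operations on words. *)

Inductive binop :=
  OAdd | OSub | OMul | ODiv | OLow | OAnd | OOr | OXor | OShl | OShr | OEq | OLt.

(* [OLow]: the n low-order bits; [OSub] is truncated. *)
Definition binop_fun (o : binop) (a n : nat) : nat :=
  match o with
  | OAdd => a + n
  | OSub => a - n
  | OMul => a * n
  | ODiv => a %/ n
  | OLow => a %% 2 ^ n
  | OAnd => Nat.land a n
  | OOr => Nat.lor a n
  | OXor => Nat.lxor a n
  | OShl => a * 2 ^ n
  | OShr => a %/ 2 ^ n
  | OEq => a == n
  | OLt => a < n
  end.

Inductive expr :=
| Cst of nat
| Len of nat
| Get of nat & expr
| Op of binop & expr & expr.

(* [Upd x i e] does nothing when i is outside the array x.
   [While n e c] iterates c as long as e is nonzero, but at most n times (n is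
   evaluated once, on entry); the bound makes execution total, and a bound of
   2^b - 1 leaves an ordinary while loop.
   [Call c xs ys] runs c on fresh variables, the i-th one initialised with a
   copy of the array nth 0 xs i, and finally copies its variables 0, 1, ... back
   into ys; the copies are paid for. *)
Inductive cmd :=
| Skip
| Asg of nat & expr
| Clr of nat
| Push of nat & expr
| Upd of nat & expr & expr
| Rnd of nat
| Send of expr
| Recv of nat
| Seq of cmd & cmd
| If of expr & cmd & cmd
| While of expr & expr & cmd
| Call of cmd & seq nat & seq nat.

Definition store := nat -> seq nat.

Definition upd (s : store) (x : nat) (v : seq nat) : store :=
  fun y => if y == x then v else s y.

Definition load (xs : seq (seq nat)) : store := fun x => nth [::] xs x.

Fixpoint eval (b : nat) (s : store) (e : expr) : nat :=
  match e with
  | Cst n => n %% 2 ^ b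
  | Len x => size (s x) %% 2 ^ b
  | Get x e1 => nth 0 (s x) (eval b s e1)
  | Op o e1 e2 => binop_fun o (eval b s e1) (eval b s e2) %% 2 ^ b
  end.

Fixpoint cost (e : expr) : nat :=
  match e with
  | Cst _ | Len _ => 1
  | Get _ e1 => (cost e1).+1
  | Op _ e1 e2 => (cost e1 + cost e2).+1
  end.

Inductive proc (T : Type) : Type :=
| Ret of T
| Tick (n : nat) of proc T
| Toss of (nat -> proc T)
| Put (m : nat) of proc T
| Take of (nat -> proc T).

Fixpoint pbind T U (p : proc T) (k : T -> proc U) : proc U :=
  match p with
  | Ret x => k x
  | Tick n q => Tick n (pbind q k)
  | Toss f => Toss (fun r => pbind (f r) k)
  | Put m q => Put m (pbind q k)
  | Take f => Take (fun m => pbind (f m) k)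
  end.

Fixpoint denote (b : nat) (c : cmd) (s : store) {struct c} : proc store :=
  match c with
  | Skip => Tick 1 (Ret s)
  | Asg x e => Tick (cost e).+1 (Ret (upd s x [:: eval b s e]))
  | Clr x => Tick 1 (Ret (upd s x [::]))
  | Push x e => Tick (cost e).+1 (Ret (upd s x (rcons (s x) (eval b s e))))
  | Upd x i e =>
      Tick (cost i + cost e).+1
        (Ret (if eval b s i < size (s x)
              then upd s x (set_nth 0 (s x) (eval b s i) (eval b s e)) else s))
  | Rnd x => Tick 1 (Toss (fun r => Ret (upd s x (rcons (s x) r))))
  | Send e => Tick (cost e).+1 (Put (eval b s e) (Ret s))
  | Recv x => Tick 1 (Take (fun m => Ret (upd s x (rcons (s x) m))))
  | Seq c1 c2 => pbind (denote b c1 s) (denote b c2)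
  | If e c1 c2 =>
      Tick (cost e).+1 (if eval b s e != 0 then denote b c1 s else denote b c2 s)
  | While n e c1 =>
      Tick (cost n).+1
        ((fix loop (i : nat) (s : store) {struct i} : proc store :=
            if i is i'.+1 then
              Tick (cost e).+1
                (if eval b s e != 0 then pbind (denote b c1 s) (loop i')
                 else Ret s)
            else Ret s) (eval b s n) s)
  | Call c1 xs ys =>
      Tick (sumn [seq size (s x) | x <- xs]).+1
        (pbind (denote b c1 (load [seq s x | x <- xs])) (fun s1 =>
          Tick (sumn [seq size (s1 i) | i <- iota 0 (size ys)])
            (Ret (fun x => if x \in ys then s1 (index x ys) else s x))))
  end.

Record log := Log {
  steps : nat;
  coins : seq nat;
  rcvd : seq nat;
  sent : seq nat }.

Definition log0 := Log 0 [::] [::] [::].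
Definition log_step n l := Log (n + steps l) (coins l) (rcvd l) (sent l).
Definition log_coin r l := Log (steps l) (rcons (coins l) r) (rcvd l) (sent l).
Definition log_rcvd m l := Log (steps l) (coins l) (rcons (rcvd l) m) (sent l).
Definition log_sent m l := Log (steps l) (coins l) (rcvd l) (rcons (sent l) m).

(* The array left in variable 0 is the output of a party. *)
Record outcome := Outcome {
  halted : bool;
  fin1 : store; fin2 : store;
  log1 : log; log2 : log }.

Definition dead (l1 l2 : log) : rtree outcome :=
  Leaf (Outcome false (load [::]) (load [::]) l1 l2).

(* A sender waits until the other party is ready to receive.  The run is [dead]
   when neither party can move although not both have finished. *)
Fixpoint run (b : nat) (p1 : proc store) (l1 : log) {struct p1} :
    proc store -> log -> rtree outcome :=
  match p1 with
  | Tick n q1 => run b q1 (log_step n l1)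
  | Toss f1 => fun p2 l2 =>
      Coin b (fun r => run b (f1 r) (log_coin r l1) p2 l2)
  | Ret s1 =>
      fix run2 (p2 : proc store) (l2 : log) {struct p2} : rtree outcome :=
        match p2 with
        | Tick n q2 => run2 q2 (log_step n l2)
        | Toss f2 => Coin b (fun r => run2 (f2 r) (log_coin r l2))
        | Ret s2 => Leaf (Outcome true s1 s2 l1 l2)
        | Put _ _ | Take _ => dead l1 l2
        end
  | Put m q1 =>
      fix run2 (p2 : proc store) (l2 : log) {struct p2} : rtree outcome :=
        match p2 with
        | Tick n q2 => run2 q2 (log_step n l2)
        | Toss f2 => Coin b (fun r => run2 (f2 r) (log_coin r l2))
        | Take f2 => run b q1 (log_sent m l1) (f2 m) (log_rcvd m l2)
        | Ret _ | Put _ _ => dead l1 l2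
        end
  | Take f1 =>
      fix run2 (p2 : proc store) (l2 : log) {struct p2} : rtree outcome :=
        match p2 with
        | Tick n q2 => run2 q2 (log_step n l2)
        | Toss f2 => Coin b (fun r => run2 (f2 r) (log_coin r l2))
        | Put m q2 => run b (f1 m) (log_rcvd m l1) q2 (log_sent m l2)
        | Ret _ | Take _ => dead l1 l2
        end
  end.

Definition exec (b : nat) (c1 c2 : cmd) (xs1 xs2 : seq (seq nat)) :
    rtree outcome :=
  run b (denote b c1 (load xs1)) log0 (denote b c2 (load xs2)) log0.

Definition solo (b : nat) (c : cmd) (xs : seq (seq nat)) : rtree outcome :=
  exec b c Skip xs [::].

Definition work (o : outcome) : nat := steps (log1 o) + steps (log2 o).

(* In bits, every message being one word. *)
Definition comm (b : nat) (o : outcome) : nat :=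
  b * (size (sent (log1 o)) + size (sent (log2 o))).

(* Boolean circuits on a list of arrays of words: array a has wires for bit t of
   its entry i, and for the presence of an entry i. *)
Inductive gate :=
| Bit (a i t : nat)
| Has (a i : nat)
| Nand (u v : nat).

(* A gate refers to earlier gates by their positions; the last one is the
   output. *)
Definition circuit := seq gate.

Definition gate_val (d : seq (seq nat)) (vals : seq bool) (g : gate) : bool :=
  match g with
  | Bit a i t => Nat.testbit (nth 0 (nth [::] d a) i) t
  | Has a i => i < size (nth [::] d a)
  | Nand u v => ~~ (nth false vals u && nth false vals v)
  end.

Definition accepts (C : circuit) (d : seq (seq nat)) : bool :=
  last false (foldl (fun vals g => rcons vals (gate_val d vals g)) [::] C).

(* A randomized two-party functionality, together with its legal instances
   (parameters and both inputs).  [secpar] is the security parameter, [wlen] the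
   word length of the machines, [sz] the size in which polynomial time is
   measured, [in1] and [in2] the two inputs as given to the parties, and [ideal]
   the joint distribution of the two outputs. *)
Record functionality := Functionality {
  inst : Type;
  legal : inst -> Prop;
  secpar : inst -> nat;
  wlen : inst -> nat;
  sz : inst -> nat;
  in1 : inst -> seq nat;
  in2 : inst -> seq nat;
  ideal : inst -> rtree (seq nat * seq nat) }.

Section Privacy.
Variable F : functionality.

Definition ensemble := inst F -> rtree (seq (seq nat)).

(* Circuits are non-uniform: they may depend on the whole instance.  Only
   instances of size polynomial in the security parameter are considered. *)
Definition indistinguishable (D E : ensemble) : Prop :=
  forall p s q : {poly nat}, exists K : nat, forall i : inst F,
    legal i -> K <= secpar i -> sz i <= p.[secpar i]%R ->
    forall C : circuit, size C <= s.[secpar i]%R ->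
    (`|prob (accepts C) (D i) - prob (accepts C) (E i)|
       * (q.[secpar i])%:R < 1)%R.

Definition run_protocol (P1 P2 : cmd) (i : inst F) : rtree outcome :=
  exec (wlen i) P1 P2 [:: in1 i] [:: in2 i].

(* A view is the triple of arrays (input, private coins, received messages); a
   simulator leaves one in its variables 0, 1, 2. *)
Definition view_out1 (P1 P2 : cmd) : ensemble := fun i =>
  rbind (run_protocol P1 P2 i) (fun o =>
    Leaf [:: in1 i; coins (log1 o); rcvd (log1 o); fin2 o 0]).

Definition view_out2 (P1 P2 : cmd) : ensemble := fun i =>
  rbind (run_protocol P1 P2 i) (fun o =>
    Leaf [:: in2 i; coins (log2 o); rcvd (log2 o); fin1 o 0]).

Definition simulation1 (S : cmd) (i : inst F) :
    rtree ((seq nat * seq nat) * outcome) :=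
  rbind (ideal i) (fun g =>
    rbind (solo (wlen i) S [:: in1 i; g.1]) (fun o => Leaf (g, o))).

Definition simulation2 (S : cmd) (i : inst F) :
    rtree ((seq nat * seq nat) * outcome) :=
  rbind (ideal i) (fun g =>
    rbind (solo (wlen i) S [:: in2 i; g.2]) (fun o => Leaf (g, o))).

Definition sim_out1 (S : cmd) : ensemble := fun i =>
  rbind (simulation1 S i) (fun go =>
    Leaf [:: fin1 go.2 0; fin1 go.2 1; fin1 go.2 2; go.1.2]).

Definition sim_out2 (S : cmd) : ensemble := fun i =>
  rbind (simulation2 S i) (fun go =>
    Leaf [:: fin1 go.2 0; fin1 go.2 1; fin1 go.2 2; go.1.1]).

Definition polytime
    (sim : inst F -> rtree ((seq nat * seq nat) * outcome)) : Prop :=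
  exists t : {poly nat}, forall i : inst F, legal i ->
    every (fun go => steps (log1 go.2) <= t.[sz i]%R) (sim i).

Definition privately_computes (P1 P2 : cmd) : Prop :=
  exists S1 S2 : cmd,
    [/\ polytime (simulation1 S1), polytime (simulation2 S2),
        indistinguishable (sim_out1 S1) (view_out1 P1 P2)
      & indistinguishable (sim_out2 S2) (view_out2 P1 P2)].

(* Every execution terminates, within the given amount of work. *)
Definition has_work (P1 P2 : cmd) (W : inst F -> nat) : Prop :=
  forall i : inst F, legal i ->
    every (fun o => halted o /\ work o <= W i) (run_protocol P1 P2 i).

Definition has_comm (P1 P2 : cmd) (C : inst F -> nat) : Prop :=
  forall i : inst F, legal i ->
    every (fun o => comm (wlen i) o <= C i) (run_protocol P1 P2 i).

End Privacy.

(* 1-out-of-w oblivious transfer of L-bit strings; party 1 is the sender. *)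
Record ot_inst := OTInst {
  ot_b : nat;
  ot_k : nat;
  ot_w : nat;
  ot_L : nat;
  ot_x : seq nat;
  ot_j : nat }.

(* A word is long enough for k bits, for a string and for the addresses of the
   input, and has length at most beta * max(k, log w). *)
Definition ot_legal (beta : nat) (i : ot_inst) : Prop :=
  [/\ [/\ ot_k i <= ot_b i, ot_L i <= ot_b i, 3 + ot_w i < 2 ^ ot_b i
        & ot_b i <= beta * maxn (ot_k i) (trunc_log 2 (ot_w i))],
      size (ot_x i) = ot_w i,
      all (fun v => v < 2 ^ ot_L i) (ot_x i)
    & ot_j i < ot_w i].

Definition OT (beta : nat) : functionality := {|
  inst := ot_inst;
  legal := ot_legal beta;
  secpar := ot_k;
  wlen := ot_b;
  sz := fun i => ot_b i + ot_w i;
  in1 := fun i => [:: ot_k i; ot_w i; ot_L i] ++ ot_x i;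
  in2 := fun i => [:: ot_k i; ot_w i; ot_L i; ot_j i];
  ideal := fun i => Leaf ([::], [:: nth 0 (ot_x i) (ot_j i)]) |}.

(* Levels are numbered from 1 to c; w_l = 2 ^ gi_n l.  The entry i of the list
   of level l is [gi_y l i] for l odd and [gi_x l i] for l even; values of the
   three functions outside these ranges are irrelevant. *)
Record gind_inst := GIndInst {
  gi_b : nat;
  gi_k : nat;
  gi_c : nat;
  gi_X : nat;
  gi_n : nat -> nat;
  gi_x : nat -> nat -> nat;
  gi_y : nat -> nat -> nat;
  gi_j0 : nat;
  gi_pi : nat }.

Definition gi_w (i : gind_inst) (l : nat) : nat := 2 ^ gi_n i l.

Definition gi_tab (i : gind_inst) (l : nat) : nat -> nat :=
  if odd l then gi_y i l else gi_x i l.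

(* Bit length of the entries of the list of level l. *)
Definition gi_len (i : gind_inst) (l : nat) : nat :=
  if l == gi_c i then gi_X i else gi_n i l.+1.

Fixpoint gi_j (i : gind_inst) (l : nat) : nat :=
  if l is l'.+1 then gi_tab i l (gi_j i l') else gi_j0 i.

Definition gind_legal (beta : nat) (i : gind_inst) : Prop :=
  [/\ [/\ gi_k i <= gi_b i, gi_X i <= gi_b i,
          5 + gi_c i + \sum_(1 <= l < (gi_c i).+1) gi_w i l < 2 ^ gi_b i
        & forall l, 1 <= l <= gi_c i ->
            gi_b i <= beta * maxn (gi_k i) (gi_n i l)],
      0 < gi_c i, ~~ odd (gi_c i),
      forall l m, 1 <= l <= gi_c i -> m < gi_w i l ->
        gi_tab i l m < 2 ^ gi_len i l
    & gi_j0 i < gi_w i 1 /\ gi_pi i < gi_w i 1].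

(* Input of a party: public parameters k, c, its share v of the initial index,
   log w_1, ..., log w_c, X_c, and then its lists one after the other, i.e. the
   levels whose parity is [par]. *)
Definition gind_input (i : gind_inst) (v : nat) (par : bool) : seq nat :=
  [:: gi_k i; gi_c i; v] ++ [seq gi_n i l | l <- iota 1 (gi_c i)]
    ++ [:: gi_X i]
    ++ flatten [seq mkseq (gi_tab i l) (gi_w i l)
               | l <- iota 1 (gi_c i) & odd l == par].

Definition GInd (beta : nat) : functionality := {|
  inst := gind_inst;
  legal := gind_legal beta;
  secpar := gi_k;
  wlen := gi_b;
  sz := fun i => gi_b i + \sum_(1 <= l < (gi_c i).+1) gi_w i l;
  in1 := fun i => gind_input i (Nat.lxor (gi_pi i) (gi_j0 i)) false;
  in2 := fun i => gind_input i (gi_pi i) true;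
  ideal := fun i => Coin (gi_X i) (fun r =>
    Leaf ([:: Nat.lxor r (gi_j i (gi_c i))], [:: r])) |}.

Declare Scope cmd_scope.
Notation "c1 ;; c2" := (Seq c1 c2)
  (at level 90, right associativity) : cmd_scope.
Local Open Scope cmd_scope.

Definition V (x : nat) : expr := Get x (Cst 0).
Definition Add (e1 e2 : expr) : expr := Op OAdd e1 e2.
Definition Xor (e1 e2 : expr) : expr := Op OXor e1 e2.
Definition Low (e1 e2 : expr) : expr := Op OLow e1 e2.
Definition Pow2 (e : expr) : expr := Op OShl (Cst 1) e.

Definition For (x : nat) (n : expr) (body : cmd) : cmd :=
  Asg x (Cst 0) ;; While n (Cst 1) (body ;; Asg x (Add (V x) (Cst 1))).

(* Single-level protocol, sender.  Variable 0: input k, w, Y, pi, y[0], ...,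
   y[w-1]; 1: pi'; 2: the input of the OT sender; 3: index. *)
Definition ind_sender (ots : cmd) : cmd :=
  let k := Get 0 (Cst 0) in
  let w := Get 0 (Cst 1) in
  let Y := Get 0 (Cst 2) in
  let pi := Get 0 (Cst 3) in
  Rnd 1 ;; Asg 1 (Low (V 1) Y) ;;
  Asg 2 k ;; Push 2 w ;; Push 2 Y ;;
  For 3 w (Push 2 (Cst 0)) ;;
  For 3 w (Upd 2 (Add (Cst 3) (Xor pi (V 3)))
                 (Xor (V 1) (Get 0 (Add (Cst 4) (V 3))))) ;;
  Call ots [:: 2] [::] ;;
  Asg 0 (V 1).

(* Single-level protocol, chooser.  Variable 0: input k, w, Y, pi (+) j; the
   value received is a Y-bit string. *)
Definition ind_chooser (otc : cmd) : cmd :=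
  Call otc [:: 0] [:: 1] ;;
  Asg 0 (Low (V 1) (Get 0 (Cst 2))).

(* Party of P_GInd that is the chooser at the levels of parity [par].
   Variable 0: input; 1: level l; 2: the share of j_(l-1); 3: position in the
   input of the party's next list; 4: w_l; 5: length of the strings of level l;
   6: input of the single-level protocol; 7: index. *)
Definition gind_party (ots otc : cmd) (par : bool) : cmd :=
  let k := Get 0 (Cst 0) in
  let c := Get 0 (Cst 1) in
  Asg 1 (Cst 1) ;;
  Asg 2 (Get 0 (Cst 2)) ;;
  Asg 3 (Add (Cst 4) c) ;;
  While c (Cst 1) (
    Asg 4 (Pow2 (Get 0 (Add (Cst 2) (V 1)))) ;;
    Asg 5 (Get 0 (Add (Cst 3) (V 1))) ;;
    Asg 6 k ;; Push 6 (V 4) ;; Push 6 (V 5) ;; Push 6 (V 2) ;;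
    If (Op OEq (Low (V 1) (Cst 1)) (Cst par))
      (Call (ind_chooser otc) [:: 6] [:: 2])
      (For 7 (V 4) (Push 6 (Get 0 (Add (V 3) (V 7)))) ;;
       Asg 3 (Add (V 3) (V 4)) ;;
       Call (ind_sender ots) [:: 6] [:: 2]) ;;
    Asg 1 (Add (V 1) (Cst 1))) ;;
  Asg 0 (V 2).

Definition gind_alice (ots otc : cmd) : cmd := gind_party ots otc true.
Definition gind_bob (ots otc : cmd) : cmd := gind_party ots otc false.

(* Main.v *)
(** Whatever the other party holds, the share of the index that a party gets at a
    level is uniform, and apart from it the party sees one coin and its view of
    one oblivious transfer.  A simulator hence draws uniform shares, fills every
    level with the simulated view of the oblivious transfer, and at the last
    level overwrites the low bits of its coin so as to end up with the prescribed
    output.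

    Levels are replaced one by one.  That the chooser receives the right string
    with overwhelming probability follows from the privacy of the transfer, each
    bit of that string being tested by a one-gate circuit; once the string is
    corrected, the rest of the run depends on the shares only and its coins can
    be averaged out.  A circuit telling the two runs apart then yields one for a
    single oblivious transfer: the rest of the view is hardwired, separately for
    each of the polynomially many sizes that the inserted view can have. *)

Require Import Defs.
From mathcomp Require Import all_boot all_order all_algebra.
From mathcomp Require Import zify ring lra.
From Stdlib Require Import FunctionalExtensionality.

Set Implicit Arguments.
Unset Strict Implicit.
Unset Printing Implicit Defensive.

Import Order.TTheory GRing.Theory Num.Theory.

(** * Expectations over coin trees *)

Section Expectation.
Local Open Scope ring_scope.

(** [run] lets the first process move whenever it can, so exchanging the parties or cutting a run
    into levels permutes the coins of the tree. Runs are therefore compared through expectations,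
    which do not see the order of the coins, and a property of all outcomes becomes the vanishing of
    the expectation of its negation.

    The replacement goes from the last level to the first, so that what follows an inserted view is
    already a simulation, driven by the share of the observed party alone.

    [WOT] is an arbitrary function, hence gives no polynomial bound on a real view, whereas the
    circuits with hardwired views need a bound on the size of the inserted one. That bound comes
    from the running time of the simulators; it carries over to real views up to a negligible
    probability, because a single gate detects a longer array. *)

Definition avg (n : nat) (F : nat -> rat) : rat :=
  (\sum_(r < 2 ^ n) F r) / (2 ^ n)%:R.

Fixpoint expect (T : Type) (f : T -> rat) (t : rtree T) : rat :=
  match t with
  | Leaf x => f x
  | Coin n g => avg n (fun r => expect f (g r))
  end.

Lemma pow2_gt0 n : 0 < (2 ^ n)%:R :> rat.
Proof. by rewrite ltr0n expn_gt0. Qed.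

Lemma eq_avg n F G : (forall r, (r < 2 ^ n)%N -> F r = G r) -> avg n F = avg n G.
Proof. by move=> h; congr (_ / _); apply: eq_bigr => r _; apply: h. Qed.

Lemma le_avg n F G :
  (forall r, (r < 2 ^ n)%N -> F r <= G r) -> avg n F <= avg n G.
Proof.
move=> h; rewrite ler_pM2r ?invr_gt0 ?pow2_gt0 //.
by apply: ler_sum => r _; apply: h.
Qed.

Lemma avg_cst n x : avg n (fun=> x) = x.
Proof.
by rewrite /avg sumr_const card_ord -(mulr_natr x) mulfK // gt_eqF ?pow2_gt0.
Qed.

Lemma avgD n F G : avg n (fun r => F r + G r) = avg n F + avg n G.
Proof. by rewrite /avg big_split mulrDl. Qed.

Lemma avgB n F G : avg n (fun r => F r - G r) = avg n F - avg n G.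
Proof. by rewrite /avg sumrB mulrBl. Qed.

Lemma avg_sum n m (F : nat -> nat -> rat) :
  avg n (fun r => \sum_(s < m) F s r) = \sum_(s < m) avg n (F s).
Proof. by rewrite /avg exchange_big -mulr_suml. Qed.

Lemma exchange_avg n m (F : nat -> nat -> rat) :
  avg n (fun r => avg m (F r)) = avg m (fun s => avg n (F^~ s)).
Proof.
rewrite /avg -!mulr_suml exchange_big /= -!mulrA; congr (_ * _).
by rewrite mulrC.
Qed.

Lemma ler_norm_avg n F : `|avg n F| <= avg n (fun r => `|F r|).
Proof.
rewrite /avg normrM [X in _ * X]ger0_norm ?invr_ge0 ?ler0n //.
by rewrite ler_pM2r ?invr_gt0 ?pow2_gt0 // ler_norm_sum.
Qed.

Lemma avg_dist_le n F G x :
  (forall r, (r < 2 ^ n)%N -> `|F r - G r| <= x) -> `|avg n F - avg n G| <= x.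
Proof.
move=> h; rewrite -avgB (le_trans (ler_norm_avg _ _)) // -[leRHS](avg_cst n).
exact: le_avg.
Qed.

Section OneTree.
Variable T : Type.
Implicit Types (t : rtree T) (f g : T -> rat) (Q : T -> Prop).

Lemma probE (P : T -> bool) t : prob P t = expect (fun x => (P x)%:R) t.
Proof.
elim: t => //= n g IH; congr (_ / _); apply: eq_bigr => r _; exact: IH.
Qed.

Lemma every_imp Q Q' t : (forall x, Q x -> Q' x) -> every Q t -> every Q' t.
Proof. by move=> h; elim: t => [x /h|n g IH /= H r /H /IH]. Qed.

Lemma every_all Q t : (forall x, Q x) -> every Q t.
Proof. by move=> h; elim: t => //= n g IH r _; apply: IH. Qed.

Lemma every_and Q Q' t :
  every Q t -> every Q' t -> every (fun x => Q x /\ Q' x) t.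
Proof.
by elim: t => [x|n g IH /= H H' r lr] //=; apply: IH; [apply: H | apply: H'].
Qed.

Lemma eq_expect_every f g t :
  every (fun x => f x = g x) t -> expect f t = expect g t.
Proof. by elim: t => //= n h IH H; apply: eq_avg => r /H /IH. Qed.

Lemma eq_expect f g t : f =1 g -> expect f t = expect g t.
Proof. by move=> h; apply: eq_expect_every; apply: every_all. Qed.

Lemma le_expect_every f g t :
  every (fun x => f x <= g x) t -> expect f t <= expect g t.
Proof. by elim: t => //= n h IH H; apply: le_avg => r /H /IH. Qed.

Lemma le_expect f g t : (forall x, f x <= g x) -> expect f t <= expect g t.
Proof. by move=> h; apply: le_expect_every; apply: every_all. Qed.

Lemma expect_cst x t : expect (fun=> x) t = x.
Proof.
elim: t => //= n g IH; rewrite -[RHS](avg_cst n); apply: eq_avg => r _; exact: IH.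
Qed.

Lemma expectD f g t : expect (fun x => f x + g x) t = expect f t + expect g t.
Proof.
elim: t => //= n h IH; rewrite -avgD; apply: eq_avg => r _; exact: IH.
Qed.

Lemma expectB f g t : expect (fun x => f x - g x) t = expect f t - expect g t.
Proof.
elim: t => //= n h IH; rewrite -avgB; apply: eq_avg => r _; exact: IH.
Qed.

Lemma expect_sum m (F : nat -> T -> rat) t :
  expect (fun x => \sum_(s < m) F s x) t = \sum_(s < m) expect (F s) t.
Proof.
elim: t => //= n h IH; rewrite -(avg_sum n m (fun s r => expect (F s) (h r))).
apply: eq_avg => r _; exact: IH.
Qed.

Lemma expect_avg n (F : nat -> T -> rat) t :
  expect (fun x => avg n (fun r => F r x)) t = avg n (fun r => expect (F r) t).
Proof.
elim: t => //= m h IH; rewrite exchange_avg; apply: eq_avg => r _; exact: IH.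
Qed.

Lemma expect_ge0 f t : (forall x, 0 <= f x) -> 0 <= expect f t.
Proof. by move=> h; rewrite -[leLHS](expect_cst 0 t) le_expect. Qed.

Lemma expect_dist f g t :
  `|expect f t - expect g t| <= expect (fun x => `|f x - g x|) t.
Proof.
elim: t => //= n h IH; rewrite -avgB (le_trans (ler_norm_avg _ _)) //.
by apply: le_avg => r _; apply: IH.
Qed.

Lemma expect_dist_le f g x t :
  every (fun y => `|f y - g y| <= x) t -> `|expect f t - expect g t| <= x.
Proof.
move=> h; rewrite (le_trans (expect_dist _ _ _)) // -[leRHS](expect_cst x t).
exact: le_expect_every.
Qed.

(** A sum of nonnegative terms vanishes only if each term does. Thus a property of all outcomes can
    be moved along any equality of expectations, even between trees of different shapes. *)
Lemma every_expect (P : T -> bool) t :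
  every P t <-> expect (fun x => (~~ P x)%:R) t = 0.
Proof.
split.
  move=> h; rewrite -(expect_cst 0 t); apply: eq_expect_every.
  by apply: every_imp h => x ->.
elim: t => [x|n g IH] /=.
  by case: (P x) => //= /eqP; rewrite oner_eq0.
move=> /eqP; rewrite mulf_eq0 invr_eq0 [X in _ || X]gt_eqF ?pow2_gt0 // orbF => H r lr.
apply: IH.
have ge0 (s : 'I_(2 ^ n)) : true -> 0 <= expect (fun x => (~~ P x)%:R : rat) (g s).
  by move=> _; apply: expect_ge0 => x; rewrite ler0n.
by move: H; rewrite psumr_eq0 // => /allP /(_ (Ordinal lr)); rewrite mem_index_enum => /(_ isT) /eqP.
Qed.

End OneTree.

Lemma expect_bind T U (f : U -> rat) (t : rtree T) (k : T -> rtree U) :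
  expect f (rbind t k) = expect (fun x => expect f (k x)) t.
Proof. by elim: t => //= n g IH; apply: eq_avg => r _; apply: IH. Qed.

Lemma every_bind T U (Q : U -> Prop) (t : rtree T) (k : T -> rtree U) :
  every Q (rbind t k) <-> every (fun x => every Q (k x)) t.
Proof. by elim: t => //= n g IH; split=> h r lr; apply/IH/h. Qed.

Lemma exchange_expect T U (F : T -> U -> rat) (t : rtree T) (u : rtree U) :
  expect (fun x => expect (F x) u) t = expect (fun y => expect (F^~ y) t) u.
Proof.
elim: t => //= n g IH; rewrite expect_avg; apply: eq_avg => r _; exact: IH.
Qed.

End Expectation.

(** * Exclusive or *)

Lemma pow2E n : PeanoNat.Nat.pow 2 n = 2 ^ n.
Proof. by elim: n => //= n ->; rewrite expnS; lia. Qed.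

Lemma natmodE a n : PeanoNat.Nat.modulo a (2 ^ n) = a %% 2 ^ n.
Proof.
have n0 : 2 ^ n <> 0 by have := expn_gt0 2 n; lia.
apply: esym; apply: (PeanoNat.Nat.mod_unique a _ (a %/ 2 ^ n)).
  by apply/ssrnat.ltP; rewrite ltn_pmod ?expn_gt0.
by rewrite {1}(divn_eq a (2 ^ n)); lia.
Qed.

Lemma testbit_low a n t :
  Nat.testbit (a %% 2 ^ n) t = (t < n) && Nat.testbit a t.
Proof.
rewrite -natmodE -pow2E; case: ltnP => h /=.
  by rewrite PeanoNat.Nat.mod_pow2_bits_low //; apply/ssrnat.ltP.
by rewrite PeanoNat.Nat.mod_pow2_bits_high //; apply/ssrnat.leP.
Qed.

Lemma lxor_low a c n :
  Nat.lxor a c %% 2 ^ n = Nat.lxor (a %% 2 ^ n) (c %% 2 ^ n).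
Proof.
apply: PeanoNat.Nat.bits_inj => t.
by rewrite PeanoNat.Nat.lxor_spec !testbit_low PeanoNat.Nat.lxor_spec; case: (t < n).
Qed.

Lemma lxor_lt a c n : a < 2 ^ n -> c < 2 ^ n -> Nat.lxor a c < 2 ^ n.
Proof.
move=> la lc; rewrite -(modn_small la) -(modn_small lc) -lxor_low.
by rewrite ltn_pmod ?expn_gt0.
Qed.

Lemma lxorK a c : Nat.lxor (Nat.lxor a c) c = a.
Proof.
by rewrite PeanoNat.Nat.lxor_assoc PeanoNat.Nat.lxor_nilpotent PeanoNat.Nat.lxor_0_r.
Qed.

Lemma lxorKl a c : Nat.lxor a (Nat.lxor a c) = c.
Proof.
by rewrite -PeanoNat.Nat.lxor_assoc PeanoNat.Nat.lxor_nilpotent PeanoNat.Nat.lxor_0_l.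
Qed.

Lemma lxorC a c : Nat.lxor a c = Nat.lxor c a.
Proof. exact: PeanoNat.Nat.lxor_comm. Qed.

Lemma lxorA a c d : Nat.lxor a (Nat.lxor c d) = Nat.lxor (Nat.lxor a c) d.
Proof. by rewrite PeanoNat.Nat.lxor_assoc. Qed.

(** Translation by a fixed word permutes {0,1}^n. This is the one-time pad: a received share is as
    uniform as a drawn one. *)
Lemma avg_lxor n d (F : nat -> rat) : d < 2 ^ n ->
  avg n (fun r => F (Nat.lxor r d)) = avg n F.
Proof.
move=> ld; rewrite /avg; congr (_ / _)%R.
pose h (r : 'I_(2 ^ n)) := Ordinal (lxor_lt (ltn_ord r) ld).
have hK : involutive h by move=> r; apply: val_inj; rewrite /= lxorK.
by rewrite [RHS](reindex_inj (inv_inj hK)).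
Qed.

(* Overwriting the [m] low bits of a uniform [n]-bit word by a uniform [m]-bit
   word leaves it uniform: exchange the roles of the word [g] and of
   [d = g xor (low bits of r)]. *)
Lemma avg_patch m n (K : nat -> nat -> rat) : m <= n ->
  avg m (fun g => avg n (fun r => K g (Nat.lxor (Nat.lxor r (r %% 2 ^ m)) g)))
  = avg n (fun r => K (r %% 2 ^ m) r).
Proof.
move=> le_mn; rewrite exchange_avg.
have lm r : r %% 2 ^ m < 2 ^ m by rewrite ltn_pmod ?expn_gt0.
transitivity (avg n (fun r => avg m (fun d =>
    K (Nat.lxor r d %% 2 ^ m) (Nat.lxor r d)))).
  apply: eq_avg => r _; rewrite -(avg_lxor _ (lm r)); apply: eq_avg => d ld.
  by rewrite lxor_low (modn_small ld) [Nat.lxor d _]lxorC lxorA lxorK.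
rewrite exchange_avg -[RHS](avg_cst m); apply: eq_avg => d ld.
have ld' : d < 2 ^ n by rewrite (leq_trans ld) ?leq_pexp2l.
by rewrite (avg_lxor (fun r => K (r %% 2 ^ m) r) ld').
Qed.

(** * Running two processes *)

Lemma pbindA T U W (p : proc T) (k : T -> proc U) (h : U -> proc W) :
  pbind (pbind p k) h = pbind p (fun x => pbind (k x) h).
Proof.
elim: p => //= [n q -> //|f IH|m q -> //|f IH].
  by congr (Toss _); apply: functional_extensionality => r; apply: IH.
by congr (Take _); apply: functional_extensionality => m; apply: IH.
Qed.

(* [reds p n q]: [q] is what remains of [p] after at most [n] units of purely
   local work. *)
Inductive reds (T : Type) : proc T -> nat -> proc T -> Prop :=
| RedsRefl p n : reds p n p
| RedsTick m q n n' r : reds q n r -> m + n <= n' -> reds (Tick m q) n' r.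

Lemma reds_bind T U (p q : proc T) n (k : T -> proc U) :
  reds p n q -> reds (pbind p k) n (pbind q k).
Proof.
by elim=> [p' n'|m q' n1 n2 r _ IH le] /=; [apply: RedsRefl | apply: RedsTick le].
Qed.

Lemma reds_trans T (p q r : proc T) n m :
  reds p n q -> reds q m r -> reds p (n + m) r.
Proof.
move=> h; elim: h m r => [p' n'|m q' n1 n2 r _ IH le] m' r' h'.
  elim: h' => [p0 n0|m0 q0 n1 n2 r0 h0 _ le]; first exact: RedsRefl.
  by apply: (RedsTick h0); lia.
by apply: (RedsTick (IH _ _ h')); lia.
Qed.

Lemma reds_weak T (p q : proc T) n m : reds p n q -> n <= m -> reds p m q.
Proof.
case=> [p' n'|m' q' n1 n2 r h le] le'; first exact: RedsRefl.
by apply: (RedsTick h); lia.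
Qed.

Definition addlog (a l : log) : log :=
  Log (steps a + steps l) (coins a ++ coins l) (rcvd a ++ rcvd l) (sent a ++ sent l).

Lemma addlog0 l : addlog l log0 = l.
Proof. by case: l => s c r t; rewrite /addlog /= addn0 !cats0. Qed.

Lemma log_step_step m n l : log_step m (log_step n l) = log_step (n + m) l.
Proof. by rewrite /log_step /= addnCA addnA. Qed.

Lemma addlog_step n a l : addlog a (log_step n l) = log_step n (addlog a l).
Proof. by rewrite /addlog /log_step /= addnCA. Qed.

Lemma addlog_coin r a l : addlog a (log_coin r l) = log_coin r (addlog a l).
Proof. by rewrite /addlog /log_coin /= rcons_cat. Qed.

Lemma addlog_rcvd r a l : addlog a (log_rcvd r l) = log_rcvd r (addlog a l).
Proof. by rewrite /addlog /log_rcvd /= rcons_cat. Qed.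

Lemma addlog_sent r a l : addlog a (log_sent r l) = log_sent r (addlog a l).
Proof. by rewrite /addlog /log_sent /= rcons_cat. Qed.

Definition swap (o : outcome) : outcome :=
  Outcome (halted o) (fin2 o) (fin1 o) (log2 o) (log1 o).

Definition after (a1 a2 : log) (o : outcome) : outcome :=
  Outcome (halted o) (fin1 o) (fin2 o) (addlog a1 (log1 o)) (addlog a2 (log2 o)).

Section Run.
Variable b : nat.
Implicit Types (p q : proc store) (l : log) (f : outcome -> rat).
Local Notation run := (run b).

(** The exact cost [m] is chosen before the logs and the partner, so that the conclusion is an
    equation usable for rewriting; only the bound on [m] matters later. *)
Lemma run_reds p n q : reds p n q ->
  exists2 m, m <= n & forall l p2 l2, run p l p2 l2 = run q (log_step m l) p2 l2.
Proof.
elim=> [p' n'|m q' n1 n2 r _ [m' le' IH] le].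
  by exists 0 => // l p2 l2; congr (run _ _ _ _); case: l.
exists (m + m'); first lia.
by move=> l p2 l2 /=; rewrite IH log_step_step.
Qed.

Lemma expect_run_tick2 f p l1 n q l2 :
  expect f (run p l1 (Tick n q) l2) = expect f (run p l1 q (log_step n l2)).
Proof.
elim: p l1 n q l2 => [s|n' p IH|g IH|m p _|g _] l1 n q l2 //=.
by apply: eq_avg => r _; apply: IH.
Qed.

(** [run] exhausts the moves of [p] before it reaches this [Toss], so coins of [p] may end up above
    it; bringing it to the top is an exchange of averages. *)
Lemma expect_run_toss2 f p l1 (g : nat -> proc store) l2 :
  expect f (run p l1 (Toss g) l2)
  = avg b (fun r => expect f (run p l1 (g r) (log_coin r l2))).
Proof.
elim: p l1 g l2 => [s|n' p IH|h IH|m p _|h _] l1 g l2 //=.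
by rewrite exchange_avg; apply: eq_avg => r _; apply: IH.
Qed.

(** Local moves of the second process can be played first by the two preceding lemmas, and messages
    are matched symmetrically. Every fact about the first process thereby holds for the second
    one. *)
Lemma expect_run_swap f p1 l1 p2 l2 :
  expect f (run p1 l1 p2 l2) = expect (f \o swap) (run p2 l2 p1 l1).
Proof.
elim: p1 l1 p2 l2 => [s|n p IH|g IH|m p IH|g IH] l1 p2 l2.
- elim: p2 l2 => [s2|n q IH|h IH|m q _|h _] l2 //=.
  by apply: eq_avg => r _; rewrite IH.
- by rewrite expect_run_tick2 /= IH.
- by rewrite expect_run_toss2 /=; apply: eq_avg => r _; rewrite IH.
- elim: p2 l2 => [s2|n q IH2|h IH2|m2 q _|h _] l2 //=.
  by apply: eq_avg => r _; rewrite IH2.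
- elim: p2 l2 => [s2|n q IH2|h IH2|m q _|h _] l2 //=.
  by apply: eq_avg => r _; rewrite IH2.
Qed.

Lemma every_run_swap (P : outcome -> bool) p1 l1 p2 l2 :
  every P (run p1 l1 p2 l2) <-> every (P \o swap) (run p2 l2 p1 l1).
Proof. by rewrite !every_expect expect_run_swap. Qed.

(** Logs are written and never read. A transfer in the middle of the protocol can thus be replaced
    by one that starts from empty logs, which is what the hypotheses on [ots] and [otc] speak of. *)
Lemma expect_run_after f p1 a1 l1 p2 a2 l2 :
  expect f (run p1 (addlog a1 l1) p2 (addlog a2 l2))
  = expect (f \o after a1 a2) (run p1 l1 p2 l2).
Proof.
elim: p1 l1 p2 l2 => [s|n p IH|g IH|m p IH|g IH] l1 p2 l2.
- elim: p2 l2 => [s2|n q IH|h IH|m q _|h _] l2 //=; first by rewrite -addlog_step IH.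
  by apply: eq_avg => r _; rewrite -addlog_coin IH.
- by rewrite /= -addlog_step IH.
- by move=> /=; apply: eq_avg => r _; rewrite -addlog_coin IH.
- elim: p2 l2 => [s2|n q IH2|h IH2|m2 q _|h _] l2 //=; first by rewrite -addlog_step IH2.
    by apply: eq_avg => r _; rewrite -addlog_coin IH2.
  by rewrite -addlog_rcvd -addlog_sent IH.
- elim: p2 l2 => [s2|n q IH2|h IH2|m q _|h _] l2 //=; first by rewrite -addlog_step IH2.
    by apply: eq_avg => r _; rewrite -addlog_coin IH2.
  by rewrite -addlog_rcvd -addlog_sent IH.
Qed.

Lemma expect_run0 f p1 l1 p2 l2 :
  expect f (run p1 l1 p2 l2) = expect (f \o after l1 l2) (run p1 log0 p2 log0).
Proof. by rewrite -expect_run_after !addlog0. Qed.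

(* A party that is done with its first phase may run ahead into its second one;
   as the first phases halt on their own, the other party no longer
   communicates in its first phase. *)
Lemma expect_run_bind f p1 l1 p2 l2 (k1 k2 : store -> proc store) :
  every halted (run p1 l1 p2 l2) ->
  expect f (run (pbind p1 k1) l1 (pbind p2 k2) l2)
  = expect (fun o => expect f (run (k1 (fin1 o)) (log1 o) (k2 (fin2 o)) (log2 o)))
      (run p1 l1 p2 l2).
Proof.
elim: p1 l1 p2 l2 => [s|n p IH|g IH|m p IH|g IH] l1 p2 l2 /=.
- elim: p2 l2 => [s2|n q IH|h IH|m q _|h _] l2 //= H; first by rewrite expect_run_tick2 IH.
  by rewrite expect_run_toss2; apply: eq_avg => r lr; rewrite IH //; apply: H.
- exact: IH.
- by move=> H; apply: eq_avg => r lr; rewrite IH //; apply: H.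
- elim: p2 l2 => [s2|n q IH2|h IH2|m2 q _|h _] l2 //= H; first by rewrite IH2.
    by apply: eq_avg => r lr; rewrite IH2 //; apply: H.
  by rewrite IH.
- elim: p2 l2 => [s2|n q IH2|h IH2|m q _|h _] l2 //= H; first by rewrite IH2.
    by apply: eq_avg => r lr; rewrite IH2 //; apply: H.
  by rewrite IH.
Qed.

(* [sized M p]: every array that [p] leaves is no longer than [M] plus the work
   done by [p]. *)
Fixpoint sized (M : nat) (p : proc store) : Prop :=
  match p with
  | Ret s => forall x, size (s x) <= M
  | Tick n q => sized (n + M) q
  | Toss f => forall r, sized M (f r)
  | Put _ q => sized M q
  | Take f => forall m, sized M (f m)
  end.

Lemma sized_bind M p (k : store -> proc store) : sized M p ->
  (forall M' s, M <= M' -> (forall x, size (s x) <= M') -> sized M' (k s)) ->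
  sized M (pbind p k).
Proof.
elim: p M => [s|n q IH|g IH|m q IH|g IH] M /= H Hk.
- exact: Hk.
- by apply: IH => // M' s le; apply: Hk; lia.
- by move=> r; apply: IH.
- exact: IH.
- by move=> r; apply: IH.
Qed.

(** An instruction lengthens an array by at most one word and costs at least one unit; [Call] only
    copies arrays that already obey the bound. This turns bounds on work into bounds on the outputs
    of subroutines. *)
Lemma sized_denote c s M : (forall x, size (s x) <= M) -> sized M (denote b c s).
Proof.
have upd_le (t : store) x v N : (forall y, size (t y) <= N) -> size v <= N ->
    forall y, size (upd t x v y) <= N.
  by move=> h hv y; rewrite /upd; case: ifP.
elim: c s M => //=.
- by move=> s M h x; apply: (leq_trans (h x)); lia.
- by move=> x e s M h; apply: upd_le => [y|] /=; [apply: (leq_trans (h y)) |]; lia.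
- by move=> x s M h; apply: upd_le => // y; apply: (leq_trans (h y)); lia.
- move=> x e s M h; apply: upd_le => [y|]; first by apply: (leq_trans (h y)); lia.
  by rewrite size_rcons; have := h x; lia.
- move=> x e e' s M h y; apply: (@leq_trans M); last lia.
  case: ifP => // lt; move: y; apply: upd_le => //.
  by rewrite size_set_nth; move: (h x) lt; rewrite /maxn; case: ifP; lia.
- move=> x s M h r; apply: upd_le => [y|]; first by apply: (leq_trans (h y)); lia.
  by rewrite size_rcons; have := h x; lia.
- by move=> e s M h x; apply: (leq_trans (h x)); lia.
- move=> x s M h r; apply: upd_le => [y|]; first by apply: (leq_trans (h y)); lia.
  by rewrite size_rcons; have := h x; lia.
- move=> c1 IH1 c2 IH2 s M h; apply: sized_bind; first exact: IH1.
  by move=> M' s' _; apply: IH2.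
- move=> e c1 IH1 c2 IH2 s M h.
  by case: ifP => _; [apply: IH1 | apply: IH2] => x; apply: (leq_trans (h x)); lia.
- move=> n e c IH s M h.
  have: forall x, size (s x) <= (cost n).+1 + M.
    by move=> x; apply: (leq_trans (h x)); lia.
  move: (eval b s n) (_ + M) {h} => N M'.
  elim: N s M' => [|N IHN] s M' h //=.
  have h' x : size (s x) <= (cost e).+1 + M' by apply: (leq_trans (h x)); lia.
  case: ifP => _ //; apply: sized_bind; first exact: IH.
  by move=> M2 s2 _; apply: IHN.
- move=> c IH xs ys s M h; apply: sized_bind.
    apply: IH => x; rewrite /load; case: (ltnP x (size xs)) => lt.
      by rewrite (nth_map 0) //; apply: (leq_trans (h _)); lia.
    by rewrite nth_default ?size_map.
  move=> M' s' le h' /= x; case: ifP => _.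
    by apply: (leq_trans (h' _)); lia.
  by apply: (leq_trans (h x)); lia.
Qed.

Lemma run_sized M p1 l1 p2 l2 : sized (M + steps l1) p1 ->
  every (fun o => forall x, size (fin1 o x) <= M + steps (log1 o)) (run p1 l1 p2 l2).
Proof.
have dd l l' : every (fun o => forall x, size (fin1 o x) <= M + steps (log1 o))
    (dead l l').
  by move=> x /=; rewrite /load nth_nil.
elim: p1 l1 p2 l2 => [s|n p IH|g IH|m p IH|g IH] l1 p2 l2 /= H.
- elim: p2 l2 => [s2|n q IH|h IH|m q _|h _] l2 //=; try exact: dd.
- by apply: IH; move: H; rewrite /= addnCA.
- by move=> r lr; apply: IH.
- elim: p2 l2 => [s2|n q IH2|h IH2|m' q _|h _] l2 //=; try exact: dd.
  exact: IH.
- elim: p2 l2 => [s2|n q IH2|h IH2|m' q _|h _] l2 //=; try exact: dd.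
  exact: IH.
Qed.

Lemma run_steps_ge n p1 l1 p2 l2 : n <= steps l1 ->
  every (fun o => n <= steps (log1 o)) (run p1 l1 p2 l2).
Proof.
elim: p1 l1 p2 l2 => [s|m p IH|g IH|m p IH|g IH] l1 p2 l2 /= H.
- by elim: p2 l2 => [s2|n' q IH|h IH|m q _|h _] l2 //= r lr; apply: IH.
- by apply: IH => /=; lia.
- by move=> r lr; apply: IH.
- elim: p2 l2 => [s2|n' q IH2|h IH2|m2 q _|h _] l2 //=;
  solve [exact: IH | by move=> r lr; apply: IH2].
- elim: p2 l2 => [s2|n' q IH2|h IH2|m2 q _|h _] l2 //=;
  solve [exact: IH | by move=> r lr; apply: IH2].
Qed.

Lemma denote_tick c s : exists n p, denote b c s = Tick n.+1 p.
Proof.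
elim: c s => [|x e|x|x e|x i e|x|e|x|c1 IH1 c2 _|e c1 _ c2 _|n e c _|c _ xs ys] s;
  do ?[by eexists; eexists; reflexivity].
by have [n [p /= ->]] := IH1 s; exists n; eexists.
Qed.

End Run.

(** * A process without partner *)

(** [solo] runs a simulator against [Skip], which answers no message, so any communication is a dead
    end. Only the halting flag, the store and the accumulated work are kept. *)
Fixpoint srun (b : nat) (p : proc store) (n : nat) : rtree (bool * store * nat) :=
  match p with
  | Ret s => Leaf (true, s, n)
  | Tick m q => srun b q (m + n)
  | Toss g => Coin b (fun r => srun b (g r) n)
  | Put _ _ | Take _ => Leaf (false, load [::], n)
  end.

Section Solo.
Variable b : nat.

Lemma expect_solo (f : bool * store * nat -> rat) c xs :
  expect (fun o => f (halted o, fin1 o, steps (log1 o))) (solo b c xs)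
  = expect f (srun b (denote b c (load xs)) 0).
Proof.
suff H p l l2 :
    expect (fun o => f (halted o, fin1 o, steps (log1 o)))
      (run b p l (Tick 1 (Ret (load [::]))) l2) = expect f (srun b p (steps l)).
  exact: H.
elim: p l l2 => [s|n q IH|g IH|m q IH|g IH] l l2 //=.
by apply: eq_avg => r _; rewrite IH.
Qed.

Lemma every_solo (P : bool * store * nat -> bool) c xs :
  every (fun o => P (halted o, fin1 o, steps (log1 o))) (solo b c xs)
  <-> every P (srun b (denote b c (load xs)) 0).
Proof.
rewrite !every_expect.
by rewrite (expect_solo (fun x => (~~ P x)%:R)%R).
Qed.

Lemma srun_reds p n q : reds p n q ->
  exists2 m, m <= n & forall l, srun b p l = srun b q (m + l).
Proof.
elim=> [p' n'|m q' n1 n2 r _ [m' le' IH] le]; first by exists 0.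
exists (m' + m); first lia.
by move=> l /=; rewrite IH addnA.
Qed.

Lemma expect_srun_bind f p (k : store -> proc store) n :
  expect f (srun b (pbind p k) n)
  = expect (fun x => if x.1.1 then expect f (srun b (k x.1.2) x.2) else f x)
      (srun b p n).
Proof.
elim: p n => [s|m q IH|g IH|m q IH|g IH] n //=.
by apply: eq_avg => r _; apply: IH.
Qed.

Lemma expect_srun_add f p m n :
  expect f (srun b p (m + n))
  = expect (fun x => f (x.1, m + x.2)) (srun b p n).
Proof.
elim: p n => [s|k q IH|g IH|k q IH|g IH] n //=.
- by rewrite addnCA IH.
- by apply: eq_avg => r _; apply: IH.
Qed.

Lemma srun_sized M p n : sized (M + n) p ->
  every (fun x => forall y, size (x.1.2 y) <= M + x.2) (srun b p n).
Proof.
elim: p n => [s|k q IH|g IH|k q IH|g IH] n //= H.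
- by apply: IH; move: H; rewrite addnCA.
- by move=> r lr; apply: IH.
- by move=> y; rewrite /load nth_nil.
- by move=> y; rewrite /load nth_nil.
Qed.

End Solo.

(** * Symbolic execution *)

Section Rules.
Variable b : nat.
Implicit Types (s : store) (e : expr) (c : cmd).
Local Notation denote := (denote b).

Definition dets c s n s' := reds (denote c s) n (Ret s').

Lemma reds_seq c1 c2 s n1 s1 n2 q : dets c1 s n1 s1 ->
  reds (denote c2 s1) n2 q -> reds (denote (Seq c1 c2) s) (n1 + n2) q.
Proof. by move=> /(reds_bind (denote c2)) h1 h2; apply: reds_trans h1 h2. Qed.

Lemma dets_asg x e s v : eval b s e = v ->
  dets (Asg x e) s (cost e).+1 (upd s x [:: v]).
Proof. by move=> <-; apply: (RedsTick (RedsRefl _ 0)); rewrite addn0. Qed.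

Lemma dets_push x e s v : eval b s e = v ->
  dets (Push x e) s (cost e).+1 (upd s x (rcons (s x) v)).
Proof. by move=> <-; apply: (RedsTick (RedsRefl _ 0)); rewrite addn0. Qed.

Lemma dets_clr x s : dets (Clr x) s 1 (upd s x [::]).
Proof. exact: (RedsTick (RedsRefl _ 0)). Qed.

Lemma dets_skip s : dets Skip s 1 s.
Proof. exact: (RedsTick (RedsRefl _ 0)). Qed.

Lemma dets_upd x e e' s m v : eval b s e = m -> eval b s e' = v -> m < size (s x) ->
  dets (Upd x e e') s (cost e + cost e').+1 (upd s x (set_nth 0 (s x) m v)).
Proof.
move=> <- <- lt; apply: (RedsTick (q := Ret _) (n := 0)); last by rewrite addn0.
by rewrite lt; apply: RedsRefl.
Qed.

Lemma reds_if (t : bool) e c1 c2 s : eval b s e = t ->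
  reds (denote (If e c1 c2) s) (cost e).+1 (denote (if t then c1 else c2) s).
Proof.
move=> he; rewrite /= he; apply: (RedsTick (n := 0)); last by rewrite addn0.
by case: t {he}; apply: RedsRefl.
Qed.

Lemma reds_seq_if (t : bool) e c1 c2 d s : eval b s e = t ->
  reds (denote (Seq (If e c1 c2) d) s) (cost e).+1
    (denote (Seq (if t then c1 else c2) d) s).
Proof. by move=> /reds_if h; apply: (reds_bind (denote d) (h c1 c2)). Qed.

Definition wloop e c := fix loop (n : nat) s {struct n} : proc store :=
  if n is n'.+1 then
    Tick (cost e).+1
      (if eval b s e != 0 then pbind (denote c s) (loop n') else Ret s)
  else Ret s.

Lemma denote_while n e c s :
  denote (While n e c) s = Tick (cost n).+1 (wloop e c (eval b s n) s).
Proof. by []. Qed.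

Lemma wloopS c n s : 0 < b ->
  wloop (Cst 1) c n.+1 s = Tick 2 (pbind (denote c s) (wloop (Cst 1) c n)).
Proof.
by move=> b0; rewrite /= modn_small // -[1]/(2 ^ 0) ltn_exp2l.
Qed.

(* [st a] is the store at the beginning of round [a], and [t a] the store before
   the index is incremented. *)
Lemma dets_for x e c s N B (st t : nat -> store) : 0 < b ->
  eval b (upd s x [:: 0]) e = N -> N < 2 ^ b -> st 0 = upd s x [:: 0] ->
  (forall a, a < N -> dets c (st a) B (t a)) ->
  (forall a, a < N -> t a x = [:: a]) ->
  (forall a, a < N -> st a.+1 = upd (t a) x [:: a.+1]) ->
  dets (For x e c) s ((cost e).+3 + N * (B + 7)) (st N).
Proof.
move=> b0 he lN st0 hc ht hst.
have h2 : 2 <= 2 ^ b by rewrite -{1}[2]/(2 ^ 1) leq_exp2l.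
have loop m a : a + m = N ->
    reds (wloop (Cst 1) (Seq c (Asg x (Add (V x) (Cst 1)))) m (st a))
      (m * (B + 7)) (Ret (st N)).
  elim: m a => [|m IH] a; first by rewrite addn0 => ->; apply: RedsRefl.
  move=> ha; rewrite wloopS // mulSn.
  (* A round costs 2 for the test, [B] for the body and 5 for the increment. *)
  apply: (RedsTick (n := B + 5 + m * (B + 7))); last lia.
  have lta : a < N by lia.
  apply: (@reds_trans _ _ (wloop (Cst 1) (Seq c (Asg x (Add (V x) (Cst 1)))) m (st a.+1))).
    apply: (@reds_bind _ _ _ (Ret (st a.+1))); apply: reds_seq (hc _ lta) _.
    rewrite hst //; apply: dets_asg.
    by rewrite /= ht // mod0n /= (modn_small h2) modn_small; lia.
  by apply: IH; lia.
apply: (@reds_weak _ _ _ (2 + ((cost e).+1 + N * (B + 7)))); last lia.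
apply: (reds_seq (s1 := st 0)); first by rewrite st0; apply: (dets_asg _ (v := 0)); rewrite /= mod0n.
rewrite denote_while {1}st0 he; apply: RedsTick (loop N 0 _) _ => //.
Qed.

(** The pushed expression is evaluated under arbitrary contents [ys] of [y], so its value may not
    depend on the part already built; no invariant on [y] is needed in applications. *)
Lemma dets_for_push x e y e' s N (g : nat -> nat) : 0 < b -> x != y ->
  eval b (upd s x [:: 0]) e = N -> N < 2 ^ b ->
  (forall a ys, a < N -> eval b (upd (upd s x [:: a]) y ys) e' = g a) ->
  dets (For x e (Push y e')) s ((cost e).+3 + N * (cost e' + 8))
    (upd (upd s x [:: N]) y (s y ++ mkseq g N)).
Proof.
move=> b0 ne he lN hg.
pose st a := upd (upd s x [:: a]) y (s y ++ mkseq g a).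
pose t a := upd (upd s x [:: a]) y (s y ++ mkseq g a.+1).
have -> : cost e' + 8 = (cost e').+1 + 7 by lia.
apply: (@dets_for _ _ _ _ _ _ st t) => //.
- apply: functional_extensionality => z; rewrite /st cats0 /upd.
  by case: eqP => [->|//]; rewrite eq_sym (negbTE ne).
- move=> a la; have -> : t a = upd (st a) y (rcons (st a y) (g a)).
    apply: functional_extensionality => z; rewrite /t /st /upd eqxx.
    by case: (z == y); rewrite // /mkseq -[a.+1]addn1 iotaD map_cat catA cats1.
  exact: dets_push (hg a _ la).
- by move=> a _; rewrite /t /upd (negbTE ne) eqxx.
- move=> a _; apply: functional_extensionality => z; rewrite /st /t /upd.
  by case: (z =P y) => [->|_]; [rewrite eq_sym (negbTE ne) | case: (z == x)].
Qed.

Definition store_call s ys (s1 : store) : store :=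
  fun x => if x \in ys then s1 (index x ys) else s x.

(* [calls p n c args g post]: after at most [n] units of local work, [p] runs
   the subroutine [c] on [args], and from the store [s1] that it leaves reaches
   within [g s1] units a final store satisfying [post s1]. *)
Definition calls (p : proc store) n c args (g : store -> nat)
    (post : store -> store -> Prop) :=
  exists2 K, reds p n (pbind (denote c (load args)) K) &
    forall s1, exists2 s', reds (K s1) (g s1) (Ret s') & post s1 s'.

(** [P] constrains the remaining process rather than a final store, because the coin of a sender is
    followed by a call of the transfer. *)
Definition draws (p : proc store) n (P : nat -> proc store -> Prop) :=
  exists2 h, reds p n (Toss h) & forall r, r < 2 ^ b -> P r (h r).

Lemma calls_call c xs ys s :
  calls (denote (Call c xs ys) s) (sumn [seq size (s x) | x <- xs]).+1
    c [seq s x | x <- xs]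
    (fun s1 => sumn [seq size (s1 i) | i <- iota 0 (size ys)])
    (fun s1 s' => s' = store_call s ys s1).
Proof.
eexists; first by apply: (RedsTick (RedsRefl _ 0)); rewrite addn0.
move=> s1; exists (store_call s ys s1) => //.
by apply: (RedsTick (RedsRefl _ 0)); rewrite addn0.
Qed.

Lemma calls_reds p q m n c args g post :
  reds p m q -> calls q n c args g post -> calls p (m + n) c args g post.
Proof. by move=> h [K hK hs]; exists K => //; apply: reds_trans h hK. Qed.

Lemma calls_bind p k n c args g g' (post post' : store -> store -> Prop) :
  calls p n c args g post ->
  (forall s1 s', post s1 s' ->
    exists2 s'', reds (k s') (g' s1) (Ret s'') & post' s1 s'') ->
  calls (pbind p k) n c args (fun s1 => g s1 + g' s1) post'.
Proof.
move=> [K hK hs] hk; exists (fun s1 => pbind (K s1) k).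
  by rewrite -pbindA; apply: reds_bind.
move=> s1; have [s' h1 /hk [s'' h2 h3]] := hs s1.
exists s'' => //; apply: reds_trans h2; exact: (reds_bind k h1).
Qed.

Lemma calls_weak p n n' c args (g g' : store -> nat) (post : store -> store -> Prop) :
  n <= n' -> (forall s, g s <= g' s) ->
  calls p n c args g post -> calls p n' c args g' post.
Proof.
move=> ln lg [K hK hs]; exists K; first exact: reds_weak hK ln.
by move=> s1; have [s' h hp] := hs s1; exists s' => //; apply: reds_weak h (lg _).
Qed.


Lemma calls_imp p n c args g (post post' : store -> store -> Prop) :
  (forall s1 s', post s1 s' -> post' s1 s') ->
  calls p n c args g post -> calls p n c args g post'.
Proof.
move=> hp [K hK hs]; exists K => // s1; have [s' h /hp h'] := hs s1.
by exists s'.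
Qed.

Lemma calls_seq_call c1 xs ys s d g (post : store -> store -> Prop) :
  (forall s1, exists2 s', reds (denote d (store_call s ys s1)) (g s1) (Ret s') &
    post s1 s') ->
  calls (denote (Seq (Call c1 xs ys) d) s) (sumn [seq size (s x) | x <- xs]).+1
    c1 [seq s x | x <- xs]
    (fun s1 => sumn [seq size (s1 i) | i <- iota 0 (size ys)] + g s1) post.
Proof.
by move=> h; apply: calls_bind (calls_call _ _ _ _) _ => s1 _ ->; apply: h.
Qed.

Lemma calls_seq c1 c2 s n1 s1 n2 c args g post : dets c1 s n1 s1 ->
  calls (denote c2 s1) n2 c args g post ->
  calls (denote (Seq c1 c2) s) (n1 + n2) c args g post.
Proof. by move=> h; apply: calls_reds; apply: (reds_bind _ h). Qed.

Lemma calls_then h c2 n c args g n2 (s2 : store -> store)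
    (post : store -> store -> Prop) :
  calls h n c args g post ->
  (forall s1 s', post s1 s' -> dets c2 s' n2 (s2 s')) ->
  calls (pbind h (denote c2)) n c args (fun s1 => g s1 + n2)
    (fun s1 s'' => exists2 s', post s1 s' & s'' = s2 s').
Proof.
move=> hh hd; apply: (calls_bind (g' := fun=> n2) hh).
by move=> s1 s' ps; exists (s2 s'); [apply: hd ps | exists s'].
Qed.

Lemma calls_seq_last c1 c2 s n c args g n2 (s2 : store -> store)
    (post : store -> store -> Prop) :
  calls (denote c1 s) n c args g post ->
  (forall s1 s', post s1 s' -> dets c2 s' n2 (s2 s')) ->
  calls (denote (Seq c1 c2) s) n c args (fun s1 => g s1 + n2)
    (fun s1 s'' => exists2 s', post s1 s' & s'' = s2 s').
Proof. exact: calls_then. Qed.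

Lemma store_call1 s y s1 v : s1 0 = v -> store_call s [:: y] s1 = upd s y v.
Proof.
move=> <-; apply: functional_extensionality => x.
by rewrite /store_call /upd inE; case: eqP => // ->; rewrite /= eqxx.
Qed.

Lemma calls_wrap c1 xs y s n c args g (v : store -> nat) :
  calls (denote c1 (load [seq s x | x <- xs])) n c args g
    (fun s1 s' => s' 0 = [:: v s1]) ->
  calls (denote (Call c1 xs [:: y]) s) ((sumn [seq size (s x) | x <- xs]).+1 + n)
    c args (fun s1 => g s1 + 1) (fun s1 s' => s' = upd s y [:: v s1]).
Proof.
move=> h; apply: calls_reds; first by apply: (RedsTick (RedsRefl _ 0)); rewrite addn0.
apply: (calls_bind (g' := fun=> 1) h) => s1 s' hs'.
exists (upd s y [:: v s1]) => //; apply: (RedsTick (n := 0)); last by rewrite /= hs'.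
by rewrite -(store_call1 _ _ hs'); apply: RedsRefl.
Qed.

Lemma draws_reds p q m n P : reds p m q -> draws q n P -> draws p (m + n) P.
Proof. by move=> h [K hK hs]; exists K => //; apply: reds_trans h hK. Qed.

Lemma draws_bind p k n (P Q : nat -> proc store -> Prop) : draws p n P ->
  (forall r h, r < 2 ^ b -> P r h -> Q r (pbind h k)) -> draws (pbind p k) n Q.
Proof.
move=> [K hK hs] hk; exists (fun r => pbind (K r) k); first exact: (reds_bind k hK).
by move=> r lr; apply: hk (hs _ lr).
Qed.

Lemma draws_weak p n n' P : n <= n' -> draws p n P -> draws p n' P.
Proof. by move=> ln [K hK hs]; exists K => //; apply: reds_weak hK ln. Qed.

Lemma draws_rnd x s :
  draws (denote (Rnd x) s) 1 (fun r q => q = Ret (upd s x (rcons (s x) r))).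
Proof. by eexists; first by apply: (RedsTick (RedsRefl _ 0)). Qed.

Lemma draws_seq_rnd x d s (P : nat -> proc store -> Prop) :
  (forall r, r < 2 ^ b -> P r (denote d (upd s x (rcons (s x) r)))) ->
  draws (denote (Seq (Rnd x) d) s) 1 P.
Proof. by move=> H; apply: draws_bind (draws_rnd _ _) _ => r h /H Pr ->. Qed.

Lemma draws_wrap c1 xs y s n n' c (args : nat -> seq (seq nat)) g (v : nat -> nat) :
  draws (denote c1 (load [seq s x | x <- xs])) n (fun r h =>
    calls h n' c (args r) g (fun _ s' => s' 0 = [:: v r])) ->
  draws (denote (Call c1 xs [:: y]) s) ((sumn [seq size (s x) | x <- xs]).+1 + n)
    (fun r h => calls h n' c (args r) (fun s1 => g s1 + 1)
      (fun _ s' => s' = upd s y [:: v r])).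
Proof.
move=> h; apply: draws_reds; first by apply: (RedsTick (RedsRefl _ 0)); rewrite addn0.
apply: draws_bind h _ => r h lr hc; apply: (calls_bind (g' := fun=> 1) hc) => s1 s' hs'.
exists (upd s y [:: v r]) => //; apply: (RedsTick (n := 0)); last by rewrite /= hs'.
by rewrite -(store_call1 _ _ hs'); apply: RedsRefl.
Qed.

Lemma draws_seq_last c1 c2 s n (P Q : nat -> proc store -> Prop) :
  draws (denote c1 s) n P ->
  (forall r h, P r h -> Q r (pbind h (denote c2))) ->
  draws (denote (Seq c1 c2) s) n Q.
Proof. by move=> h hk; apply: draws_bind h _ => r h' _; apply: hk. Qed.

Lemma draws_seq c1 c2 s n1 s1 n2 P : dets c1 s n1 s1 ->
  draws (denote c2 s1) n2 P -> draws (denote (Seq c1 c2) s) (n1 + n2) P.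
Proof. by move=> h; apply: draws_reds; apply: (reds_bind _ h). Qed.

Lemma evalV s x : eval b s (V x) = nth 0 (s x) 0.
Proof. by rewrite /= mod0n. Qed.

Lemma eval_cst s n : n < 2 ^ b -> eval b s (Cst n) = n.
Proof. exact: modn_small. Qed.

Lemma eval_get s x e n : eval b s e = n -> eval b s (Get x e) = nth 0 (s x) n.
Proof. by move=> /= ->. Qed.

Lemma eval_getc s x n : n < 2 ^ b -> eval b s (Get x (Cst n)) = nth 0 (s x) n.
Proof. by move=> ln; apply: eval_get; apply: eval_cst. Qed.

Lemma eval_add s e e' m n : eval b s e = m -> eval b s e' = n ->
  m + n < 2 ^ b -> eval b s (Add e e') = m + n.
Proof. by move=> /= -> ->; apply: modn_small. Qed.

Lemma eval_xor s e e' m n : eval b s e = m -> eval b s e' = n ->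
  m < 2 ^ b -> n < 2 ^ b -> eval b s (Xor e e') = Nat.lxor m n.
Proof. by move=> /= -> -> lm ln; rewrite modn_small // lxor_lt. Qed.

Lemma eval_low s e e' m n : eval b s e = m -> eval b s e' = n ->
  n <= b -> eval b s (Low e e') = m %% 2 ^ n.
Proof.
move=> /= -> -> ln; rewrite modn_small // (leq_trans (ltn_pmod _ _)) ?expn_gt0 //.
by rewrite leq_exp2l.
Qed.

Lemma eval_pow2 s e n : 0 < b -> eval b s e = n -> n < b ->
  eval b s (Pow2 e) = 2 ^ n.
Proof.
move=> b0 /= -> ln; rewrite (modn_small (m := 1)); last by rewrite -[1]/(2 ^ 0) ltn_exp2l.
by rewrite mul1n modn_small // ltn_exp2l.
Qed.

Lemma eval_parity s e l (par : bool) : 0 < b -> eval b s e = l ->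
  eval b s (Op OEq (Low e (Cst 1)) (Cst par)) = (odd l == par).
Proof.
move=> b0 /= ->.
have h1 : 1 < 2 ^ b by rewrite -[1]/(2 ^ 0) ltn_exp2l.
rewrite (modn_small h1) expn1 modn2 [odd l %% _]modn_small ?(leq_ltn_trans (leq_b1 _)) //.
rewrite [par %% _]modn_small ?(leq_ltn_trans (leq_b1 _)) //.
by case: (odd l); case: par; rewrite modn_small ?expn_gt0.
Qed.

End Rules.

(** * The local programs of the protocol *)

Definition gind_body (ots otc : cmd) (par : bool) : cmd :=
  Seq (Asg 4 (Pow2 (Get 0 (Add (Cst 2) (V 1)))))
  (Seq (Asg 5 (Get 0 (Add (Cst 3) (V 1))))
  (Seq (Asg 6 (Get 0 (Cst 0)))
  (Seq (Push 6 (V 4)) (Seq (Push 6 (V 5)) (Seq (Push 6 (V 2))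
  (Seq (If (Op OEq (Low (V 1) (Cst 1)) (Cst par))
      (Call (ind_chooser otc) [:: 6] [:: 2])
      (Seq (For 7 (V 4) (Push 6 (Get 0 (Add (V 3) (V 7)))))
       (Seq (Asg 3 (Add (V 3) (V 4)))
        (Call (ind_sender ots) [:: 6] [:: 2]))))
    (Asg 1 (Add (V 1) (Cst 1))))))))).

Lemma gind_partyE ots otc par :
  gind_party ots otc par
  = Seq (Asg 1 (Cst 1)) (Seq (Asg 2 (Get 0 (Cst 2)))
    (Seq (Asg 3 (Add (Cst 4) (Get 0 (Cst 1))))
    (Seq (While (Get 0 (Cst 1)) (Cst 1) (gind_body ots otc par)) (Asg 0 (V 2))))).
Proof. by []. Qed.

Definition sender_input (o : ot_inst) : seq nat :=
  [:: ot_k o; ot_w o; ot_L o] ++ ot_x o.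
Definition chooser_input (o : ot_inst) : seq nat :=
  [:: ot_k o; ot_w o; ot_L o; ot_j o].

Lemma leq_sum_nat n l (F : nat -> nat) :
  1 <= l <= n -> F l <= \sum_(1 <= a < n.+1) F a.
Proof.
move=> /andP[h1 h2]; rewrite (@big_cat_nat _ _ _ l) //=; last lia.
by rewrite (@big_ltn _ _ _ l) //=; lia.
Qed.

(** Every list has at least one entry, so the number of levels, and with it the number of hybrids,
    is bounded by the size of the instance. *)
Lemma levels_le i : gi_c i <= \sum_(1 <= a < (gi_c i).+1) gi_w i a.
Proof.
apply: (@leq_trans (\sum_(1 <= a < (gi_c i).+1) 1)).
  by rewrite sum_nat_const_nat; lia.
by apply: leq_sum => a _; rewrite expn_gt0.
Qed.

Lemma size_input i u s : size (gind_input i u s)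
  <= 4 + gi_c i + \sum_(1 <= a < (gi_c i).+1) gi_w i a.
Proof.
rewrite /gind_input !size_cat size_map size_iota size_flatten sumnE /=.
rewrite big_map big_map big_filter /index_iota subn1 /=.
suff : \sum_(a <- iota 1 (gi_c i) | odd a == s) size (mkseq (gi_tab i a) (gi_w i a))
    <= \sum_(a <- iota 1 (gi_c i)) gi_w i a by lia.
rewrite big_mkcond; apply: leq_sum => a _.
by rewrite size_mkseq; case: ifP.
Qed.

Section Instance.
Variables (beta : nat) (i : gind_inst).
Hypothesis leg : gind_legal beta i.
Local Notation b := (gi_b i).
Local Notation k := (gi_k i).
Local Notation c := (gi_c i).
Local Notation w := (gi_w i).
Local Notation len := (gi_len i).
Local Notation tab := (gi_tab i).

(* The oblivious transfer of level [l], when the shares of the index are [p]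
   and [q] and the sender draws [r]. *)
Definition level_ot (l p q r : nat) : ot_inst :=
  OTInst b k (w l) (len l)
    (mkseq (fun a => Nat.lxor (r %% 2 ^ len l) (tab l (Nat.lxor p a))) (w l)) q.

Lemma words_bound : 5 + c + \sum_(1 <= l < c.+1) w l < 2 ^ b.
Proof. by case: leg => [[]]. Qed.

Lemma b_gt0 : 0 < b.
Proof. by move: words_bound; case: b => //; rewrite expn0; lia. Qed.

Lemma c_gt0 : 0 < c.
Proof. by case: leg. Qed.

Lemma w_bound l : 1 <= l <= c -> w l <= \sum_(1 <= l < c.+1) w l.
Proof. exact: leq_sum_nat. Qed.

Lemma w_word l : 1 <= l <= c -> 5 + c + w l < 2 ^ b.
Proof.
by move=> /w_bound h; apply: leq_ltn_trans words_bound; rewrite leq_add2l.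
Qed.

Lemma n_lt l : 1 <= l <= c -> gi_n i l < b.
Proof.
by move=> /w_word; rewrite /gi_w => h; rewrite -(@ltn_exp2l 2) //; lia.
Qed.

Lemma len_le l : 1 <= l <= c -> len l <= b.
Proof.
move=> hl; rewrite /gi_len; case: eqP => [_|/eqP ne]; first by case: leg => [[]].
by apply/ltnW/n_lt; lia.
Qed.

Lemma tab_lt l a : 1 <= l <= c -> a < w l -> tab l a < 2 ^ len l.
Proof. by case: leg => [_ _ _ h _]; apply: h. Qed.

Lemma low_lt n r : r %% 2 ^ n < 2 ^ n.
Proof. by rewrite ltn_pmod ?expn_gt0. Qed.

Lemma low_word l r : 1 <= l <= c -> r %% 2 ^ len l < 2 ^ b.
Proof. by move=> /len_le h; rewrite (leq_trans (low_lt _ _)) ?leq_exp2l. Qed.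

Lemma index_lt l r : 1 <= l < c -> r %% 2 ^ len l < w l.+1.
Proof.
by move=> hl; rewrite /gi_len ifF ?low_lt //; apply/eqP; lia.
Qed.

Lemma level_ot_legal l p q r : 1 <= l <= c -> p < w l -> q < w l ->
  ot_legal beta (level_ot l p q r).
Proof.
move=> hl lp lq; split=> [|||//] /=; last 2 first.
- by rewrite size_mkseq.
- apply/allP => y /mapP[a]; rewrite mem_iota => /= la ->.
  by rewrite lxor_lt ?low_lt ?tab_lt ?lxor_lt.
split.
- by case: leg => [[]].
- exact: len_le.
- by have := w_word hl; lia.
- by rewrite trunc_expnK //; case: leg => [[_ _ _ h] _ _ _ _]; apply: h.
Qed.

Lemma level_ot_sz l p q r : 1 <= l <= c -> sz (f := OT beta) (level_ot l p q r)
  <= sz (f := GInd beta) i.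
Proof. by move=> /w_bound /=; lia. Qed.

(* Position in the input of the list of level [l], or of the first one after it,
   for the party holding the lists of parity [s]. *)
Definition pos (s : bool) (l : nat) : nat :=
  4 + c + \sum_(1 <= a < l | odd a == s) w a.

Lemma posS s l : 0 < l -> pos s l.+1 = pos s l + (if odd l == s then w l else 0).
Proof.
move=> l0; rewrite /pos big_mkcond [X in _ = _ + X + _]big_mkcond /=.
by rewrite big_nat_recr //= addnA.
Qed.

Lemma pos_le s l : l <= c.+1 -> pos s l < 2 ^ b.
Proof.
move=> hl; apply: leq_ltn_trans words_bound; rewrite /pos.
suff : \sum_(1 <= a < l | odd a == s) w a <= \sum_(1 <= a < c.+1) w a by lia.
rewrite big_mkcond /=.
case: (posnP l) => [->|l0]; first by rewrite big_geq.
rewrite (@big_cat_nat _ _ _ l 1 c.+1) //=.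
apply: (leq_trans _ (leq_addr _ _)); apply: leq_sum => a _.
by case: ifP.
Qed.

Section Input.
Variables (u0 : nat) (s : bool).
Local Notation inp := (gind_input i u0 s).

Lemma input_n l : 1 <= l <= c -> nth 0 inp (2 + l) = gi_n i l.
Proof.
case: l => // l /= lc; rewrite nth_cat size_map size_iota lc.
by rewrite (nth_map 0) ?size_iota // nth_iota.
Qed.

Lemma input_len l : 1 <= l <= c -> nth 0 inp (3 + l) = len l.
Proof.
move=> hl; rewrite /gi_len; case: eqP => [->|/eqP ne].
  by rewrite /= nth_cat size_map size_iota ltnn subnn.
by rewrite -(input_n (l := l.+1)); [rewrite addnS | lia].
Qed.

Lemma input_tab l a : 1 <= l <= c -> odd l == s -> a < w l ->
  nth 0 inp (pos s l + a) = tab l a.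
Proof.
move=> hl hs la; rewrite /gind_input catA catA nth_cat.
have -> : size (([:: k; c; u0] ++ [seq gi_n i l | l <- iota 1 c]) ++ [:: gi_X i]) = 4 + c.
  by rewrite !size_cat size_map size_iota /=; lia.
rewrite ltnNge (_ : 4 + c <= pos s l + a) /=; last by rewrite /pos; lia.
have -> : pos s l + a - (4 + c) = \sum_(1 <= a < l | odd a == s) w a + a.
  by rewrite /pos; lia.
(* The lists are cut at level [l]; the earlier ones of parity [s] fill the positions from the end of
   the header up to [pos s l]. *)
have -> : iota 1 c = iota 1 l.-1 ++ l :: iota l.+1 (c - l).
  have -> : l :: iota l.+1 (c - l) = iota (1 + l.-1) (c - l).+1.
    by rewrite /= (_ : 1 + l.-1 = l) //; lia.
  by rewrite -iotaD; congr iota; lia.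
rewrite filter_cat map_cat flatten_cat /= hs /= nth_cat.
have -> : size (flatten [seq mkseq (tab l) (w l) | l <- iota 1 l.-1 & odd l == s])
    = \sum_(1 <= a < l | odd a == s) w a.
  rewrite size_flatten sumnE big_map big_map big_filter /index_iota subn1.
  by apply: eq_bigr => x _; rewrite size_mkseq.
rewrite ifF; last by lia.
by rewrite addKn nth_cat size_mkseq la nth_mkseq.
Qed.

End Input.

(* What a party of parity [par] keeps between two levels. *)
Definition inv (u0 : nat) (par : bool) (l u : nat) (st : store) : Prop :=
  [/\ st 0 = gind_input i u0 (~~ par), st 1 = [:: l], st 2 = [:: u]
    & st 3 = [:: pos (~~ par) l]].

Lemma ind_chooser_calls otc arr : nth 0 arr 2 <= b ->
  calls b (denote b (ind_chooser otc) (load [:: arr]))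
    (size arr).+1 otc [:: arr] (fun s1 => size (s1 0) + 6)
    (fun s1 s' => s' 0 = [:: nth 0 (s1 0) 0 %% 2 ^ nth 0 arr 2]).
Proof.
move=> hY; have two : 2 < 2 ^ b by have := words_bound; lia.
apply: (calls_weak _ _ (calls_seq_call _ _ (g := fun=> 6) _)).
- by rewrite /= addn0.
- by move=> s1; rewrite /= addn0.
move=> s1; eexists.
  apply: dets_asg; apply: eval_low hY; first exact: evalV.
  by apply: eval_get; apply: eval_cst.
by [].
Qed.

Lemma dets_masked_table st l p q r : 1 <= l <= c -> p < w l ->
  let arr := [:: k; w l; len l; p] ++ mkseq (tab l) (w l) in
  st 0 = arr -> st 1 = [:: r %% 2 ^ len l] ->
  st 2 = [:: k; w l; len l] ++ mkseq (fun=> 0) (w l) ->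
  dets b (For 3 (Get 0 (Cst 1))
      (Upd 2 (Add (Cst 3) (Xor (Get 0 (Cst 3)) (V 3)))
             (Xor (V 1) (Get 0 (Add (Cst 4) (V 3))))))
    st (5 + w l * 27)
    (upd (upd st 3 [:: w l]) 2 (sender_input (level_ot l p q r))).
Proof.
move=> hl lp arr h0 h1 h2; have b0 := b_gt0; have lw := w_word hl.
pose x a := Nat.lxor (r %% 2 ^ len l) (tab l (Nat.lxor p a)).
(* Round [a] writes the entry of index [p] xor [a], so entry [d] is final once round [p] xor [d] is
   over. *)
pose line a := [:: k; w l; len l]
  ++ mkseq (fun d => if Nat.lxor p d < a then x d else 0) (w l).
pose st' a := upd (upd st 3 [:: a]) 2 (line a).
pose t a := upd (upd st 3 [:: a]) 2 (line a.+1).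
have -> : upd (upd st 3 [:: w l]) 2 (sender_input (level_ot l p q r)) = st' (w l).
  congr upd; rewrite /sender_input /line /=; congr [:: _, _, _ & _].
  by apply/eq_in_map => d; rewrite mem_iota /= => ld; rewrite ifT // lxor_lt.
have two : 1 < 2 ^ b by lia.
apply: (@dets_for b 3 _ _ st (w l) 20 st' t) => //.
- by rewrite /= (modn_small two) /upd /= h0.
- by lia.
- rewrite /st' (_ : line 0 = upd st 3 [:: 0] 2); last by rewrite /upd /= h2.
  by apply: functional_extensionality => z; rewrite {1}/upd; case: eqP => [->|].
- move=> a la; have lpa : Nat.lxor p a < w l by rewrite lxor_lt.
  have -> : t a = upd (st' a) 2 (set_nth 0 (st' a 2) (3 + Nat.lxor p a)
      (Nat.lxor (r %% 2 ^ len l) (tab l a))).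
    apply: functional_extensionality => z; rewrite /t /st' {1 3 4}/upd.
    case: eqP => // _; apply: (@eq_from_nth _ 0) => [|d].
      by rewrite size_set_nth !size_cat !size_mkseq /=; apply/esym/maxn_idPr; lia.
    rewrite size_cat size_mkseq /=.
    case: d => [|[|[|d]]] //; rewrite !ltnS => ld.
    rewrite /= nth_set_nth /= !nth_mkseq // ltnS.
    case: eqP => [->|ne]; first by rewrite /x lxorKl leqnn.
    rewrite leq_eqVlt (_ : (_ == a) = false) //.
    by apply/eqP => e; apply: ne; rewrite -e lxorKl.
  apply: (@reds_weak _ _ _ 16) => //; apply: dets_upd.
  + apply: eval_add; first by apply: eval_cst; lia.
      apply: (eval_xor (m := p) (n := a)).
      * by rewrite eval_getc ?/st' ?/upd /= ?h0 //; lia.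
      * by rewrite evalV /st' /upd.
      * by lia.
      * by lia.
    by lia.
  + rewrite (_ : tab l a = nth 0 arr (4 + a)); last by rewrite /= nth_mkseq.
    apply: eval_xor; first by rewrite evalV /st' /upd /= h1.
    * have e1 : eval b (st' a) (Add (Cst 4) (V 3)) = 4 + a.
        apply: eval_add; first by apply: eval_cst; lia.
          by rewrite evalV.
        by lia.
      by rewrite (eval_get _ e1) /st' /upd /= h0.
    * exact: low_word.
    * rewrite /= nth_mkseq //; apply: leq_trans (tab_lt hl la) _.
      by rewrite leq_exp2l // len_le.
  + by rewrite /st' /upd /= size_mkseq !ltnS.
- move=> a _; apply: functional_extensionality => z; rewrite /st' /t /upd.
  by case: (z =P 2) => [->|_] //; case: (z == 3).
Qed.

Lemma ind_sender_draws ots l p q : 1 <= l <= c -> p < w l ->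
  draws b (denote b (ind_sender ots)
      (load [:: [:: k; w l; len l; p] ++ mkseq (tab l) (w l)]))
    1 (fun r h => calls b h (100 * (w l).+1) ots
      [:: sender_input (level_ot l p q r)] (fun=> 4)
      (fun _ s' => s' 0 = [:: r %% 2 ^ len l])).
Proof.
move=> hl lp; have b0 := b_gt0; have lw := w_word hl; have lY := len_le hl.
rewrite /ind_sender; set arr := _ ++ _; set st0 := load _.
apply: draws_seq_rnd => r ltr.
have two : 3 < 2 ^ b by lia.
apply: calls_weak; last first.
- apply: calls_seq; first by apply: (dets_asg _ (v := r %% 2 ^ len l));
    rewrite (eval_low (m := r) (n := len l)) ?evalV // eval_getc //; lia.
  apply: calls_seq; first by apply: (dets_asg _ (v := k));
    rewrite eval_getc //; lia.
  apply: calls_seq; first by apply: (dets_push _ (v := w l));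
    rewrite eval_getc //; lia.
  apply: calls_seq; first by apply: (dets_push _ (v := len l));
    rewrite eval_getc //; lia.
  apply: calls_seq.
    apply: (dets_for_push (N := w l) (g := fun=> 0)) => //.
    - by rewrite eval_getc //; lia.
    - by lia.
    - by move=> a ys _; apply: mod0n.
  apply: calls_seq; first by apply: (@dets_masked_table _ l p q r).
  apply: calls_seq_call => s1; eexists; first by apply: dets_asg; rewrite evalV.
  by [].
- by move=> s1; rewrite /=; lia.
- by rewrite /= size_mkseq; lia.
Qed.

Lemma inv_input_n u0 par l u st : 1 <= l <= c -> inv u0 par l u st ->
  dets b (Asg 4 (Pow2 (Get 0 (Add (Cst 2) (V 1))))) st 8 (upd st 4 [:: w l]).
Proof.
move=> hl [h0 h1 _ _]; have lw := w_word hl; apply: dets_asg.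
apply: (eval_pow2 b_gt0 _ (n_lt hl)); rewrite -(input_n u0 (~~ par) hl) -h0.
apply: eval_get; apply: eval_add; first by apply: eval_cst; lia.
  by rewrite evalV h1.
by move: hl => /andP[]; lia.
Qed.

Lemma inv_input_len u0 par l u st : 1 <= l <= c -> inv u0 par l u st ->
  dets b (Asg 5 (Get 0 (Add (Cst 3) (V 1)))) (upd st 4 [:: w l]) 6
    (upd (upd st 4 [:: w l]) 5 [:: len l]).
Proof.
move=> hl [h0 h1 _ _]; have lw := w_word hl; apply: dets_asg.
rewrite -(input_len u0 (~~ par) hl) -h0.
apply: eval_get; apply: eval_add; first by apply: eval_cst; lia.
  by rewrite evalV /upd /= h1.
by move: hl => /andP[]; lia.
Qed.

(* The store in which a party enters the branch of its role at level [l]. *)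
Definition ready l u (st : store) : store :=
  upd (upd (upd (upd (upd (upd st 4 [:: w l]) 5 [:: len l]) 6 [:: k])
    6 [:: k; w l]) 6 [:: k; w l; len l]) 6 [:: k; w l; len l; u].

Lemma gind_body_ready ots otc par u0 l u st : 1 <= l <= c ->
  inv u0 par l u st ->
  reds (denote b (gind_body ots otc par) st) 40
    (denote b (Seq (if odd l == par then Call (ind_chooser otc) [:: 6] [:: 2]
      else (Seq (For 7 (V 4) (Push 6 (Get 0 (Add (V 3) (V 7)))))
       (Seq (Asg 3 (Add (V 3) (V 4)))
        (Call (ind_sender ots) [:: 6] [:: 2]))))
      (Asg 1 (Add (V 1) (Cst 1)))) (ready l u st)).
Proof.
move=> hl hi; have lw := w_word hl; have [h0 h1 h2 h3] := hi; have b0 := b_gt0.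
apply: (@reds_weak _ _ _ (8 + (6 + (3 + (3 + (3 + (3 + 7))))))) => //.
apply: reds_seq (inv_input_n hl hi) _.
apply: reds_seq (inv_input_len hl hi) _.
apply: reds_seq; first by apply: (dets_asg _ (v := k));
  rewrite eval_getc /upd /= ?h0 //; lia.
apply: reds_seq; first by apply: (dets_push _ (v := w l)); rewrite evalV.
apply: reds_seq; first by apply: (dets_push _ (v := len l)); rewrite evalV.
apply: reds_seq; first by apply: (dets_push _ (v := u)); rewrite evalV /upd /= h2.
apply: reds_seq_if; by apply: eval_parity => //; rewrite evalV /upd /= h1.
Qed.

Lemma incr_level l st : 1 <= l <= c -> st 1 = [:: l] ->
  dets b (Asg 1 (Add (V 1) (Cst 1))) st 5 (upd st 1 [:: l.+1]).
Proof.
move=> hl h1; have lw := w_word hl; apply: dets_asg.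
rewrite -[l.+1]addn1; apply: eval_add; first by rewrite evalV h1.
  by apply: eval_cst; lia.
by move: hl => /andP[]; lia.
Qed.

(** The input of the chooser involves neither [p] nor [r]. They are left free, to be instantiated by
    the share and the coin of the sender, so that both parties refer to the same transfer. *)
Lemma gind_body_chooser ots otc par u0 l p u r st : 1 <= l <= c ->
  odd l == par -> inv u0 par l u st ->
  calls b (denote b (gind_body ots otc par) st) 60 otc
    [:: chooser_input (level_ot l p u r)] (fun s1 => size (s1 0) + 12)
    (fun s1 => inv u0 par l.+1 (nth 0 (s1 0) 0 %% 2 ^ len l)).
Proof.
move=> hl hp hi; have [h0 h1 h2 h3] := hi.
have h := calls_wrap (xs := [:: 6]) (s := ready l u st) 2
  (ind_chooser_calls otc (arr := [:: k; w l; len l; u]) (len_le hl)).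
have {}h := calls_seq_last (c2 := Asg 1 (Add (V 1) (Cst 1))) (n2 := 5)
  (s2 := fun s' => upd s' 1 [:: l.+1]) h _.
have := gind_body_ready ots otc hl hi; rewrite hp => hr.
apply: calls_weak (calls_imp _ (calls_reds hr (h _))) => //.
- by move=> s1; lia.
- move=> s1 s' [t -> ->]; split; rewrite /upd /ready /upd //= h3 posS; last by case/andP: hl.
  by rewrite (eqP hp) eq_sym; case: (par); rewrite addn0.
- by move=> s1 s' ->; apply: incr_level hl _; rewrite /ready /upd /= h1.
Qed.

Lemma gind_body_sender ots otc par u0 l u q st : 1 <= l <= c ->
  odd l != par -> u < w l -> inv u0 par l u st ->
  draws b (denote b (gind_body ots otc par) st) (100 * (w l).+1) (fun r h =>
    calls b h (100 * (w l).+1) ots [:: sender_input (level_ot l u q r)] (fun=> 10)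
      (fun _ => inv u0 par l.+1 (r %% 2 ^ len l))).
Proof.
move=> hl hp hu hi; have [h0 h1 h2 h3] := hi; have lw := w_word hl.
have hs : odd l == ~~ par by case: (odd l) (par) hp => [] [].
have b0 := b_gt0.
have lp := @pos_le (~~ par) l.+1 _.
pose st1 := upd (upd (ready l u st) 7 [:: w l]) 6
  ([:: k; w l; len l; u] ++ mkseq (tab l) (w l)).
pose st2 := upd st1 3 [:: pos (~~ par) l.+1].
have hpos : pos (~~ par) l + w l = pos (~~ par) l.+1.
  by rewrite posS ?hs //; case/andP: hl.
have {}lp : pos (~~ par) l + w l < 2 ^ b.
  by rewrite hpos lp //; case/andP: hl.
have e1 : dets b (For 7 (V 4) (Push 6 (Get 0 (Add (V 3) (V 7))))) (ready l u st)
    (5 + w l * 14) st1.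
  apply: (dets_for_push (N := w l) (g := tab l)) => //.
  - by rewrite evalV.
  - by lia.
  - move=> a ys la; rewrite -(input_tab u0 _ hs) // -h0; apply: eval_get.
    apply: eval_add; [by rewrite evalV /ready /upd /= h3 | by rewrite evalV | lia].
have e2 : dets b (Asg 3 (Add (V 3) (V 4))) st1 6 st2.
  apply: dets_asg; rewrite -hpos.
  by apply: eval_add; [rewrite evalV /st1 /ready /upd /= h3 | rewrite evalV |].
have := gind_body_ready ots otc hl hi; rewrite (negbTE hp) => hr.
have {}e1 := draws_seq e1 (draws_seq e2
  (draws_wrap (xs := [:: 6]) (s := st2) 2 (ind_sender_draws ots q hl hu))).
apply: (draws_weak _ (draws_reds hr (draws_seq_last e1 _))).
  by rewrite /= size_mkseq; lia.
move=> r h hc; have hc2 := calls_then (c2 := Asg 1 (Add (V 1) (Cst 1))) (n2 := 5)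
     (s2 := fun s' => upd s' 1 [:: l.+1]) hc _.
apply: calls_weak (calls_imp _ (hc2 _)) => //.
- by move=> _ s' [t -> ->]; split; rewrite /st2 /st1 /ready /upd /=.
- by move=> _ s' ->; apply: incr_level hl _; rewrite /st2 /st1 /ready /upd /= h1.
Qed.

End Instance.

(** * The two parties together *)

Section TwoParties.
Variable b : nat.

Lemma expect_run_reds2 p n q : reds p n q ->
  exists2 m, m <= n & forall f p1 l1 l,
    expect f (run b p1 l1 p l) = expect f (run b p1 l1 q (log_step m l)).
Proof.
move=> /(run_reds b)[m lm h]; exists m => // f p1 l1 l.
by rewrite expect_run_swap h -expect_run_swap.
Qed.

End TwoParties.

Section Protocol.
Variables (beta : nat) (ots otc : cmd) (WOT COT : nat -> nat -> nat).
Hypothesis OT_work :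
  has_work (F := OT beta) ots otc (fun o => WOT (ot_w o) (ot_k o)).
Hypothesis OT_comm :
  has_comm (F := OT beta) ots otc (fun o => COT (ot_w o) (ot_k o)).
Variable i : gind_inst.
Hypothesis leg : gind_legal beta i.
Local Notation b := (gi_b i).
Local Notation k := (gi_k i).
Local Notation c := (gi_c i).
Local Notation w := (gi_w i).
Local Notation len := (gi_len i).

Definition ot_run (o : ot_inst) : rtree outcome :=
  run_protocol (F := OT beta) ots otc o.

(** The last conjunct bounds the cost of copying back the output of the chooser; 4 is the length of
    [chooser_input]. *)
Definition regular (o : ot_inst) (t : outcome) : bool :=
  [&& halted t, work t <= WOT (ot_w o) (ot_k o), comm (ot_b o) t <= COT (ot_w o) (ot_k o)
    & size (fin2 t 0) <= 4 + steps (log2 t)].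

Lemma every_regular o : ot_legal beta o -> every (regular o) (ot_run o).
Proof.
move=> lo.
have hs : every (fun t : outcome => size (fin2 t 0) <= 4 + steps (log2 t)) (ot_run o).
  rewrite /ot_run /run_protocol /exec.
  apply/(every_run_swap _ (fun t => size (fin2 t 0) <= 4 + steps (log2 t))).
  apply: (every_imp _ (run_sized (M := 4) _ _ _ _)); last first.
    by apply: sized_denote => -[|[|x]].
  by move=> t /(_ 0).
apply: every_imp (every_and (every_and (OT_work lo) (OT_comm lo)) hs).
by move=> t [[[h1 h2] h3] h4]; apply/and4P; split.
Qed.

Definition received (l : nat) (t : outcome) : nat :=
  nth 0 (fin2 t 0) 0 %% 2 ^ len l.

(** Local work commutes with everything, so a level amounts to one coin and one transfer. The stores
    and the costs that it leaves are known only through the invariant and a bound; hence the value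
    [G] of the continuation is required at all of them. *)
Lemma run_level f l p q uS uC sS sC lS lC (KS KC : store -> proc store)
    (G : nat -> outcome -> rat) :
  1 <= l <= c -> p < w l -> q < w l ->
  inv i uS (~~ odd l) l p sS -> inv i uC (odd l) l q sC ->
  (forall r t sS' sC' n n', r < 2 ^ b -> regular (level_ot i l p q r) t ->
    inv i uS (~~ odd l) l.+1 (r %% 2 ^ len l) sS' ->
    inv i uC (odd l) l.+1 (received l t) sC' ->
    n + n' <= 300 * (w l).+1 + steps (log2 t) ->
    expect f (run b (KS sS') (log_step n (addlog (log_coin r lS) (log1 t)))
      (KC sC') (log_step n' (addlog lC (log2 t)))) = G r t) ->
  expect f (run b (pbind (denote b (gind_body ots otc (~~ odd l)) sS) KS) lS
    (pbind (denote b (gind_body ots otc (odd l)) sC) KC) lC)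
  = avg b (fun r => expect (G r) (ot_run (level_ot i l p q r))).
Proof.
move=> hl hp hq hS hC H.
have hodd : odd l != ~~ odd l by case: odd.
have [hS' redS drawS] := gind_body_sender leg ots otc q hl hodd hp hS.
have [m1 lm1 ->] := run_reds b (reds_bind KS redS).
rewrite [expect _ _]/=; apply: eq_avg => r lr.
have [K1 red1 post1] := drawS r lr.
have [K2 red2 post2] :=
  gind_body_chooser leg ots otc p r hl (eqxx (odd l)) hC.
have [m2 lm2 ->] := run_reds b (reds_bind KS red1).
have [m3 lm3 ->] := expect_run_reds2 b (reds_bind KC red2).
rewrite !pbindA.
set o := level_ot i l p q r.
have lo : ot_legal beta o by apply: level_ot_legal.
have reg := every_regular lo.
set l1 := log_step m2 _; set l2 := log_step m3 _.
have halts : every halted (run b (denote b ots (load [:: sender_input o])) l1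
    (denote b otc (load [:: chooser_input o])) l2).
  (* Halting is known for runs from empty logs; prepending logs does not affect it. *)
  rewrite every_expect expect_run0 -every_expect.
  by apply: every_imp reg => t /and4P[].
rewrite expect_run_bind // expect_run0; apply: eq_expect_every.
apply: every_imp reg => t ht /=.
have [sS' red3 invS] := post1 (fin1 t); have [sC' red4 invC] := post2 (fin2 t).
have [m4 lm4 ->] := run_reds b (reds_bind KS red3).
have [m5 lm5 ->] := expect_run_reds2 b (reds_bind KC red4).
rewrite -(H r t sS' sC' (m1 + m2 + m4) (m3 + m5)) //.
  congr (expect f (run b _ _ _ _)); rewrite /l1 /l2 /log_step /addlog /=; congr Log; lia.
by case/and4P: ht => _ _ _ hsz; lia.
Qed.

(** From here on a level is described from the side of the party of parity [par], whose share is
    [u]: it is the chooser if [odd l == par] and the sender otherwise. The other party has share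
    [v]. *)
Definition ot_of (par : bool) (l u v r : nat) : ot_inst :=
  if odd l == par then level_ot i l v u r else level_ot i l u v r.
Definition share1 (par : bool) (l r : nat) (t : outcome) : nat :=
  if odd l == par then received l t else r %% 2 ^ len l.
Definition share2 (par : bool) (l r : nat) (t : outcome) : nat :=
  if odd l == par then r %% 2 ^ len l else received l t.
Definition coins1 (par : bool) (l r : nat) (t : outcome) (cs : seq nat) : seq nat :=
  if odd l == par then cs ++ coins (log2 t) else rcons cs r ++ coins (log1 t).
Definition rcvd1 (par : bool) (l : nat) (t : outcome) (ms : seq nat) : seq nat :=
  ms ++ rcvd (if odd l == par then log2 t else log1 t).

(** One [WOT] is the transfer itself; the other pays for copying the array left by the chooser,
    which is no longer than its work plus a constant. *)
Lemma run_level_par par f l u v u0 v0 s1 s2 l1 l2 (K1 K2 : store -> proc store)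
    (G : nat -> outcome -> rat) :
  1 <= l <= c -> u < w l -> v < w l ->
  inv i u0 par l u s1 -> inv i v0 (~~ par) l v s2 ->
  (forall r t s1' s2' l1' l2', r < 2 ^ b -> regular (ot_of par l u v r) t ->
    inv i u0 par l.+1 (share1 par l r t) s1' ->
    inv i v0 (~~ par) l.+1 (share2 par l r t) s2' ->
    coins l1' = coins1 par l r t (coins l1) -> rcvd l1' = rcvd1 par l t (rcvd l1) ->
    steps l1' + steps l2'
      <= steps l1 + steps l2 + 300 * (w l).+1 + 2 * WOT (w l) k ->
    b * (size (sent l1') + size (sent l2'))
      <= b * (size (sent l1) + size (sent l2)) + COT (w l) k ->
    expect f (run b (K1 s1') l1' (K2 s2') l2') = G r t) ->
  expect f (run b (pbind (denote b (gind_body ots otc par) s1) K1) l1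
    (pbind (denote b (gind_body ots otc (~~ par)) s2) K2) l2)
  = avg b (fun r => expect (G r) (ot_run (ot_of par l u v r))).
Proof.
move=> hl hu hv h1 h2; rewrite /ot_of /share1 /share2 /coins1 /rcvd1.
case: eqP => [hp|/eqP hp].
  move: h1 h2; rewrite -hp => h1 h2 H; rewrite expect_run_swap.
  apply: (run_level hl hv hu h2 h1) => r t sS' sC' n n' lr ht iS iC hn.
  rewrite -expect_run_swap; have /and4P[_ hw hc _] := ht.
  apply: H => //=.
  - by move: hw; rewrite /work /=; lia.
  - by move: hc; rewrite /comm /= !size_cat; nia.
have {hp} hp : par = ~~ odd l by case: (odd l) (par) hp => [] [].
move: h1 h2; rewrite hp negbK => h1 h2 H.
apply: (run_level hl hu hv h1 h2) => r t sS' sC' n n' lr ht iS iC hn.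
have /and4P[_ hw hc _] := ht.
apply: H => //=.
- by move: hw; rewrite /work /=; lia.
- by move: hc; rewrite /comm /= !size_cat; nia.
Qed.

Lemma share1_lt par l r t : 1 <= l < c -> share1 par l r t < w l.+1.
Proof. by rewrite /share1; case: ifP => _ ?; apply: index_lt. Qed.

Lemma share2_lt par l r t : 1 <= l < c -> share2 par l r t < w l.+1.
Proof. by rewrite /share2; case: ifP => _ ?; apply: index_lt. Qed.

Definition party_loop par m s : proc store :=
  pbind (wloop b (Cst 1) (gind_body ots otc par) m s) (denote b (Asg 0 (V 2))).

Lemma party_loopS par m s : party_loop par m.+1 s
  = Tick 2 (pbind (denote b (gind_body ots otc par) s) (party_loop par m)).
Proof. by rewrite /party_loop (wloopS _ _ _ (b_gt0 leg)) /= pbindA. Qed.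

Lemma party_start par u0 :
  exists2 n, n <= 20 & exists2 s, inv i u0 par 1 u0 s & forall f l p2 l2,
    expect f (run b (denote b (gind_party ots otc par)
      (load [:: gind_input i u0 (~~ par)])) l p2 l2)
    = expect f (run b (party_loop par c s) (log_step n l) p2 l2).
Proof.
have b0 := b_gt0 leg; have lw := words_bound leg.
rewrite gind_partyE; set s0 := load _.
pose s := upd (upd (upd s0 1 [:: 1]) 2 [:: u0]) 3 [:: 4 + c].
have h : reds (denote b (Seq (Asg 1 (Cst 1)) (Seq (Asg 2 (Get 0 (Cst 2)))
    (Seq (Asg 3 (Add (Cst 4) (Get 0 (Cst 1))))
    (Seq (While (Get 0 (Cst 1)) (Cst 1) (gind_body ots otc par)) (Asg 0 (V 2)))))) s0)
    (2 + (3 + (5 + 3))) (party_loop par c s).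
  apply: reds_seq; first by apply: (dets_asg _ (v := 1)); apply: eval_cst; lia.
  apply: reds_seq; first by apply: (dets_asg _ (v := u0)); rewrite eval_getc //; lia.
  apply: reds_seq.
    apply: (dets_asg _ (v := 4 + c)); apply: eval_add; first by apply: eval_cst; lia.
      by rewrite eval_getc //; lia.
    by lia.
  have h : reds (denote b (While (Get 0 (Cst 1)) (Cst 1) (gind_body ots otc par)) s)
      3 (wloop b (Cst 1) (gind_body ots otc par) c s).
    by rewrite denote_while eval_getc; [apply: (RedsTick (RedsRefl _ 0)) | lia].
  exact: (reds_bind (denote b (Asg 0 (V 2))) h).
have [n ln H] := run_reds b h; exists n; first by lia.
exists s => [|f l p2 l2]; last by rewrite H.
split => //; rewrite /s /upd /= /pos.
by rewrite big_geq // addn0.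
Qed.

(* The expectation of [F (coins) (received messages) (output of the other
   party)] for the party of parity [par] over the last [m] levels, from level [l]
   on, when the shares of the index are [u] and [v]. *)
Fixpoint real_value (par : bool) (F : seq nat -> seq nat -> seq nat -> rat)
    (m l u v : nat) (cs ms : seq nat) : rat :=
  if m is m'.+1 then
    avg b (fun r => expect (fun t =>
      real_value par F m' l.+1 (share1 par l r t) (share2 par l r t)
        (coins1 par l r t cs) (rcvd1 par l t ms)) (ot_run (ot_of par l u v r)))
  else F cs ms [:: v].

Lemma expect_party_loop par F m l u v u0 v0 s1 s2 l1 l2 :
  1 <= l -> m + l = c.+1 -> (0 < m -> u < w l) -> (0 < m -> v < w l) ->
  inv i u0 par l u s1 -> inv i v0 (~~ par) l v s2 ->
  expect (fun t => F (coins (log1 t)) (rcvd (log1 t)) (fin2 t 0))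
    (run b (party_loop par m s1) l1 (party_loop (~~ par) m s2) l2)
  = real_value par F m l u v (coins l1) (rcvd l1).
Proof.
elim: m l u v s1 s2 l1 l2 => [|m IH] l u v s1 s2 l1 l2 l0 hm hu hv h1 h2.
  by case: h2 => _ _ h2 _; rewrite /= mod0n h2.
have hl : 1 <= l <= c by lia.
rewrite !party_loopS [run _ _ _ _ _]/= expect_run_tick2 [RHS]/=.
apply: (run_level_par hl (hu _) (hv _) h1 h2) => //.
move=> r t s1' s2' l1' l2' lr ht i1 i2 hc hr _ _.
rewrite (IH _ _ _ _ _ _ _ _ _ _ _ i1 i2) ?hc ?hr //; first by lia.
  by move=> m0; apply: share1_lt; lia.
by move=> m0; apply: share2_lt; lia.
Qed.

(** Replacing 300 by 310 absorbs the loop tests of both parties, and the final 6 is their last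
    assignment. *)
Lemma every_party_loop par m l u v u0 v0 s1 s2 l1 l2 W C :
  1 <= l -> m + l = c.+1 -> (0 < m -> u < w l) -> (0 < m -> v < w l) ->
  inv i u0 par l u s1 -> inv i v0 (~~ par) l v s2 ->
  steps l1 + steps l2 + \sum_(l <= a < c.+1) (310 * (w a).+1 + 2 * WOT (w a) k) + 6 <= W ->
  b * (size (sent l1) + size (sent l2)) + \sum_(l <= a < c.+1) COT (w a) k <= C ->
  every (fun t => [&& halted t, work t <= W & comm b t <= C])
    (run b (party_loop par m s1) l1 (party_loop (~~ par) m s2) l2).
Proof.
rewrite every_expect.
elim: m l u v s1 s2 l1 l2 => [|m IH] l u v s1 s2 l1 l2 l0 hm hu hv h1 h2 hW hC.
  have {}hW : steps l1 + steps l2 + 6 <= W.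
    by move: hW; rewrite big_geq; lia.
  have {}hC : b * (size (sent l1) + size (sent l2)) <= C.
    by move: hC; rewrite big_geq; lia.
  rewrite /= /work /comm /= hC andbT.
  by case: (leqP _ W) => // h; exfalso; lia.
have hl : 1 <= l <= c by lia.
rewrite !party_loopS [run _ _ _ _ _]/= expect_run_tick2.
(* A violated bound must have expectation 0, so the constant 0 is the value of every
   continuation. *)
rewrite (run_level_par (G := fun _ _ => 0%R) hl (hu _) (hv _) h1 h2) //.
  by rewrite -[RHS](avg_cst b); apply: eq_avg => r _; rewrite expect_cst.
move=> r t s1' s2' l1' l2' lr ht i1 i2 _ _ hst hse.
move: hW hC; rewrite !(@big_ltn _ _ _ l) /=; try lia.
move=> hW hC.
apply: (IH _ _ _ _ _ _ _ _ _ _ _ i1 i2); try lia.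
- by move=> m0; apply: share1_lt; lia.
- by move=> m0; apply: share2_lt; lia.
- by move: hst => /=; lia.
- by move: hse => /=; lia.
Qed.

Lemma expect_gind_run par F u0 v0 : u0 < w 1 -> v0 < w 1 ->
  expect (fun t => F (coins (log1 t)) (rcvd (log1 t)) (fin2 t 0))
    (exec b (gind_party ots otc par) (gind_party ots otc (~~ par))
       [:: gind_input i u0 (~~ par)] [:: gind_input i v0 par])
  = real_value par F c 1 u0 v0 [::] [::].
Proof.
move=> hu hv; have [n1 _ [s1 i1 e1]] := party_start par u0.
have [n2 _ [s2 i2 e2]] := party_start (~~ par) v0; rewrite negbK in e2.
rewrite /exec e1 expect_run_swap e2 -expect_run_swap.
by rewrite (@expect_party_loop par F c 1 u0 v0 u0 v0 s1 s2) ?addn1.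
Qed.

Lemma every_gind_run par u0 v0 : u0 < w 1 -> v0 < w 1 ->
  every (fun t => [&& halted t,
      work t <= \sum_(1 <= a < c.+1) (310 * (w a).+1 + 2 * WOT (w a) k) + 46
    & comm b t <= \sum_(1 <= a < c.+1) COT (w a) k])
    (exec b (gind_party ots otc par) (gind_party ots otc (~~ par))
       [:: gind_input i u0 (~~ par)] [:: gind_input i v0 par]).
Proof.
move=> hu hv; have [n1 ln1 [s1 i1 e1]] := party_start par u0.
have [n2 ln2 [s2 i2 e2]] := party_start (~~ par) v0; rewrite negbK in e2.
rewrite every_expect /exec e1 expect_run_swap e2 -expect_run_swap -every_expect.
apply: (@every_party_loop par c 1 u0 v0 u0 v0 s1 s2) => //=; first by rewrite addn1.
  by lia.
by rewrite muln0.
Qed.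

(** [has_work] bounds [WOT] from below by the work of an actual run. A legal transfer exists at this
    level, its sender spends at least one unit, and the tree of its runs has a branch. *)
Lemma WOT_gt0 l : 1 <= l <= c -> 0 < WOT (w l) k.
Proof.
move=> hl; pose o := level_ot i l 0 0 0.
have lo : ot_legal beta o by apply: level_ot_legal; rewrite ?expn_gt0.
have h1 : every (fun t => 0 < steps (log1 t)) (run_protocol (F := OT beta) ots otc o).
  rewrite /run_protocol /exec.
  have [n [p ->]] := denote_tick b ots (load [:: sender_input o]).
  exact: (@run_steps_ge b 1 p (log_step n.+1 log0)).
elim: (run_protocol _ _ _) (every_and h1 (OT_work lo)) => [t [h [_ h2]]|n g IH H].
  by apply: leq_trans h2; rewrite /work addn_gt0 h.
by apply: (IH 0); apply: H; rewrite expn_gt0.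
Qed.

End Protocol.

(** * Circuits *)

Section Circuits.
Implicit Types (d : seq (seq nat)) (C : circuit) (g : gate).

Definition wires d (vals : seq bool) C : seq bool :=
  foldl (fun vals g => rcons vals (gate_val d vals g)) vals C.

Lemma acceptsE C d : accepts C d = last false (wires d [::] C).
Proof. by []. Qed.

Lemma size_wires d vals C : size (wires d vals C) = size vals + size C.
Proof.
elim: C vals => [|g C IH] vals; first by rewrite addn0.
by rewrite /wires /= -/(wires _ _ _) IH size_rcons addSnnS.
Qed.

Lemma wires_cat d vals C1 C2 :
  wires d vals (C1 ++ C2) = wires d (wires d vals C1) C2.
Proof. exact: foldl_cat. Qed.

Lemma accepts_nth C d : accepts C d = nth false (wires d [::] C) (size C).-1.
Proof. by rewrite acceptsE -nth_last size_wires. Qed.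

Definition shift_gate (n : nat) g : gate :=
  if g is Nand u v then Nand (n + u) (n + v) else g.

Lemma wires_shift d v1 v C :
  wires d (v1 ++ v) [seq shift_gate (size v1) g | g <- C] = v1 ++ wires d v C.
Proof.
elim: C v => //= g C IH v.
rewrite /wires /= -!/(wires _ _ _) -IH rcons_cat; congr (wires d (_ ++ rcons _ _) _).
by case: g => //= x y; rewrite !nth_cat !ltnNge !leq_addr /= !addKn.
Qed.

Definition cnot C : circuit := rcons C (Nand (size C).-1 (size C).-1).

Definition cand C1 C2 : circuit :=
  C1 ++ [seq shift_gate (size C1) g | g <- C2]
  ++ [:: Nand (size C1).-1 (size C1 + (size C2).-1);
         Nand (size C1 + size C2) (size C1 + size C2)].

Lemma accepts_cnot C d : accepts (cnot C) d = ~~ accepts C d.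
Proof.
rewrite !accepts_nth /cnot size_rcons -cats1 wires_cat.
by rewrite /wires /= -/(wires d [::] C) nth_rcons size_wires add0n ltnn eqxx andbb.
Qed.

(** An empty circuit outputs false but has no wire: the position of its output would designate a
    gate outside it. Hence the two hypotheses on sizes. *)
Lemma accepts_cand C1 C2 d : 0 < size C1 -> 0 < size C2 ->
  accepts (cand C1 C2) d = accepts C1 d && accepts C2 d.
Proof.
move=> h1 h2; rewrite acceptsE /cand wires_cat wires_cat.
have hw : size (wires d [::] C1) = size C1 by rewrite size_wires.
rewrite -{1}[wires d [::] C1]cats0 -{1}hw wires_shift.
rewrite {1}/wires /= last_rcons nth_rcons size_cat hw size_wires add0n.
rewrite ltnn eqxx andbb negbK !nth_cat hw.
have -> : (size C1).-1 < size C1 by lia.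
by rewrite ltnNge leq_addr /= addKn -!accepts_nth.
Qed.

Lemma size_cand C1 C2 : size (cand C1 C2) = size C1 + size C2 + 2.
Proof. by rewrite /cand !size_cat size_map addnA. Qed.

Definition has_size (a n : nat) : circuit :=
  if n is n'.+1 then cand [:: Has a n'] (cnot [:: Has a n]) else cnot [:: Has a 0].

Lemma accepts_has_size a n d : accepts (has_size a n) d = (size (nth [::] d a) == n).
Proof.
case: n => [|n] /=; first by rewrite accepts_cnot /accepts /= lt0n negbK.
by rewrite accepts_cand // accepts_cnot /accepts /= -leqNgt andbC -eqn_leq.
Qed.

Lemma size_has_size a n : 0 < size (has_size a n) <= 5.
Proof. by case: n. Qed.

(* The frame [a0; pc ++ _ ++ qc; pm ++ _ ++ qm; a3] is hardwired into a circuit;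
   the holes, of known sizes [n] and [m], are read from arrays 1 and 2. *)
Section Insert.
Variables (a0 a3 pc qc pm qm : seq nat).

Definition frame (x y : seq nat) : seq (seq nat) :=
  [:: a0; pc ++ x ++ qc; pm ++ y ++ qm; a3].

(** A gate at a position [N] beyond the circuit reads as the default false, so its [Nand] with
    itself is true; array 4 is absent from data of four arrays, so [Has 4 0] is false. *)
Definition const_gate (N : nat) (t : bool) : gate :=
  if t then Nand N N else Has 4 0.

(** Each gate is replaced by a single one, which keeps the positions of all wires. Zeros stand for
    the holes, since elsewhere the frame depends on their lengths only. *)
Definition insert_gate (N n m : nat) g : gate :=
  let d := frame (nseq n 0) (nseq m 0) in
  match g with
  | Nand u v => Nand u v
  | Has a i => const_gate N (i < size (nth [::] d a))
  | Bit a i t =>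
      if (a == 1) && (size pc <= i < size pc + n) then Bit 1 (i - size pc) t
      else if (a == 2) && (size pm <= i < size pm + m) then Bit 2 (i - size pm) t
      else const_gate N (Nat.testbit (nth 0 (nth [::] d a) i) t)
  end.

Definition insert (n m : nat) C : circuit :=
  [seq insert_gate (size C) n m g | g <- C].

Lemma nth_hole (p x y q : seq nat) j : size x = size y ->
  ~~ (size p <= j < size p + size x) ->
  nth 0 (p ++ x ++ q) j = nth 0 (p ++ y ++ q) j.
Proof.
move=> hxy h; rewrite !nth_cat; case: ltnP => // h1; rewrite -hxy ifF //.
  by rewrite ifF //; apply/negbTE; move: h; lia.
by apply/negbTE; move: h; lia.
Qed.

Lemma accepts_insert C d : size d = 4 ->
  accepts (insert (size (nth [::] d 1)) (size (nth [::] d 2)) C) d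
  = accepts C (frame (nth [::] d 1) (nth [::] d 2)).
Proof.
move=> hd; set n := size _; set m := size _.
pose d' := frame (nth [::] d 1) (nth [::] d 2).
rewrite !acceptsE; congr last; rewrite /insert.
suff H C' vals : size vals + size C' <= size C ->
    wires d vals [seq insert_gate (size C) n m g | g <- C'] = wires d' vals C'.
  exact: H.
elim: C' vals => //= g C' IH vals hs.
rewrite /wires /= -!/(wires _ _ _).
have cE t : gate_val d vals (const_gate (size C) t) = t.
  by case: t => /=; rewrite ?(nth_default _ (s := d)) ?hd // !nth_default //; lia.
have -> : gate_val d vals (insert_gate (size C) n m g) = gate_val d' vals g.
  case: g => [a j t|a j|u v] //=; last first.
    rewrite cE; congr (_ < _).
    by case: a => [|[|[|[|a]]]] //=; rewrite !size_cat size_nseq.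
  case: ifP => [/and3P[/eqP -> h1 h2]|H1].
    rewrite /= nth_cat ltnNge h1 /= nth_cat ifT //; rewrite -/n; lia.
  case: ifP => [/and3P[/eqP -> h1 h2]|H2].
    rewrite /= nth_cat ltnNge h1 /= nth_cat ifT //; rewrite -/m; lia.
  rewrite cE; congr Nat.testbit; case: a H1 H2 => [|[|[|[|a]]]] //= H1 H2.
    by apply: nth_hole; rewrite size_nseq // H1.
  by apply: nth_hole; rewrite size_nseq // H2.
by apply: IH; rewrite size_rcons; lia.
Qed.

End Insert.
End Circuits.

(** * Distinguishers with a hardwired frame *)

Section Insertion.
Local Open Scope ring_scope.

Lemma sum_delta (N x : nat) (f : nat -> rat) :
  \sum_(n < N) (x == n)%:R * f n = if (x < N)%N then f x else 0.
Proof.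
case: ltnP => h.
  rewrite (bigD1 (Ordinal h)) //= eqxx mul1r big1 ?addr0 // => j.
  by rewrite -val_eqE /= eq_sym => /negbTE ->; rewrite mul0r.
by rewrite big1 // => j _; rewrite gtn_eqF ?mul0r // (leq_trans (ltn_ord j)).
Qed.

Variables (D E : rtree (seq (seq nat))) (T : nat) (delta : rat).
Hypothesis D4 : every (fun d => size d = 4%N) D.
Hypothesis E4 : every (fun d => size d = 4%N) E.
Hypothesis Esize :
  every (fun d => (size (nth [::] d 1) <= T)%N /\ (size (nth [::] d 2) <= T)%N) E.

(** The circuits [K n m] accept on disjoint sets of samples, and their sum over [n, m <= T] is the
    value of [C] on the framed sample when both holes are small. The remaining 2 accounts for large
    samples of [D]. The size overhead 14 is two size tests of at most 5 gates and two conjunctions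
    of 2. *)
Lemma insert_dist (C : circuit) (a0 a3 pc qc pm qm : seq nat) :
  (forall C' : circuit, (size C' <= size C + 14)%N ->
    `|prob (accepts C') D - prob (accepts C') E| <= delta) ->
  `|expect (fun d => (accepts C (frame a0 a3 pc qc pm qm (nth [::] d 1) (nth [::] d 2)))%:R) D
    - expect (fun d => (accepts C (frame a0 a3 pc qc pm qm (nth [::] d 1) (nth [::] d 2)))%:R) E|
  <= (T.+1 ^ 2 + 2)%:R * delta.
Proof.
move=> H.
have delta0 : 0 <= delta by apply: le_trans (H [::] _).
case: (posnP (size C)) => [/size0nil ->|C0].
  by rewrite !expect_cst subrr normr0 mulr_ge0 ?ler0n.
pose phi d : rat :=
  (accepts C (frame a0 a3 pc qc pm qm (nth [::] d 1) (nth [::] d 2)))%:R.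
pose K n m := cand (insert a0 a3 pc qc pm qm n m C) (cand (has_size 1 n) (has_size 2 m)).
pose small (d : seq (seq nat)) := (size (nth [::] d 1) < T.+1)%N && (size (nth [::] d 2) < T.+1)%N.
pose main d : rat := \sum_(n < T.+1) \sum_(m < T.+1) (accepts (K n m) d)%:R.
have mainE d : size d = 4%N -> main d = (small d)%:R * phi d.
  move=> d4; transitivity (\sum_(n < T.+1) (size (nth [::] d 1) == n)%:R *
      \sum_(m < T.+1) (size (nth [::] d 2) == m)%:R *
         (accepts (insert a0 a3 pc qc pm qm n m C) d)%:R : rat).
    apply: eq_bigr => n _; rewrite mulr_sumr; apply: eq_bigr => m _.
    have [s1 _] := andP (size_has_size 1 n); have [s2 _] := andP (size_has_size 2 m).
    rewrite /K !accepts_cand ?size_cand ?size_map // ?addn_gt0 ?s1 // !accepts_has_size.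
    by rewrite -!natrM !mulnb andbC andbA.
  rewrite (sum_delta _ _ (fun n => \sum_(m < T.+1) (size (nth [::] d 2) == m)%:R *
         (accepts (insert a0 a3 pc qc pm qm n m C) d)%:R)).
  rewrite /small; case: ltnP => _; last by rewrite mul0r.
  rewrite (sum_delta _ _ (fun m => (accepts (insert a0 a3 pc qc pm qm _ m C) d)%:R)).
  by case: ltnP => _; rewrite ?mul0r // accepts_insert // mul1r.
have part : `|expect main D - expect main E| <= (T.+1 ^ 2)%:R * delta.
  have sumE t : expect main t = \sum_(n < T.+1) \sum_(m < T.+1) prob (accepts (K n m)) t.
    rewrite /main (expect_sum _ (fun n d => \sum_(m < T.+1) (accepts (K n m) d)%:R)).
    apply: eq_bigr => n _.
    rewrite (expect_sum _ (fun m d => (accepts (K n m) d)%:R)); apply: eq_bigr => m _.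
    by rewrite probE.
  rewrite !sumE -sumrB (le_trans (ler_norm_sum _ _ _)) //.
  apply: (@le_trans _ _ (\sum_(n < T.+1) \sum_(m < T.+1) delta)).
    apply: ler_sum => n _; rewrite -sumrB (le_trans (ler_norm_sum _ _ _)) //.
    apply: ler_sum => m _; apply: H.
    have [_ s1] := andP (size_has_size 1 n); have [_ s2] := andP (size_has_size 2 m).
    by rewrite /K !size_cand size_map; lia.
  by rewrite !sumr_const !card_ord -mulrnA mulr_natl expnS expn1.
have phi01 d : 0 <= phi d <= 1 by rewrite /phi ler0n lern1 leq_b1.
(* A sample that [main] misses has an entry at position [T] of array 1 or 2. The gate testing this
   never accepts on [E], hence accepts on [D] with probability at most [delta]. *)
have restD : `|expect phi D - expect main D| <= 2 * delta.
  have big a : a \in [:: 1%N; 2%N] ->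
      expect (fun d => (accepts [:: Has a T] d)%:R) D <= delta.
    move=> ha; have := H [:: Has a T] _; rewrite !probE.
    have -> : expect (fun d => (accepts [:: Has a T] d)%:R) E = 0 :> rat.
      rewrite -[RHS](expect_cst 0 E); apply: eq_expect_every.
      apply: every_imp Esize => d [h1 h2]; rewrite /accepts /=.
      by move: ha; rewrite !inE => /orP[] /eqP ->; rewrite ltnNge ?h1 ?h2.
    rewrite subr0 => /(_ _)/(le_trans (ler_norm _)); apply.
    by rewrite /= addnC.
  rewrite (le_trans (expect_dist _ _ _)) // mulr_natl mulr2n.
  apply: le_trans (lerD (big 1%N isT) (big 2%N isT)).
  rewrite -expectD; apply: le_expect_every; apply: every_imp D4 => d d4.
  rewrite mainE // /small /accepts /= !ltnS.
  have /andP[p0 p1] := phi01 d.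
  case: leqP => _; case: leqP => _ /=; rewrite ?mul1r ?mul0r ?subrr ?subr0 ?normr0 //.
  - by rewrite ger0_norm // add0r.
  - by rewrite ger0_norm // addr0.
  - by rewrite ger0_norm // (le_trans p1) // lerDl.
have restE : expect phi E = expect main E.
  apply: eq_expect_every; apply: every_imp (every_and E4 Esize) => d [d4 [h1 h2]].
  by rewrite mainE // /small !ltnS h1 h2 mul1r.
rewrite -/phi natrD mulrDl restE.
have -> : expect phi D - expect main E
    = (expect main D - expect main E) + (expect phi D - expect main D) by ring.
by rewrite (le_trans (ler_normD _ _)) // lerD.
Qed.

End Insertion.

(** * Polynomials over the natural numbers *)

Lemma natpolyD (p q : {poly nat}) (x : nat) : (p + q)%R.[x]%R = p.[x]%R + q.[x]%R.
Proof. exact: hornerD. Qed.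

Lemma natpolyM (p q : {poly nat}) (x : nat) : (p * q)%R.[x]%R = p.[x]%R * q.[x]%R.
Proof. exact: hornerM. Qed.

Lemma natpolyC (a x : nat) : a%:P%R.[x]%R = a.
Proof. exact: hornerC. Qed.

Lemma natpolyX (x : nat) : ('X%R : {poly nat}).[x]%R = x.
Proof. exact: hornerX. Qed.

Lemma poly_nat_mono (p : {poly nat}) (x y : nat) : x <= y -> (p.[x]%R <= p.[y]%R).
Proof.
move=> h; elim/poly_ind: p => [|p a IH]; first by rewrite !horner0.
by rewrite !natpolyD !natpolyM !natpolyX !natpolyC leq_add2r leq_mul.
Qed.

(** With n = k / (d+1) one has k+1 <= (d+1) 2^n, so the left side is at most A (d+1)^d 2^(nd). The
    threshold makes A (d+1)^d <= n < 2^n, and n(d+1) <= k. *)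
Lemma exp2_dominates (A d : nat) :
  exists K, forall k, K <= k -> A * k.+1 ^ d < 2 ^ k.
Proof.
exists ((A * d.+1 ^ d) * d.+1) => k hk.
pose n := k %/ d.+1; have n1 : n.+1 <= 2 ^ n by apply: ltn_expl.
have kn : k.+1 <= d.+1 * 2 ^ n.
  apply: leq_trans (leq_mul (leqnn _) n1).
  by rewrite mulnC; apply: ltn_ceil.
have hn : A * d.+1 ^ d <= n by rewrite leq_divRL.
have : A * k.+1 ^ d <= A * d.+1 ^ d * 2 ^ (n * d).
  rewrite expnM -mulnA -expnMn leq_mul2l.
  have le_pow x y e : x <= y -> x ^ e <= y ^ e by case: e => // e; rewrite leq_exp2r.
  by rewrite le_pow ?orbT.
move=> /leq_ltn_trans; apply.
apply: (@leq_trans (2 ^ n * 2 ^ (n * d))).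
  by rewrite ltn_pmul2r ?expn_gt0 // (leq_ltn_trans hn).
by rewrite -expnD -mulnS leq_exp2l // leq_divM.
Qed.

Lemma poly_lt_exp2 (p : {poly nat}) :
  exists K : nat, forall k : nat, K <= k -> p.[k]%R < 2 ^ k.
Proof.
have [A [d h]] : exists A d, forall k, p.[k]%R <= A * k.+1 ^ d.
  elim/poly_ind: p => [|p a [A [d IH]]].
    by exists 0, 0 => k; rewrite horner0.
  exists (A + a), d.+1 => k; rewrite natpolyD natpolyM natpolyX natpolyC.
  rewrite expnSr mulnDl leq_add //.
    by rewrite mulnA leq_mul ?IH.
  by rewrite leq_pmulr // muln_gt0 expn_gt0.
have [K hK] := exp2_dominates A d.
by exists K => k /hK; apply: leq_ltn_trans.
Qed.

(** * The simulators *)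

Definition copy (src dst : nat) : cmd := For 7 (Len src) (Push dst (Get src (V 7))).

(* Variables 0-7 as in [gind_party]; 8: coins; 9: received messages; 10: coin of
   the level; 11: output to be reproduced; 12: next share of the index; 13-15:
   output of the simulators [S1] and [S2] of the oblivious transfer; 16: empty. *)
Definition sim_body (S1 S2 : cmd) (par : bool) : cmd :=
  Seq (Asg 4 (Pow2 (Get 0 (Add (Cst 2) (V 1)))))
  (Seq (Asg 5 (Get 0 (Add (Cst 3) (V 1))))
  (Seq (Clr 10)
  (Seq (Rnd 10)
  (Seq (If (Op OEq (V 1) (Get 0 (Cst 1)))
          (Asg 10 (Xor (Xor (V 10) (Low (V 10) (V 5))) (V 11))) Skip)
  (Seq (Asg 12 (Low (V 10) (V 5)))
  (Seq (Asg 6 (Get 0 (Cst 0))) (Seq (Push 6 (V 4)) (Seq (Push 6 (V 5))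
  (Seq (If (Op OEq (Low (V 1) (Cst 1)) (Cst par))
          (Seq (Push 6 (V 2)) (Call S2 [:: 6; 12] [:: 13; 14; 15]))
          (Seq (Push 8 (V 10))
          (Seq (For 7 (V 4)
                 (Push 6 (Xor (V 12) (Get 0 (Add (V 3) (Xor (V 2) (V 7)))))))
          (Seq (Asg 3 (Add (V 3) (V 4)))
               (Call S1 [:: 6; 16] [:: 13; 14; 15])))))
  (Seq (copy 14 8) (Seq (copy 15 9)
  (Seq (Asg 2 (V 12)) (Asg 1 (Add (V 1) (Cst 1))))))))))))))).

Definition gind_sim (S1 S2 : cmd) (par : bool) : cmd :=
  Seq (Asg 11 (V 1)) (Seq (Asg 1 (Cst 1)) (Seq (Asg 2 (Get 0 (Cst 2)))
  (Seq (Asg 3 (Add (Cst 4) (Get 0 (Cst 1))))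
  (Seq (While (Get 0 (Cst 1)) (Cst 1) (sim_body S1 S2 par))
       (Call Skip [:: 0; 8; 9] [:: 0; 1; 2]))))).

Lemma dets_copy b s src dst : 0 < b -> src != 7 -> dst != 7 -> src != dst ->
  let N := size (s src) %% 2 ^ b in
  dets b (copy src dst) s (4 + N * 11)
    (upd (upd s 7 [:: N]) dst (s dst ++ take N (s src))).
Proof.
move=> b0 h1 h2 h3 N.
have le : N <= size (s src) by apply: leq_mod.
rewrite -(map_nth_iota0 0 le).
apply: (dets_for_push (N := N) (g := nth 0 (s src))) => //.
- by rewrite eq_sym.
- by rewrite /= /upd (negbTE h1).
- by rewrite /N ltn_pmod ?expn_gt0.
- move=> a ys la; have e : eval b (upd (upd s 7 [:: a]) dst ys) (V 7) = a.
    by rewrite evalV /upd (eq_sym _ dst) (negbTE h2).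
  by rewrite (eval_get _ e) /upd (negbTE h3) (negbTE h1).
Qed.

Section Simulator.
Variables (beta : nat) (S1 S2 : cmd) (i : gind_inst).
Hypothesis leg : gind_legal beta i.
Local Notation b := (gi_b i).
Local Notation k := (gi_k i).
Local Notation c := (gi_c i).
Local Notation w := (gi_w i).
Local Notation len := (gi_len i).
Local Notation tab := (gi_tab i).
Variables (par : bool) (u0 g : nat).
Hypothesis g_lt : g < 2 ^ len c.
Local Notation inp := (gind_input i u0 (~~ par)).

(** Xor with its own low bits clears them in the coin of the last level, and [g] takes their place;
    the high bits are untouched. *)
Definition patch (l r : nat) : nat :=
  if l == c then Nat.lxor (Nat.lxor r (r %% 2 ^ len l)) g else r.

Lemma g_word : g < 2 ^ b.
Proof.
by rewrite (leq_trans g_lt) // leq_exp2l // (len_le leg) // (c_gt0 leg) leqnn.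
Qed.

Lemma patch_lt l r : 1 <= l <= c -> r < 2 ^ b -> patch l r < 2 ^ b.
Proof.
move=> hl hr; rewrite /patch; case: eqP => // e.
by rewrite !lxor_lt ?g_word // (low_word leg).
Qed.

Definition sinv (l u : nat) (cs ms : seq nat) (st : store) : Prop :=
  [/\ inv i u0 par l u st, st 8 = cs, st 9 = ms, st 11 = [:: g] & st 16 = [::]].

(** [Len] returns a word, so [copy] stops at the length modulo 2^b. *)
Definition trunc (v : seq nat) : seq nat := take (size v %% 2 ^ b) v.

Definition sim_cmd (l : nat) : cmd := if odd l == par then S2 else S1.
(** The zeros fill the fields of [level_ot] that the simulated party does not see. As chooser it is
    handed the low bits of its coin as the string received; as sender it gets the empty output. *)
Definition sim_args (l u r : nat) : seq (seq nat) :=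
  if odd l == par then
    [:: chooser_input (level_ot i l 0 u 0); [:: r %% 2 ^ len l]]
  else [:: sender_input (level_ot i l u 0 r); [::]].
Definition sim_coins (l r : nat) (cs : seq nat) : seq nat :=
  if odd l == par then cs else rcons cs r.

Definition sim_tail : cmd :=
  Seq (copy 14 8) (Seq (copy 15 9) (Seq (Asg 2 (V 12)) (Asg 1 (Add (V 1) (Cst 1))))).

Lemma dets_sim_tail l u cs ms st s1 : 1 <= l <= c ->
  st 0 = inp -> st 1 = [:: l] -> st 3 = [:: pos i (~~ par) l.+1] ->
  st 8 = cs -> st 9 = ms -> st 11 = [:: g] -> st 12 = [:: u] -> st 16 = [::] ->
  exists2 st', dets b sim_tail (store_call st [:: 13; 14; 15] s1)
      (16 + 11 * size (s1 1) + 11 * size (s1 2)) st'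
    & sinv l.+1 u (cs ++ trunc (s1 1)) (ms ++ trunc (s1 2)) st'.
Proof.
move=> hl h0 h1 h3 h8 h9 h11 h12 h16; have b0 := b_gt0 leg.
set st1 := store_call _ _ _.
pose st2 := upd (upd st1 7 [:: size (st1 14) %% 2 ^ b]) 8 (cs ++ trunc (s1 1)).
pose st3 := upd (upd st2 7 [:: size (st2 15) %% 2 ^ b]) 9 (ms ++ trunc (s1 2)).
have e1 : dets b (copy 14 8) st1 (4 + size (s1 1) %% 2 ^ b * 11) st2.
  have := @dets_copy b st1 14 8 b0 isT isT isT.
  by rewrite /st2 /trunc (_ : st1 8 = cs).
have e2 : dets b (copy 15 9) st2 (4 + size (s1 2) %% 2 ^ b * 11) st3.
  have := @dets_copy b st2 15 9 b0 isT isT isT.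
  by rewrite /st3 /trunc (_ : st2 9 = ms).
exists (upd (upd st3 2 [:: u]) 1 [:: l.+1]); last first.
  by split=> //; split.
have l1 : size (s1 1) %% 2 ^ b <= size (s1 1) by apply: leq_mod.
have l2 : size (s1 2) %% 2 ^ b <= size (s1 2) by apply: leq_mod.
apply: (@reds_weak _ _ _ ((4 + size (s1 1) %% 2 ^ b * 11)
  + ((4 + size (s1 2) %% 2 ^ b * 11) + (3 + 5)))); last by lia.
apply: reds_seq e1 _; apply: reds_seq e2 _.
apply: reds_seq; first by apply: (dets_asg _ (v := u)); rewrite evalV /st3 /st2 /st1 /upd /store_call /= h12.
by apply: (incr_level leg hl).
Qed.

Lemma sim_body_draws l u cs ms st : 1 <= l <= c -> u < w l ->
  sinv l u cs ms st ->
  draws b (denote b (sim_body S1 S2 par) st) 16 (fun r h =>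
    calls b h (100 * (w l).+1) (sim_cmd l) (sim_args l u (patch l r))
      (fun s1 => 20 * (size (s1 0) + size (s1 1) + size (s1 2)) + 20)
      (fun s1 => sinv l.+1 (patch l r %% 2 ^ len l)
        (sim_coins l (patch l r) cs ++ trunc (s1 1)) (ms ++ trunc (s1 2)))).
Proof.
move=> hl hu [hi h8 h9 h11 h16]; have [h0 h1 h2 h3] := hi.
have b0 := b_gt0 leg; have lw := w_word leg hl; have lY := len_le leg hl.
rewrite /sim_body; apply: draws_seq (inv_input_n leg hl hi) _.
apply: draws_seq (inv_input_len leg hl hi) _.
apply: draws_seq (dets_clr _ _ _) _.
apply: draws_seq_rnd => r lr.
set st1 := upd _ 10 _.
pose p := patch l r; have lp : p < 2 ^ b by apply: patch_lt.
pose y := p %% 2 ^ len l; have ly : y < 2 ^ b by apply: (low_word leg).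
pose st2 := upd st1 10 [:: p].
have e1 : dets b (If (Op OEq (V 1) (Get 0 (Cst 1)))
    (Asg 10 (Xor (Xor (V 10) (Low (V 10) (V 5))) (V 11))) Skip) st1 20 st2.
  have he : eval b st1 (Op OEq (V 1) (Get 0 (Cst 1))) = (l == c).
    rewrite [LHS]/= mod0n /st1 /upd /= h0 h1 modn_small //; last by lia.
    by rewrite modn_small //; case: (l == c) => /=; lia.
  apply: (@reds_weak _ _ _ (5 + 15)) => //.
  apply: (reds_trans (reds_if _ _ he)).
  rewrite /st2 /p /patch; case: eqP => e.
    apply: (@reds_weak _ _ _ 12) => //; apply: dets_asg.
    apply: eval_xor; last first.
    - exact: g_word.
    - by rewrite lxor_lt // (low_word leg).
    - by rewrite evalV /st1 /upd /= h11.
    apply: eval_xor => //; first by rewrite evalV.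
      by apply: eval_low => //; rewrite evalV.
    exact: (low_word leg).
  apply: (@reds_weak _ _ _ 1) => //.
  rewrite (_ : upd st1 10 _ = st1); first exact: dets_skip.
  apply: functional_extensionality => z; rewrite /st1 /upd.
  by case: eqP.
pose st3 := upd (upd (upd (upd st2 12 [:: y]) 6 [:: k]) 6 [:: k; w l]) 6 [:: k; w l; len l].
have e2 q n a ar gg post :
    calls b (denote b q st3) n a ar gg post ->
    calls b (denote b (Seq (Asg 12 (Low (V 10) (V 5)))
  (Seq (Asg 6 (Get 0 (Cst 0))) (Seq (Push 6 (V 4)) (Seq (Push 6 (V 5)) q)))) st2)
      (6 + (3 + (3 + (3 + n)))) a ar gg post.
  move=> hq; apply: calls_seq.
    by apply: (dets_asg _ (v := y)); apply: eval_low => //; rewrite evalV.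
  apply: calls_seq; first by apply: (dets_asg _ (v := k));
    rewrite eval_getc /st2 /st1 /upd /= ?h0 //; lia.
  apply: calls_seq; first by apply: (dets_push _ (v := w l)); rewrite evalV.
  by apply: calls_seq; first by apply: (dets_push _ (v := len l)); rewrite evalV.
have hpar : eval b st3 (Op OEq (Low (V 1) (Cst 1)) (Cst par)) = (odd l == par).
  by apply: eval_parity => //; rewrite evalV /st3 /st2 /st1 /upd /= h1.
have hgo n a ar post : n <= 43 + w l * 40 ->
    calls b (denote b (Seq (if odd l == par
          then Seq (Push 6 (V 2)) (Call S2 [:: 6; 12] [:: 13; 14; 15])
          else Seq (Push 8 (V 10))
          (Seq (For 7 (V 4)
                 (Push 6 (Xor (V 12) (Get 0 (Add (V 3) (Xor (V 2) (V 7)))))))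
          (Seq (Asg 3 (Add (V 3) (V 4)))
               (Call S1 [:: 6; 16] [:: 13; 14; 15])))) sim_tail) st3) n a ar
      (fun s1 => size (s1 0) + (size (s1 1) + (size (s1 2) + 0))
         + (16 + 11 * size (s1 1) + 11 * size (s1 2))) post ->
    calls b (denote b (Seq (If (Op OEq (V 1) (Get 0 (Cst 1)))
          (Asg 10 (Xor (Xor (V 10) (Low (V 10) (V 5))) (V 11))) Skip)
  (Seq (Asg 12 (Low (V 10) (V 5)))
  (Seq (Asg 6 (Get 0 (Cst 0))) (Seq (Push 6 (V 4)) (Seq (Push 6 (V 5))
  (Seq (If (Op OEq (Low (V 1) (Cst 1)) (Cst par))
          (Seq (Push 6 (V 2)) (Call S2 [:: 6; 12] [:: 13; 14; 15]))
          (Seq (Push 8 (V 10))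
          (Seq (For 7 (V 4)
                 (Push 6 (Xor (V 12) (Get 0 (Add (V 3) (Xor (V 2) (V 7)))))))
          (Seq (Asg 3 (Add (V 3) (V 4)))
               (Call S1 [:: 6; 16] [:: 13; 14; 15]))))) sim_tail)))))) st1)
      (100 * (w l).+1) a ar (fun s1 => 20 * (size (s1 0) + size (s1 1) + size (s1 2)) + 20) post.
  move=> hn hc; have hd := calls_seq e1 (e2 _ _ _ _ _ _
    (calls_reds (reds_seq_if _ _ _ hpar) hc)).
  by apply: calls_weak hd => [|s1]; rewrite /=; lia.
apply: (hgo (43 + w l * 40)) => //; rewrite /sim_cmd /sim_args /sim_coins -/p -/y.
case: eqP => [hp|/eqP hp].
  pose st4 := upd st3 6 [:: k; w l; len l; u].
  have ep : dets b (Push 6 (V 2)) st3 3 st4.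
    by apply: dets_push; rewrite evalV /st3 /st2 /st1 /upd /= h2.
  have hc := calls_seq ep (calls_call b S2 [:: 6; 12] [:: 13; 14; 15] st4).
  have hpos : pos i (~~ par) l.+1 = pos i (~~ par) l.
    by rewrite posS ?hp ?addn0 //; [case: (par); rewrite addn0 | case/andP: hl].
  apply: (calls_weak _ _ (calls_bind (k := denote b sim_tail)
    (g' := fun s1 => 16 + 11 * size (s1 1) + 11 * size (s1 2)) hc _)) => // s1 _ ->.
  by apply: (dets_sim_tail s1 hl) => //; rewrite hpos.
have hs : odd l == ~~ par by case: (odd l) (par) hp => [] [].
have hpos : pos i (~~ par) l + w l = pos i (~~ par) l.+1.
  by rewrite posS ?hs //; case/andP: hl.
have lpos : pos i (~~ par) l + w l < 2 ^ b.
  by rewrite hpos (pos_le leg) //; case/andP: hl.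
pose st4 := upd st3 8 (rcons cs p).
pose st5 := upd (upd st4 7 [:: w l]) 6 (sender_input (level_ot i l u 0 p)).
pose st6 := upd st5 3 [:: pos i (~~ par) l.+1].
have ep : dets b (Push 8 (V 10)) st3 3 st4.
  by rewrite /st4 -h8; apply: dets_push; rewrite evalV.
have ef : dets b (For 7 (V 4)
    (Push 6 (Xor (V 12) (Get 0 (Add (V 3) (Xor (V 2) (V 7))))))) st4 (5 + w l * 20) st5.
  apply: (dets_for_push (N := w l)
    (g := fun a => Nat.lxor y (tab l (Nat.lxor u a)))) => //.
  - by rewrite evalV.
  - by lia.
  - move=> a ys la; have lua : Nat.lxor u a < w l by rewrite lxor_lt.
    apply: eval_xor => //; first by rewrite evalV.
      rewrite -(input_tab u0 hl hs lua) -h0; apply: eval_get.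
      apply: eval_add; first by rewrite evalV /st4 /st3 /st2 /st1 /upd /= h3.
        apply: eval_xor; [by rewrite evalV /st4 /st3 /st2 /st1 /upd /= h2
          | by rewrite evalV | lia | lia].
      by lia.
    by rewrite (leq_trans (tab_lt leg hl lua)) // leq_exp2l.
have e3 : dets b (Asg 3 (Add (V 3) (V 4))) st5 6 st6.
  apply: dets_asg; rewrite -hpos.
  by apply: eval_add; [rewrite evalV /st5 /st4 /st3 /st2 /st1 /upd /= h3 | rewrite evalV |].
have hc := calls_seq ep (calls_seq ef (calls_seq e3
  (calls_call b S1 [:: 6; 16] [:: 13; 14; 15] st6))).
have e16 : st6 16 = [::] by rewrite /st6 /st5 /st4 /st3 /st2 /st1 /upd /= h16.
have ea : [seq st6 x | x <- [:: 6; 16]] = [:: sender_input (level_ot i l u 0 p); [::]].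
  by rewrite /= e16.
rewrite ea in hc.
apply: (calls_weak _ _ (calls_bind (k := denote b sim_tail)
    (g' := fun s1 => 16 + 11 * size (s1 1) + 11 * size (s1 2)) hc _)) => //; last first.
  by move=> s1 _ ->; apply: (dets_sim_tail s1 hl).
by rewrite /= e16 /= size_mkseq; lia.
Qed.

(* The outcome [(halted, store, work)] of a subroutine that does not halt is
   that of the whole simulation. *)
Lemma srun_sim_level (f : bool * store * nat -> rat) (Q : bool * store * nat -> Prop)
    (G : nat -> bool * store * nat -> rat)
    (K : store -> proc store) l u cs ms st n :
  1 <= l <= c -> u < w l -> sinv l u cs ms st ->
  (forall r, r < 2 ^ b ->
    every Q (srun b (denote b (sim_cmd l) (load (sim_args l u (patch l r)))) 0)) ->
  (forall r s1 n1 n', r < 2 ^ b -> Q (false, s1, n1) ->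
    n' <= n + n1 + 200 * (w l).+1 -> f (false, s1, n') = G r (false, s1, n1)) ->
  (forall r s1 n1 n' st', r < 2 ^ b -> Q (true, s1, n1) ->
    n' <= n + n1 + 200 * (w l).+1 + 20 * (size (s1 0) + size (s1 1) + size (s1 2)) ->
    sinv l.+1 (patch l r %% 2 ^ len l)
      (sim_coins l (patch l r) cs ++ trunc (s1 1)) (ms ++ trunc (s1 2)) st' ->
    expect f (srun b (K st') n') = G r (true, s1, n1)) ->
  expect f (srun b (pbind (denote b (sim_body S1 S2 par) st) K) n)
  = avg b (fun r => expect (G r)
      (srun b (denote b (sim_cmd l) (load (sim_args l u (patch l r)))) 0)).
Proof.
move=> hl hu hi hQ Hdead Hlive.
have [h red draw] := sim_body_draws hl hu hi.
have [m1 lm1 ->] := srun_reds b (reds_bind K red).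
rewrite [expect _ _]/=; apply: eq_avg => r lr.
have [K1 red1 post] := draw r lr.
have [m2 lm2 ->] := srun_reds b (reds_bind K red1).
rewrite pbindA -[m2 + _]addn0 expect_srun_bind expect_srun_add.
apply: eq_expect_every; apply: every_imp (hQ r lr) => -[[[] s1] n1] hq /=.
  have [st' red2 hst'] := post s1.
  have [m3 lm3 ->] := srun_reds b (reds_bind K red2).
  by apply: Hlive hst' => //; lia.
by apply: Hdead => //; lia.
Qed.

Definition sim_loop m st : proc store :=
  pbind (wloop b (Cst 1) (sim_body S1 S2 par) m st)
    (denote b (Call Skip [:: 0; 8; 9] [:: 0; 1; 2])).

Lemma sim_loopS m st : sim_loop m.+1 st
  = Tick 2 (pbind (denote b (sim_body S1 S2 par) st) (sim_loop m)).
Proof.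
rewrite /sim_loop (wloopS _ _ _ (b_gt0 leg)).
have e := pbindA (denote b (sim_body S1 S2 par) st)
  (wloop b (Cst 1) (sim_body S1 S2 par) m)
  (denote b (Call Skip [:: 0; 8; 9] [:: 0; 1; 2])).
exact: (congr1 (fun p => Tick 2 p) e).
Qed.

Lemma sim_start : exists2 n, n <= 20 & exists2 st, sinv 1 u0 [::] [::] st &
  forall l, srun b (denote b (gind_sim S1 S2 par) (load [:: inp; [:: g]])) l
    = srun b (sim_loop c st) (n + l).
Proof.
have b0 := b_gt0 leg; have lw := words_bound leg.
rewrite /gind_sim; set s0 := load _.
pose st := upd (upd (upd (upd s0 11 [:: g]) 1 [:: 1]) 2 [:: u0]) 3 [:: 4 + c].
suff h : reds (denote b (gind_sim S1 S2 par) s0) (3 + (2 + (3 + (5 + 3)))) (sim_loop c st).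
  have [n ln H] := srun_reds b h; exists n; first by lia.
  exists st => [|l]; last by rewrite H.
  split => //; split => //; rewrite /st /upd /= /pos.
  by rewrite big_geq // addn0.
apply: reds_seq; first by apply: (dets_asg _ (v := g)); rewrite evalV.
apply: reds_seq; first by apply: (dets_asg _ (v := 1)); apply: eval_cst; lia.
apply: reds_seq; first by apply: (dets_asg _ (v := u0)); rewrite eval_getc //; lia.
apply: reds_seq.
  apply: (dets_asg _ (v := 4 + c)); apply: eval_add; first by apply: eval_cst; lia.
    by rewrite eval_getc //; lia.
  by lia.
have h : reds (denote b (While (Get 0 (Cst 1)) (Cst 1) (sim_body S1 S2 par)) st)
    3 (wloop b (Cst 1) (sim_body S1 S2 par) c st).
  by rewrite denote_while eval_getc; [apply: (RedsTick (RedsRefl _ 0)) | lia].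
exact: (reds_bind (denote b (Call Skip [:: 0; 8; 9] [:: 0; 1; 2])) h).
Qed.

(** The simulator as programmed: patched coin, truncated copies, and a stuck subroutine that ends
    everything with empty arrays. [sim_value] below is its idealisation. *)
Fixpoint prog_value (Phi : seq nat -> seq nat -> seq nat -> rat)
    (m l u : nat) (cs ms : seq nat) : rat :=
  if m is m'.+1 then
    avg b (fun r => expect (fun x =>
      if x.1.1 then prog_value Phi m' l.+1 (patch l r %% 2 ^ len l)
        (sim_coins l (patch l r) cs ++ trunc (x.1.2 1)) (ms ++ trunc (x.1.2 2))
      else Phi [::] [::] [::])
      (srun b (denote b (sim_cmd l) (load (sim_args l u (patch l r)))) 0))
  else Phi inp cs ms.

Lemma srun_dead p n : every (fun x : bool * store * nat => x.1.1 \/ x.1.2 = load [::]) (srun b p n).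
Proof.
elim: p n => [s|m q IH|h IH|m q _|h _] n /=; try by [left | right].
  exact: IH.
by move=> r _; apply: IH.
Qed.

Lemma expect_sim_loop Phi m l u cs ms st n :
  1 <= l -> m + l = c.+1 -> (0 < m -> u < w l) -> sinv l u cs ms st ->
  expect (fun x => Phi (x.1.2 0) (x.1.2 1) (x.1.2 2)) (srun b (sim_loop m st) n)
  = prog_value Phi m l u cs ms.
Proof.
elim: m l u cs ms st n => [|m IH] l u cs ms st n l0 hm hu hi.
  by case: hi => [[h0 _ _ _] h8 h9 _ _]; rewrite /= /load /= h0 h8 h9.
have hl : 1 <= l <= c by lia.
rewrite sim_loopS [srun _ _ _]/= [RHS]/=.
apply: (srun_sim_level (Q := fun x : bool * store * nat => x.1.1 \/ x.1.2 = load [::]) hl (hu _) hi) => //.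
- by move=> r _; apply: srun_dead.
- by move=> r s1 n1 n' _ [//|/= -> _].
- move=> r s1 n1 n' st' _ _ _ hst'; apply: IH hst' => //; first by lia.
  by move=> m0; apply: index_lt; lia.
Qed.

Lemma expect_gind_sim Phi : u0 < w 1 ->
  expect (fun x => Phi (x.1.2 0) (x.1.2 1) (x.1.2 2))
    (srun b (denote b (gind_sim S1 S2 par) (load [:: inp; [:: g]])) 0)
  = prog_value Phi c 1 u0 [::] [::].
Proof.
move=> hu; have [n _ [st hst ->]] := sim_start.
by apply: expect_sim_loop hst => //; rewrite addn1.
Qed.

(** * Running time of the simulator *)

Section Time.
Variable tS : nat.
Hypothesis sub_time : forall l u r, 1 <= l <= c -> u < w l -> r < 2 ^ b ->
  every (fun x => x.2 <= tS) (srun b (denote b (sim_cmd l) (load (sim_args l u r))) 0).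

Definition sub_ok (l : nat) (x : bool * store * nat) : Prop :=
  x.2 <= tS /\ forall y, size (x.1.2 y) <= w l + 4 + tS.

Lemma every_sub_ok l u r : 1 <= l <= c -> u < w l -> r < 2 ^ b ->
  every (sub_ok l) (srun b (denote b (sim_cmd l) (load (sim_args l u r))) 0).
Proof.
clear g_lt g; move=> hl hu hr.
have hs : every (fun x => forall y, size (x.1.2 y) <= w l + 4 + x.2)
    (srun b (denote b (sim_cmd l) (load (sim_args l u r))) 0).
  apply: srun_sized; rewrite addn0; apply: sized_denote => y.
  rewrite /load /sim_args; case: ifP => _; case: y => [|[|y]] //=;
    rewrite ?nth_nil ?size_mkseq //; lia.
apply: every_imp (every_and (sub_time hl hu hr) hs) => x /= [h1 h2].
by split=> // y; apply: (leq_trans (h2 y)); rewrite leq_add2l.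
Qed.

(** The summands [2 * (size cs + size ms)] and [2 * I] are the two copies made by the final [Call].
    Charging them in advance makes a level pay at once for the words that it appends. *)
Lemma every_sim_loop I L m l u cs ms st n W :
  size inp <= I -> (forall a, 1 <= a <= c -> w a + 5 + tS <= L) ->
  1 <= l -> m + l = c.+1 -> (0 < m -> u < w l) -> sinv l u cs ms st ->
  n + 2 * (size cs + size ms) + m * (270 * L) + 2 * I + 10 <= W ->
  every (fun x => x.2 <= W) (srun b (sim_loop m st) n).
Proof.
move=> hI hL; rewrite every_expect.
elim: m l u cs ms st n => [|m IH] l u cs ms st n l0 hm hu hi hW.
  case: hi => [[h0 _ _ _] h8 h9 _ _]; move: hI h0.
  move: (gind_input _ _ _) => v hI h0; rewrite [srun _ _ _]/= h0 h8 h9 /=.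
  by case: (leqP _ W) => // h; exfalso; move: h; rewrite /load /=; lia.
have hl : 1 <= l <= c by lia.
have lL := hL l hl.
rewrite sim_loopS [srun _ _ _]/=.
rewrite (srun_sim_level (Q := sub_ok l) (G := fun _ _ => 0%R) hl (hu _) hi) //.
- by rewrite -[RHS](avg_cst b); apply: eq_avg => r _; rewrite expect_cst.
- by move=> r hr; apply: every_sub_ok => //; [apply: hu | apply: patch_lt].
- move=> r s1 n1 n' _ [/= h1 _] hn'.
  by case: (leqP _ W) => // h; exfalso; lia.
- move=> r s1 n1 n' st' _ [/= h1 h2] hn' hst'; apply: IH hst' _ => //; first by lia.
    by move=> m0; apply: index_lt; lia.
  have tr v : size (trunc v) <= size v by rewrite size_take_min geq_minr.
  have := h2 0; have := h2 1; have := h2 2; have := tr (s1 1); have := tr (s1 2).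
  have : size (sim_coins l (patch l r) cs) <= (size cs).+1.
    by rewrite /sim_coins; case: ifP; rewrite ?size_rcons.
  by rewrite !size_cat; move: hW; rewrite [m.+1 * _]mulSn; lia.
Qed.

Lemma every_gind_sim : u0 < w 1 ->
  every (fun x => x.2 <= (\sum_(1 <= a < c.+1) w a + b + tS + 10) ^ 2 * 600)
    (srun b (denote b (gind_sim S1 S2 par) (load [:: inp; [:: g]])) 0).
Proof.
move=> hu; have [n ln [st hst ->]] := sim_start.
have cw := levels_le i; have sI := size_input i u0 (~~ par).
move: cw sI; set Sw := \sum_(1 <= a < c.+1) w a => cw sI.
have hL a : 1 <= a <= c -> w a + 5 + tS <= Sw + 5 + tS.
  by move=> /w_bound h; rewrite !leq_add2r.
apply: (every_sim_loop sI hL _ _ _ hst) => //; first by rewrite addn1.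
have h1 : c * (270 * (Sw + 5 + tS)) <= 270 * (Sw + b + tS + 10) ^ 2.
  by rewrite mulnCA expnS expn1 leq_mul2l leq_mul //; lia.
have h2 : 10 * (Sw + b + tS + 10) <= (Sw + b + tS + 10) ^ 2.
  by rewrite expnS expn1 leq_mul2r; apply/orP; right; lia.
by rewrite /=; lia.
Qed.

End Time.

End Simulator.

(** * Replacing real levels by simulated ones *)

Section Analysis.
Variables (beta : nat) (ots otc S1 S2 : cmd) (i : gind_inst).
Hypothesis leg : gind_legal beta i.
Local Notation b := (gi_b i).
Local Notation c := (gi_c i).
Local Notation w := (gi_w i).
Local Notation len := (gi_len i).
Local Notation tab := (gi_tab i).
Local Notation ot_run := (ot_run beta ots otc).

Lemma gi_j_lt l : l < c -> gi_j i l < w l.+1.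
Proof.
elim: l => [|l IH] hl; first by case: leg => _ _ _ _ [].
have h : gi_tab i l.+1 (gi_j i l) < 2 ^ len l.+1.
  by apply: (tab_lt leg); [lia | apply: IH; lia].
by move: h; rewrite /gi_len ifF //; apply/eqP; lia.
Qed.

Lemma gi_j_last : gi_j i c < 2 ^ len c.
Proof.
have := c_gt0 leg; have := @gi_j_lt c.-1; have := @tab_lt _ _ leg c (gi_j i c.-1).
case: c => // n h1 h2 _ /=; apply: h1; first by rewrite ltnSn.
by apply: h2.
Qed.

Lemma expect_sim_out1 h o : expect h (sim_out1 (F := OT beta) S1 o)
  = expect (fun x : bool * store * nat =>
      h [:: x.1.2 0; x.1.2 1; x.1.2 2; [:: nth 0 (ot_x o) (ot_j o)]])
    (srun (ot_b o) (denote (ot_b o) S1 (load [:: sender_input o; [::]])) 0).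
Proof.
rewrite /sim_out1 /simulation1 /= !expect_bind /=.
exact: (expect_solo _ (fun x : bool * store * nat => h [:: x.1.2 0; x.1.2 1; x.1.2 2; [:: nth 0 (ot_x o) (ot_j o)]])).
Qed.

Lemma expect_sim_out2 h o : expect h (sim_out2 (F := OT beta) S2 o)
  = expect (fun x : bool * store * nat =>
      h [:: x.1.2 0; x.1.2 1; x.1.2 2; [::]])
    (srun (ot_b o) (denote (ot_b o) S2
       (load [:: chooser_input o; [:: nth 0 (ot_x o) (ot_j o)]])) 0).
Proof.
rewrite /sim_out2 /simulation2 /= !expect_bind /=.
exact: (expect_solo _ (fun x : bool * store * nat => h [:: x.1.2 0; x.1.2 1; x.1.2 2; [::]])).
Qed.

Lemma expect_view_out1 h o : expect h (view_out1 (F := OT beta) ots otc o)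
  = expect (fun t => h [:: sender_input o; coins (log1 t); rcvd (log1 t); fin2 t 0])
    (ot_run o).
Proof. exact: expect_bind. Qed.

Lemma expect_view_out2 h o : expect h (view_out2 (F := OT beta) ots otc o)
  = expect (fun t => h [:: chooser_input o; coins (log2 t); rcvd (log2 t); fin1 t 0])
    (ot_run o).
Proof. exact: expect_bind. Qed.

Lemma nth_level_ot l p q r : q < w l ->
  nth 0 (ot_x (level_ot i l p q r)) q = Nat.lxor (r %% 2 ^ len l) (tab l (Nat.lxor p q)).
Proof. by move=> hq; rewrite /= nth_mkseq. Qed.

Variables (s0 T : nat) (delta : rat) (par : bool).
Hypothesis close1 : forall l p q r (C : circuit), 1 <= l <= c -> p < w l -> q < w l ->
  size C <= 14 + s0 ->
  (`|prob (accepts C) (sim_out1 (F := OT beta) S1 (level_ot i l p q r))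
   - prob (accepts C) (view_out1 (F := OT beta) ots otc (level_ot i l p q r))| <= delta)%R.
Hypothesis close2 : forall l p q r (C : circuit), 1 <= l <= c -> p < w l -> q < w l ->
  size C <= 14 + s0 ->
  (`|prob (accepts C) (sim_out2 (F := OT beta) S2 (level_ot i l p q r))
   - prob (accepts C) (view_out2 (F := OT beta) ots otc (level_ot i l p q r))| <= delta)%R.
Hypothesis T_word : T < 2 ^ b.

Local Notation sim_level l u r := (srun b
  (denote b (sim_cmd S1 S2 par l) (load (sim_args i par l u r))) 0).
Hypothesis sub_size : forall l u r, 1 <= l <= c -> u < w l -> r < 2 ^ b ->
  every (fun x : bool * store * nat => forall y, size (x.1.2 y) <= T) (sim_level l u r).

Lemma delta_ge0 : (0 <= delta)%R.
Proof.
have h1 : 1 <= 1 <= c by rewrite (c_gt0 leg).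
have w1 : 0 < w 1 by rewrite expn_gt0.
by apply: le_trans (close1 (l := 1) (p := 0) (q := 0) 0 (C := [::]) h1 w1 w1 _).
Qed.

(** The privacy of the sender's side is what mentions the output of the chooser, so [close1] serves
    whichever party is observed. In the simulated pair that output is the right string, so a test of
    one bit has probability 0 or 1 and the distance is exactly the error probability of that bit. *)
Lemma received_correct l p q r : 1 <= l <= c -> p < w l -> q < w l ->
  (expect (fun t => (received i l t
      != Nat.lxor (r %% 2 ^ len l) (tab l (Nat.lxor p q)))%:R)
    (ot_run (level_ot i l p q r)) <= b%:R * delta)%R.
Proof.
move=> hl hp hq; set o := level_ot _ _ _ _ _; set z := Nat.lxor _ _.
have lz : z < 2 ^ len l by rewrite lxor_lt ?low_lt ?(tab_lt leg) // lxor_lt.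
pose wrong (j : nat) (t : outcome) : rat :=
  (Nat.testbit (nth 0 (fin2 t 0) 0) j != Nat.testbit z j)%:R%R.
have hw j : (expect (wrong j) (ot_run o) <= delta)%R.
  have := close1 r (C := [:: Bit 3 0 j]) hl hp hq isT.
  rewrite !probE expect_sim_out1 expect_view_out1 nth_level_ot //.
  rewrite /accepts /= expect_cst -/z -/o /wrong; case: (Nat.testbit z j) => /=.
    rewrite -[X in (`|X - _|)%R](expect_cst 1%R (ot_run o)) -expectB.
    move=> /(le_trans (ler_norm _)); apply: le_trans; apply: le_expect => t.
    by case: Nat.testbit; rewrite /= ?subr0 ?subrr.
  rewrite sub0r normrN => /(le_trans (ler_norm _)); apply: le_trans.
  by apply: le_expect => t; case: Nat.testbit.
apply: (@le_trans _ _ (expect (fun t => \sum_(j < len l) wrong j t)%R (ot_run o))).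
  apply: le_expect => t; case: eqP => [_|ne] /=.
    by apply: sumr_ge0 => j _; rewrite ler0n.
  suff [j hj] : exists j : 'I_(len l),
      Nat.testbit (nth 0 (fin2 t 0) 0) j != Nat.testbit z j.
    rewrite (bigD1 j) //= /wrong hj lerDl.
    by apply: sumr_ge0 => j' _; rewrite ler0n.
  apply/existsP; apply: contraT; rewrite negb_exists => /forallP h.
  case: ne; apply: PeanoNat.Nat.bits_inj => j; rewrite /received testbit_low.
  rewrite -(modn_small lz) testbit_low; case: ltnP => //= hj.
  by have := h (Ordinal hj); rewrite negbK => /eqP.
rewrite (expect_sum _ wrong) (@le_trans _ _ (\sum_(j < len l) delta)%R) //.
  by apply: ler_sum => j _; apply: hw.
rewrite sumr_const card_ord -[(delta *+ _)%R]mulr_natl ler_wpM2r ?delta_ge0 //.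
by rewrite ler_nat (len_le leg).
Qed.

(* The oblivious transfer of level [l] in which the party of parity [par], with
   share [u], ends up with the share [low r]. *)
Definition ideal_ot (l u v r : nat) : ot_inst :=
  if odd l == par then level_ot i l v u (Nat.lxor r (tab l (Nat.lxor v u)))
  else level_ot i l u v r.
Definition real_view (l u v r : nat) : rtree (seq (seq nat)) :=
  if odd l == par then view_out2 (F := OT beta) ots otc (ideal_ot l u v r)
  else view_out1 (F := OT beta) ots otc (ideal_ot l u v r).
Definition sim_view (l u v r : nat) : rtree (seq (seq nat)) :=
  if odd l == par then sim_out2 (F := OT beta) S2 (ideal_ot l u v r)
  else sim_out1 (F := OT beta) S1 (ideal_ot l u v r).

Lemma close_views l u v r (C : circuit) : 1 <= l <= c -> u < w l -> v < w l ->
  size C <= 14 + s0 ->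
  (`|prob (accepts C) (real_view l u v r) - prob (accepts C) (sim_view l u v r)| <= delta)%R.
Proof.
move=> hl hu hv hC; rewrite /real_view /sim_view /ideal_ot distrC.
by case: (odd l == par); [apply: close2 | apply: close1].
Qed.

(** The left side ignores [v]: the coin in [ideal_ot] is shifted so that a chooser obtains the low
    bits of [r] whatever the other share is, and a sender's simulator never sees that share. *)
Lemma expect_sim_level (h : seq nat -> seq nat -> seq nat -> rat) l u v r :
  u < w l -> v < w l ->
  1 <= l <= c ->
  expect (fun x : bool * store * nat => h (x.1.2 0) (x.1.2 1) (x.1.2 2)) (sim_level l u r)
  = expect (fun d => h (nth [::] d 0) (nth [::] d 1) (nth [::] d 2)) (sim_view l u v r).
Proof.
move=> hu hv hl; rewrite /sim_view /sim_cmd /sim_args /ideal_ot; case: (odd l == par).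
  rewrite expect_sim_out2 nth_level_ot // lxor_low.
  by rewrite (modn_small (tab_lt leg hl _)) ?lxorK // lxor_lt.
by rewrite expect_sim_out1.
Qed.

Lemma sim_view_size4 l u v r : every (fun d => size d = 4) (sim_view l u v r).
Proof.
by rewrite /sim_view; case: ifP => _; rewrite /sim_out1 /sim_out2 every_bind;
  apply: every_all.
Qed.

Lemma real_view_size4 l u v r : every (fun d => size d = 4) (real_view l u v r).
Proof.
by rewrite /real_view; case: ifP => _; rewrite /view_out1 /view_out2 every_bind;
  apply: every_all.
Qed.

Lemma sim_view_small l u v r : 1 <= l <= c -> u < w l -> v < w l -> r < 2 ^ b ->
  every (fun d => size (nth [::] d 1) <= T /\ size (nth [::] d 2) <= T)
    (sim_view l u v r).
Proof.
move=> hl hu hv hr.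
pose P (d : seq (seq nat)) := (size (nth [::] d 1) <= T) && (size (nth [::] d 2) <= T).
suff : every P (sim_view l u v r) by apply: every_imp => d /andP.
apply/every_expect.
have := expect_sim_level (fun a x y => (~~ ((size x <= T) && (size y <= T))%N)%:R)%R
  r hu hv hl.
rewrite /P => <-.
rewrite -[RHS](expect_cst 0%R (sim_level l u r)); apply: eq_expect_every.
by apply: every_imp (sub_size hl hu hr) => x h; rewrite !h.
Qed.

(* Also bounds the probability that a simulator gets stuck, as the view that it
   then leaves lacks the input. *)
Lemma sim_level_halts l u v r : 1 <= l <= c -> u < w l -> v < w l ->
  (expect (fun x : bool * store * nat => (~~ x.1.1)%:R) (sim_level l u r) <= delta)%R.
Proof.
move=> hl hu hv; have := close_views r (C := [:: Has 0 0]) hl hu hv isT.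
rewrite !probE -(expect_sim_level (fun a x y => (0 < size a)%N%:R)%R r hu hv hl).
have -> : expect (fun d => (accepts [:: Has 0 0] d)%:R)%R (real_view l u v r) = 1%R.
  rewrite /real_view; case: ifP => _.
    by rewrite expect_view_out2 expect_cst.
  by rewrite expect_view_out1 expect_cst.
rewrite -{1}[1%R](expect_cst 1%R (sim_level l u r)) -expectB.
move=> /(le_trans (ler_norm _)); apply: le_trans; apply: le_expect_every.
apply: every_imp (srun_dead _ _ _) => x [-> /=|->].
  by case: (0 < _); rewrite ?subrr ?subr0.
by rewrite /load /= subr0; case: (~~ _).
Qed.

(** * Hybrid argument over the levels *)

Section Test.
Variable F : seq nat -> seq nat -> seq nat -> rat.
Variable eta : rat.
Hypothesis F01 : forall x y z, (0 <= F x y z <= 1)%R.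
Hypothesis F_close : forall l u v r pc qc pm qm z, 1 <= l <= c -> u < w l -> v < w l ->
  r < 2 ^ b ->
  (`|expect (fun d => F (pc ++ nth [::] d 1 ++ qc) (pm ++ nth [::] d 2 ++ qm) z)
       (real_view l u v r)
   - expect (fun d => F (pc ++ nth [::] d 1 ++ qc) (pm ++ nth [::] d 2 ++ qm) z)
       (sim_view l u v r)| <= eta)%R.

(** Only [u] is carried along. The output of the other party is reconstructed at the end from [u]
    and the true final index. *)
Fixpoint sim_value (m l u : nat) (cs ms : seq nat) : rat :=
  if m is m'.+1 then
    avg b (fun r => expect (fun x : bool * store * nat =>
      sim_value m' l.+1 (r %% 2 ^ len l)
        (sim_coins par l r cs ++ x.1.2 1) (ms ++ x.1.2 2)) (sim_level l u r))
  else F cs ms [:: Nat.lxor u (gi_j i c)].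

Lemma expect01 X (f : X -> rat) t : (forall x, (0 <= f x <= 1)%R) ->
  (0 <= expect f t <= 1)%R.
Proof.
move=> h; apply/andP; split; first by apply: expect_ge0 => x; case/andP: (h x).
by rewrite -[leRHS](expect_cst 1%R t); apply: le_expect => x; case/andP: (h x).
Qed.

Lemma avg01 n f : (forall r, (0 <= f r <= 1)%R) -> (0 <= avg n f <= 1)%R.
Proof.
move=> h; apply/andP; split; first rewrite -[leLHS](avg_cst n);
  last rewrite -[leRHS](avg_cst n); by apply: le_avg => r _; case/andP: (h r).
Qed.

Lemma real_value01 m l u v cs ms :
  (0 <= real_value beta ots otc i par F m l u v cs ms <= 1)%R.
Proof.
elim: m l u v cs ms => [|m IH] l u v cs ms //=.
by apply: avg01 => r; apply: expect01 => t.
Qed.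

Lemma sim_value01 m l u cs ms : (0 <= sim_value m l u cs ms <= 1)%R.
Proof.
elim: m l u cs ms => [|m IH] l u cs ms //=.
by apply: avg01 => r; apply: expect01 => t.
Qed.

Lemma sim_coins_cat l r x y : sim_coins par l r (x ++ y) = x ++ sim_coins par l r y.
Proof. by rewrite /sim_coins; case: ifP; rewrite ?rcons_cat. Qed.

(* The later levels do not depend on what is inserted into the view. *)
Lemma sim_value_insert (D E : rtree (seq (seq nat))) x m l u pc qc pm qm :
  (forall pc qc pm qm z,
    `|expect (fun d => F (pc ++ nth [::] d 1 ++ qc) (pm ++ nth [::] d 2 ++ qm) z) D
    - expect (fun d => F (pc ++ nth [::] d 1 ++ qc) (pm ++ nth [::] d 2 ++ qm) z) E|
    <= x)%R ->
  (`|expect (fun d => sim_value m l u (pc ++ nth [::] d 1 ++ qc) (pm ++ nth [::] d 2 ++ qm)) D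
   - expect (fun d => sim_value m l u (pc ++ nth [::] d 1 ++ qc) (pm ++ nth [::] d 2 ++ qm)) E|
  <= x)%R.
Proof.
move=> H; elim: m l u pc qc pm qm => [|m IH] l u pc qc pm qm /=; first exact: H.
rewrite !expect_avg; apply: avg_dist_le => r _.
rewrite exchange_expect [X in (`|_ - X|)%R]exchange_expect.
apply: expect_dist_le; apply: every_all => t.
have e X : expect (fun d => sim_value m l.+1 (r %% 2 ^ len l)
      (sim_coins par l r (pc ++ nth [::] d 1 ++ qc) ++ t.1.2 1)
      ((pm ++ nth [::] d 2 ++ qm) ++ t.1.2 2)) X
    = expect (fun d => sim_value m l.+1 (r %% 2 ^ len l)
      (pc ++ nth [::] d 1 ++ (sim_coins par l r qc ++ t.1.2 1))
      (pm ++ nth [::] d 2 ++ (qm ++ t.1.2 2))) X.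
  by apply: eq_expect => d; rewrite !sim_coins_cat -!catA.
by rewrite !e; apply: IH.
Qed.

(** The two sides agree whenever the string received is right. An observed sender already has the
    low bits of the coin as its share; for an observed chooser the coin is first shifted by the
    table entry. *)
Lemma correct_level (R : nat -> nat -> seq nat -> seq nat -> rat) l u v cs ms :
  (forall x y z t, 0 <= R x y z t <= 1)%R -> 1 <= l <= c -> u < w l -> v < w l ->
  (`|avg b (fun r => expect (fun t => R (share1 i par l r t) (share2 i par l r t)
       (coins1 par l r t cs) (rcvd1 par l t ms)) (ot_run (ot_of i par l u v r)))
   - avg b (fun r => expect (fun d => R (r %% 2 ^ len l)%N
       (Nat.lxor (r %% 2 ^ len l)%N (tab l (Nat.lxor u v)))
       (sim_coins par l r cs ++ nth [::] d 1) (ms ++ nth [::] d 2))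
       (real_view l u v r))| <= b%:R * delta)%R.
Proof.
move=> R01 hl hu hv.
have close (f g : outcome -> rat) p q r :
    (forall t, 0 <= f t <= 1)%R -> (forall t, 0 <= g t <= 1)%R ->
    p < w l -> q < w l ->
    (forall t, received i l t = Nat.lxor (r %% 2 ^ len l) (tab l (Nat.lxor p q)) ->
      f t = g t) ->
    (`|expect f (ot_run (level_ot i l p q r)) - expect g (ot_run (level_ot i l p q r))|
      <= b%:R * delta)%R.
  move=> f01 g01 hp hq h; apply: le_trans (received_correct r hl hp hq).
  apply: le_trans (expect_dist _ _ _) _; apply: le_expect => t.
  case: eqP => [/h ->|_] /=; first by rewrite subrr normr0.
  by have /andP[? ?] := f01 t; have /andP[? ?] := g01 t; rewrite ler_norml; lra.
rewrite /real_view /ideal_ot /ot_of /share1 /share2 /coins1 /rcvd1 /sim_coins.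
case: (odd l == par); last first.
  apply: avg_dist_le => r hr; rewrite expect_view_out1 /=.
  by apply: close => // t ->.
pose z := tab l (Nat.lxor v u).
have lz : z < 2 ^ b.
  have lvu : Nat.lxor v u < w l by rewrite lxor_lt.
  by rewrite (leq_trans (tab_lt leg hl lvu)) // leq_exp2l // (len_le leg).
(* Undoes the shift built into [ideal_ot], so that both sides run the same transfer for each
   coin. *)
rewrite -[X in (`|_ - X|)%R](avg_lxor _ lz).
apply: avg_dist_le => r hr; rewrite expect_view_out2 /= lxorK.
rewrite [Nat.lxor u v]lxorC -/z lxor_low.
rewrite (modn_small (tab_lt leg hl _)); last by rewrite lxor_lt.
by rewrite lxorK; apply: close => // t ->.
Qed.

(** The shares always xor to the current index, the last level played being [l.-1]. A level costs
    [b * delta] for correcting the string received and [eta] for exchanging its view; in between,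
    the later levels are replaced by induction. *)
Lemma real_sim_value m l u v cs ms :
  1 <= l -> m + l = c.+1 -> (0 < m -> u < w l) -> (0 < m -> v < w l) ->
  Nat.lxor u v = gi_j i l.-1 ->
  (`|real_value beta ots otc i par F m l u v cs ms - sim_value m l u cs ms|
   <= m%:R * (b%:R * delta + eta))%R.
Proof.
elim: m l u v cs ms => [|m IH] l u v cs ms l0 hm hu hv huv.
  rewrite /= mul0r (_ : v = Nat.lxor u (gi_j i c)) ?subrr ?normr0 //.
  by rewrite -(_ : l.-1 = c) -?huv ?lxorKl //; lia.
have hl : 1 <= l <= c by lia.
have {}hu : u < w l by apply: hu.
have {}hv : v < w l by apply: hv.
pose ideal r := (Nat.lxor (r %% 2 ^ len l) (tab l (Nat.lxor u v))).
pose step1 := avg b (fun r => expect (fun d =>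
  real_value beta ots otc i par F m l.+1 (r %% 2 ^ len l) (ideal r)
       (sim_coins par l r cs ++ nth [::] d 1) (ms ++ nth [::] d 2))
       (real_view l u v r)).
pose step2 (view : nat -> nat -> nat -> nat -> rtree (seq (seq nat))) :=
  avg b (fun r => expect (fun d =>
  sim_value m l.+1 (r %% 2 ^ len l)
       (sim_coins par l r cs ++ nth [::] d 1) (ms ++ nth [::] d 2))
       (view l u v r)).
have e1 : (`|real_value beta ots otc i par F m.+1 l u v cs ms - step1| <= b%:R * delta)%R.
  apply: (@correct_level (fun x y z t => real_value beta ots otc i par F m l.+1 x y z t)) => //.
  by move=> x y z t; apply: real_value01.
have e2 : (`|step1 - step2 real_view| <= m%:R * (b%:R * delta + eta))%R.
  apply: avg_dist_le => r hr; apply: expect_dist_le; apply: every_all => d.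
  apply: IH => //.
  - by lia.
  - by move=> m0; apply: index_lt; lia.
  - move=> m0; have := @tab_lt _ _ leg l (Nat.lxor u v) hl; rewrite lxor_lt // => /(_ isT).
    rewrite /ideal /gi_w /gi_len ifF; last by apply/eqP; lia.
    by apply: lxor_lt; rewrite low_lt.
  - by rewrite /ideal lxorKl huv; case: (l) l0.
have e3 : (`|step2 real_view - step2 sim_view| <= eta)%R.
  apply: avg_dist_le => r hr.
  have := @sim_value_insert (real_view l u v r) (sim_view l u v r) eta m l.+1
    (r %% 2 ^ len l) (sim_coins par l r cs) [::] ms [::] _.
  have e X : expect (fun d => sim_value m l.+1 (r %% 2 ^ len l)
      (sim_coins par l r cs ++ nth [::] d 1 ++ [::]) (ms ++ nth [::] d 2 ++ [::])) X
    = expect (fun d => sim_value m l.+1 (r %% 2 ^ len l)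
      (sim_coins par l r cs ++ nth [::] d 1) (ms ++ nth [::] d 2)) X.
    by apply: eq_expect => d; rewrite !cats0.
  by rewrite !e; apply => *; apply: F_close.
have e4 : sim_value m.+1 l u cs ms = step2 sim_view.
  apply: eq_avg => r hr.
  exact: (expect_sim_level (fun _ x y => sim_value m l.+1 (r %% 2 ^ len l)
    (sim_coins par l r cs ++ x) (ms ++ y)) r hu hv hl).
rewrite e4 -natr1 mulrDl mul1r.
move: e1 e2 e3; rewrite !ler_norml => /andP[? ?] /andP[? ?] /andP[? ?].
by apply/andP; split; lra.
Qed.

End Test.

(** * From the program of the simulator to its idealisation *)

Section Program.
Variables (u0 : nat) (A : seq nat -> seq nat -> seq nat -> seq nat -> rat).
Hypothesis A01 : forall a x y z, (0 <= A a x y z <= 1)%R.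
Local Notation inp := (gind_input i u0 (~~ par)).
Local Notation outputs g := (fun a x y => A a x y [:: Nat.lxor g (gi_j i c)]).
Local Notation prog g := (prog_value S1 S2 i par u0 g (outputs g)).
Local Notation sim := (sim_value (A inp)).

Lemma prog_value01 g m l u cs ms : (0 <= prog g m l u cs ms <= 1)%R.
Proof.
elim: m l u cs ms => [|m IH] l u cs ms //=.
by apply: avg01 => r; apply: expect01 => x; case: x.1.1.
Qed.

Lemma trunc_small v : size v <= T -> trunc i v = v.
Proof.
by move=> h; rewrite /trunc modn_small ?take_size // (leq_ltn_trans h).
Qed.

(** On a stuck subroutine the two values, both in [0,1], differ by at most 1, and this event has
    probability at most [delta]; the other share in [sim_level_halts] is arbitrary and is taken to
    be 0. *)
Lemma expect_halting (f h : bool * store * nat -> rat) l u r (x : rat) :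
  1 <= l <= c -> u < w l -> r < 2 ^ b -> (0 <= x)%R ->
  (forall y, 0 <= f y <= 1)%R -> (forall y, 0 <= h y <= 1)%R ->
  (forall y : bool * store * nat, y.1.1 -> (forall a, size (y.1.2 a) <= T) -> (`|f y - h y| <= x)%R) ->
  (`|expect f (sim_level l u r) - expect h (sim_level l u r)| <= delta + x)%R.
Proof.
move=> hl hu hr x0 f01 h01 H; have w0 : 0 < w l by rewrite expn_gt0.
apply: le_trans (expect_dist _ _ _) _.
apply: (@le_trans _ _ (expect (fun y : bool * store * nat => (~~ y.1.1)%:R + x)%R
    (sim_level l u r))).
  apply: le_expect_every; apply: every_imp (sub_size hl hu hr) => y hy.
  case e: y.1.1 => /=; first by rewrite add0r H.
  have /andP[? ?] := f01 y; have /andP[? ?] := h01 y.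
  by rewrite ler_norml; apply/andP; split; lra.
by rewrite expectD expect_cst lerD2r (sim_level_halts _ hl hu w0).
Qed.

(** The average over [g] is pushed through all levels down to the last, where [avg_patch] turns the
    patched coin into a uniform one with low bits [g]. With [m = 0] no coin would be left to tie [u]
    to [g]. *)
Lemma prog_sim_value m l u cs ms : 0 < m -> 1 <= l -> m + l = c.+1 -> u < w l ->
  (`|avg (len c) (fun g => prog g m l u cs ms) - sim m l u cs ms| <= m%:R * delta)%R.
Proof.
have d0 := delta_ge0.
elim: m l u cs ms => [//|m IH] l u cs ms _ l0 hm hu.
have hl : 1 <= l <= c by lia.
case: (posnP m) => m0.
  have lc : l = c by lia.
  subst m; rewrite /= /patch -lc eqxx mul1r.
  rewrite (avg_patch (fun g r => expect (fun x : bool * store * nat =>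
    if x.1.1 then A inp (sim_coins par l r cs ++ trunc i (x.1.2 1)) (ms ++ trunc i (x.1.2 2))
       [:: Nat.lxor g (gi_j i l)]
    else A [::] [::] [::] [:: Nat.lxor g (gi_j i l)]) (sim_level l u r))).
    apply: avg_dist_le => r hr; rewrite -[leRHS]addr0.
    apply: expect_halting => // [y|y hy hs]; first by case: ifP.
    by rewrite hy !trunc_small // subrr normr0.
  exact: (len_le leg).
have lc : (l == c) = false by apply/eqP; lia.
rewrite /= /patch lc exchange_avg.
have -> : (m.+1%:R * delta = delta + m%:R * delta)%R by rewrite -natr1; ring.
apply: avg_dist_le => r hr; rewrite -expect_avg.
apply: expect_halting => //.
- by rewrite mulr_ge0 ?ler0n.
- by move=> y; apply: avg01 => g; case: ifP => _; rewrite ?prog_value01.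
- by move=> y; apply: sim_value01.
move=> y hy hs; rewrite hy !trunc_small //; apply: IH => //; first by lia.
by apply: index_lt; lia.
Qed.

End Program.

Variables (WOT COT : nat -> nat -> nat).
Hypothesis OT_work :
  has_work (F := OT beta) ots otc (fun o => WOT (ot_w o) (ot_k o)).
Hypothesis OT_comm :
  has_comm (F := OT beta) ots otc (fun o => COT (ot_w o) (ot_k o)).

(** Multiples of [delta] lost per level: [b] for the bits of the string received, [T.+1 ^ 2 + 2] for
    inserting a view, 1 for a simulator that gets stuck. *)
Lemma gind_close u0 v0 (C : circuit) : u0 < w 1 -> v0 < w 1 ->
  Nat.lxor u0 v0 = gi_j0 i -> size C <= s0 ->
  (`|avg (len c) (fun g => expect (fun x : bool * store * nat =>
       (accepts C [:: x.1.2 0; x.1.2 1; x.1.2 2; [:: Nat.lxor g (gi_j i c)]])%:R)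
       (srun b (denote b (gind_sim S1 S2 par)
         (load [:: gind_input i u0 (~~ par); [:: g]])) 0))
   - expect (fun t => (accepts C [:: gind_input i u0 (~~ par);
         coins (log1 t); rcvd (log1 t); fin2 t 0])%:R)
      (exec b (gind_party ots otc par) (gind_party ots otc (~~ par))
       [:: gind_input i u0 (~~ par)] [:: gind_input i v0 par])|
  <= c%:R * ((b + (T.+1 ^ 2 + 2) + 1)%:R * delta))%R.
Proof.
move=> hu hv huv hC.
pose A a x y z : rat := (accepts C [:: a; x; y; z])%:R%R.
have A01 a x y z : (0 <= A a x y z <= 1)%R by rewrite /A ler0n lern1 leq_b1.
set inp := gind_input i u0 (~~ par).
have hc : 0 < c by apply: (c_gt0 leg).
rewrite (expect_gind_run OT_work OT_comm leg par (A inp) hu hv).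
have -> : avg (len c) (fun g => expect (fun x : bool * store * nat =>
       (accepts C [:: x.1.2 0; x.1.2 1; x.1.2 2; [:: Nat.lxor g (gi_j i c)]])%:R)%R
       (srun b (denote b (gind_sim S1 S2 par) (load [:: inp; [:: g]])) 0))
    = avg (len c) (fun g => prog_value S1 S2 i par u0 g
        (fun a x y => A a x y [:: Nat.lxor g (gi_j i c)]) c 1 u0 [::] [::]).
  apply: eq_avg => g hg.
  by rewrite -(expect_gind_sim S1 S2 leg par hg
    (fun a x y => A a x y [:: Nat.lxor g (gi_j i c)]) hu).
have F_close l u v r pc qc pm qm z : 1 <= l <= c -> u < w l -> v < w l -> r < 2 ^ b ->
  (`|expect (fun d => A inp (pc ++ nth [::] d 1 ++ qc) (pm ++ nth [::] d 2 ++ qm) z)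
       (real_view l u v r)
   - expect (fun d => A inp (pc ++ nth [::] d 1 ++ qc) (pm ++ nth [::] d 2 ++ qm) z)
       (sim_view l u v r)| <= (T.+1 ^ 2 + 2)%:R * delta)%R.
  move=> hl hu' hv' hr; apply: insert_dist.
  - exact: real_view_size4.
  - exact: sim_view_size4.
  - exact: sim_view_small.
  - by move=> C' hC'; apply: close_views => //; lia.
have e1 := prog_sim_value u0 A01 [::] [::] hc (leqnn 1) (addn1 c) hu.
have e2 := real_sim_value (A01 inp) F_close [::] [::] (leqnn 1) (addn1 c)
  (fun=> hu) (fun=> hv) huv.
move: e1 e2; set X := avg _ _; set Y := sim_value _ _ _ _ _ _; set Z := real_value _ _ _ _ _ _ _ _ _ _ _ _.
move=> e1 e2; rewrite -[X in (`|X - _|)%R](subrK Y).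
have -> : (X - Y + Y - Z = (X - Y) - (Z - Y))%R by ring.
rewrite (le_trans (ler_normB _ _)) // (le_trans (lerD e1 e2)) //.
by rewrite le_eqVlt; apply/orP; left; apply/eqP; rewrite !natrD; ring.
Qed.

End Analysis.

(** * Privacy, work and communication *)

Section Main.
Variables (beta : nat) (ots otc : cmd) (WOT COT : nat -> nat -> nat).
Hypothesis OT_work :
  has_work (F := OT beta) ots otc (fun o => WOT (ot_w o) (ot_k o)).
Hypothesis OT_comm :
  has_comm (F := OT beta) ots otc (fun o => COT (ot_w o) (ot_k o)).
Local Notation sz i := (sz (f := GInd beta) i).

Lemma share_lt i : gind_legal beta i ->
  Nat.lxor (gi_pi i) (gi_j0 i) < gi_w i 1 /\ gi_pi i < gi_w i 1.
Proof. by case=> _ _ _ _ [h1 h2]; split=> //; apply: lxor_lt. Qed.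

Lemma gi_len_last i : gi_len i (gi_c i) = gi_X i.
Proof. by rewrite /gi_len eqxx. Qed.

Section Simulators.
Variables (S1 S2 : cmd) (t1 t2 : {poly nat}).
Hypothesis time1 : forall o, ot_legal beta o ->
  every (fun go => steps (log1 go.2) <= t1.[Defs.sz (f := OT beta) o]%R)
    (simulation1 (F := OT beta) S1 o).
Hypothesis time2 : forall o, ot_legal beta o ->
  every (fun go => steps (log1 go.2) <= t2.[Defs.sz (f := OT beta) o]%R)
    (simulation2 (F := OT beta) S2 o).

Lemma every_subroutine i par l u r : gind_legal beta i ->
  1 <= l <= gi_c i -> u < gi_w i l -> r < 2 ^ gi_b i ->
  every (fun x : bool * store * nat => x.2 <= (t1 + t2).[sz i]%R)
    (srun (gi_b i) (denote (gi_b i) (sim_cmd S1 S2 par l)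
       (load (sim_args i par l u r))) 0).
Proof.
move=> leg hl hu hr; have w0 : 0 < gi_w i l by rewrite expn_gt0.
have bound o (t : {poly nat}) : Defs.sz (f := OT beta) o <= sz i ->
    t \in [:: t1; t2] -> t.[Defs.sz (f := OT beta) o]%R <= (t1 + t2).[sz i]%R.
  move=> ho; rewrite natpolyD !inE => /orP[] /eqP ->.
    by apply: leq_trans (poly_nat_mono _ ho) (leq_addr _ _).
  by apply: leq_trans (poly_nat_mono _ ho) (leq_addl _ _).
rewrite /sim_cmd /sim_args; case: (odd l == par).
  pose o := level_ot i l 0 u (Nat.lxor r (gi_tab i l (Nat.lxor 0 u))).
  have lo : ot_legal beta o by apply: level_ot_legal.
  have := time2 lo; rewrite /simulation2 /= every_bind => h.
  have {h} : every (fun t => steps (log1 t) <= (t1 + t2).[sz i]%R)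
      (solo (gi_b i) S2 [:: chooser_input o; [:: nth 0 (ot_x o) u]]).
    apply: every_imp h => t /= h; apply: leq_trans h (bound o t2 _ _) => //.
      exact: level_ot_sz.
    by rewrite !inE eqxx orbT.
  move=> /(every_solo _ (fun x => x.2 <= (t1 + t2).[sz i]%R)).
  rewrite nth_level_ot // lxor_low.
  by rewrite (modn_small (tab_lt leg hl _)) ?lxorK // lxor_lt.
pose o := level_ot i l u 0 r.
have lo : ot_legal beta o by apply: level_ot_legal.
have := time1 lo; rewrite /simulation1 /= every_bind => h.
have {h} : every (fun t => steps (log1 t) <= (t1 + t2).[sz i]%R)
    (solo (gi_b i) S1 [:: sender_input o; [::]]).
  apply: every_imp h => t /= h; apply: leq_trans h (bound o t1 _ _) => //.
    exact: level_ot_sz.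
  by rewrite !inE eqxx.
by move=> /(every_solo _ (fun x => x.2 <= (t1 + t2).[sz i]%R)).
Qed.

Definition gind_time : {poly nat} :=
  (('X + (t1 + t2) + (10%N)%:P) * ('X + (t1 + t2) + (10%N)%:P) * (600%N)%:P)%R.

Lemma gind_sim_time i par u0 g : gind_legal beta i -> u0 < gi_w i 1 ->
  g < 2 ^ gi_X i ->
  every (fun t => steps (log1 t) <= gind_time.[sz i]%R)
    (solo (gi_b i) (gind_sim S1 S2 par) [:: gind_input i u0 (~~ par); [:: g]]).
Proof.
move=> leg hu; rewrite -gi_len_last => hg.
apply/(every_solo _ (fun x => x.2 <= gind_time.[sz i]%R)).
have := every_gind_sim leg hg
  (fun l u r hl hu hr => every_subroutine par leg hl hu hr) hu.
apply: every_imp => x h; apply: leq_trans h _.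
rewrite /gind_time !(natpolyM, natpolyD, natpolyX, natpolyC) /=.
by rewrite expnS expn1 [_ + gi_b i]addnC.
Qed.

Lemma gind_polytime1 : polytime (simulation1 (F := GInd beta) (gind_sim S1 S2 true)).
Proof.
exists gind_time => i leg; have [hu _] := share_lt leg.
rewrite /simulation1 every_bind /= => r lr; rewrite every_bind /=.
apply: (gind_sim_time true leg hu).
by rewrite lxor_lt // -gi_len_last (gi_j_last leg).
Qed.

Lemma gind_polytime2 : polytime (simulation2 (F := GInd beta) (gind_sim S1 S2 false)).
Proof.
exists gind_time => i leg; have [_ hu] := share_lt leg.
rewrite /simulation2 every_bind /= => r lr; rewrite every_bind /=.
exact: (gind_sim_time false leg hu).
Qed.

Hypothesis indist1 : indistinguishable (sim_out1 (F := OT beta) S1) (view_out1 ots otc).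
Hypothesis indist2 : indistinguishable (sim_out2 (F := OT beta) S2) (view_out2 ots otc).

Lemma gind_indist (p s q : {poly nat}) : exists K : nat, forall i par u0 v0,
  gind_legal beta i -> K <= gi_k i -> sz i <= p.[gi_k i]%R ->
  u0 < gi_w i 1 -> v0 < gi_w i 1 -> Nat.lxor u0 v0 = gi_j0 i ->
  forall C : circuit, size C <= s.[gi_k i]%R ->
  (`|avg (gi_X i) (fun g => expect (fun x : bool * store * nat =>
       (accepts C [:: x.1.2 0; x.1.2 1; x.1.2 2; [:: Nat.lxor g (gi_j i (gi_c i))]])%:R)
       (srun (gi_b i) (denote (gi_b i) (gind_sim S1 S2 par)
         (load [:: gind_input i u0 (~~ par); [:: g]])) 0))
   - expect (fun t => (accepts C [:: gind_input i u0 (~~ par);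
         coins (log1 t); rcvd (log1 t); fin2 t 0])%:R)
      (exec (gi_b i) (gind_party ots otc par) (gind_party ots otc (~~ par))
       [:: gind_input i u0 (~~ par)] [:: gind_input i v0 par])|
   * (q.[gi_k i])%:R < 1)%R.
Proof.
(* Arrays left by a subroutine are no longer than its input, at most w + 4 words, plus its running
   time. *)
pose T : {poly nat} := (p + (4%N)%:P + ((t1 + t2) \Po p))%R.
pose N : {poly nat} := (p * (p + ((T + (1%N)%:P) * (T + (1%N)%:P) + (2%N)%:P) + (1%N)%:P))%R.
(* The loss is at most [N / q']; adding 1 makes [q'] positive and the final inequality strict. *)
pose q' : {poly nat} := (N * q + (1%N)%:P)%R.
have [K1 H1] := indist1 p ((14%N)%:P + s)%R q'.
have [K2 H2] := indist2 p ((14%N)%:P + s)%R q'.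
(* Eventually [T] < 2^k <= 2^b, so that the simulator copies the views without truncation. *)
have [K3 H3] := poly_lt_exp2 T.
exists (K1 + K2 + K3) => i par u0 v0 leg hK hsz hu hv huv C hC.
set k := gi_k i in hK hsz hC *.
pose delta : rat := ((q'.[k])%:R^-1)%R.
have q'0 : (0 < (q'.[k])%:R :> rat)%R.
  by rewrite ltr0n /q' natpolyD natpolyC addn1.
have close x : (x * (q'.[k])%:R < 1 -> x <= delta)%R.
  by move=> h; rewrite /delta -[leRHS]mul1r ler_pdivlMr // ltW.
have osz l pp qq r : 1 <= l <= gi_c i ->
    Defs.sz (f := OT beta) (level_ot i l pp qq r) <= p.[k]%R.
  by move=> hl; apply: leq_trans hsz; apply: level_ot_sz.
have hs (C' : circuit) : size C' <= 14 + s.[k]%R -> size C' <= (((14%N)%:P + s).[k])%R.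
  by rewrite natpolyD natpolyC.
have close1 l pp qq r (C' : circuit) : 1 <= l <= gi_c i -> pp < gi_w i l ->
    qq < gi_w i l -> size C' <= 14 + s.[k]%R ->
    (`|prob (accepts C') (sim_out1 (F := OT beta) S1 (level_ot i l pp qq r))
     - prob (accepts C') (view_out1 (F := OT beta) ots otc (level_ot i l pp qq r))|
     <= delta)%R.
  move=> hl hp hq /hs hC'; apply: close; apply: (H1 (level_ot i l pp qq r)) => //.
  - exact: level_ot_legal.
  - by rewrite /= -/k; lia.
  - exact: osz.
have close2 l pp qq r (C' : circuit) : 1 <= l <= gi_c i -> pp < gi_w i l ->
    qq < gi_w i l -> size C' <= 14 + s.[k]%R ->
    (`|prob (accepts C') (sim_out2 (F := OT beta) S2 (level_ot i l pp qq r))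
     - prob (accepts C') (view_out2 (F := OT beta) ots otc (level_ot i l pp qq r))|
     <= delta)%R.
  move=> hl hp hq /hs hC'; apply: close; apply: (H2 (level_ot i l pp qq r)) => //.
  - exact: level_ot_legal.
  - by rewrite /= -/k; lia.
  - exact: osz.
have TE : T.[k]%R = p.[k]%R + 4 + (t1 + t2).[p.[k]]%R.
  by rewrite /T !natpolyD !natpolyC horner_comp natpolyD.
have T_word : T.[k]%R < 2 ^ gi_b i.
  apply: (@leq_trans (2 ^ k)); first by apply: H3; lia.
  by rewrite leq_exp2l //; case: leg => [[]].
have szE : sz i = gi_b i + \sum_(1 <= l < (gi_c i).+1) gi_w i l by [].
have sub_size l u r : 1 <= l <= gi_c i -> u < gi_w i l -> r < 2 ^ gi_b i ->
    every (fun x : bool * store * nat => forall y, size (x.1.2 y) <= T.[k]%R)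
    (srun (gi_b i) (denote (gi_b i) (sim_cmd S1 S2 par l)
       (load (sim_args i par l u r))) 0).
  move=> hl hu' hr.
  have := every_sub_ok
    (fun l u r hl hu hr => every_subroutine par leg hl hu hr) hl hu' hr.
  apply: every_imp => x [_ h] y; apply: leq_trans (h y) _.
  rewrite TE leq_add ?poly_nat_mono // leq_add2r (leq_trans _ hsz) // szE.
  by rewrite (leq_trans (w_bound hl)) ?leq_addl.
have := gind_close leg close1 close2 T_word sub_size OT_work OT_comm hu hv huv hC.
rewrite gi_len_last => h; apply: le_lt_trans (ler_wpM2r (ler0n _ _) h) _.
have le_c : gi_c i <= p.[k]%R.
  by apply: (leq_trans (levels_le i)); apply: leq_trans hsz; rewrite szE leq_addl.
have le_b : gi_b i <= p.[k]%R by apply: leq_trans hsz; rewrite szE leq_addr.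
set M := gi_b i + _ + 1.
have le_N : gi_c i * M <= N.[k]%R.
  rewrite /N natpolyM leq_mul // !natpolyD natpolyM !natpolyD !natpolyC /M.
  have <- : T.[k]%R = p.[k]%R + 4 + ((t1 + t2) \Po p)%R.[k]%R.
    by rewrite /T !natpolyD natpolyC.
  by rewrite [T.[k]%R + 1]addn1 mulnn !leq_add2r.
rewrite mulrA -natrM mulrAC -natrM ltr_pdivrMr // mul1r ltr_nat.
by rewrite /q' natpolyD natpolyM natpolyC addn1 ltnS leq_mul.
Qed.

Lemma gind_indist1 : indistinguishable
  (sim_out1 (F := GInd beta) (gind_sim S1 S2 true))
  (view_out1 (gind_alice ots otc) (gind_bob ots otc)).
Proof.
move=> p s q; have [K H] := gind_indist p s q; exists K => i leg hK hsz C hC.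
have [hu hv] := share_lt leg.
have huv : Nat.lxor (Nat.lxor (gi_pi i) (gi_j0 i)) (gi_pi i) = gi_j0 i.
  by rewrite lxorC lxorKl.
have := H i true _ _ leg hK hsz hu hv huv C hC; congr ((`|_ - _| * _ < _)%R).
  have lj : gi_j i (gi_c i) < 2 ^ gi_X i by rewrite -gi_len_last (gi_j_last leg).
  (* The output given to Alice is the ideal coin masked by the final index; the shift makes that
     output itself the uniform variable. *)
  rewrite probE /sim_out1 /simulation1 !expect_bind /= -(avg_lxor _ lj).
  apply: eq_avg => r _; rewrite expect_bind /= lxorK.
  by rewrite (expect_solo _ (fun x : bool * store * nat =>
    (accepts C [:: x.1.2 0; x.1.2 1; x.1.2 2; [:: r]])%:R)%R).
by rewrite probE /view_out1 expect_bind.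
Qed.

Lemma gind_indist2 : indistinguishable
  (sim_out2 (F := GInd beta) (gind_sim S1 S2 false))
  (view_out2 (gind_alice ots otc) (gind_bob ots otc)).
Proof.
move=> p s q; have [K H] := gind_indist p s q; exists K => i leg hK hsz C hC.
have [hv hu] := share_lt leg.
have := H i false _ _ leg hK hsz hu hv (lxorKl _ _) C hC; congr ((`|_ - _| * _ < _)%R).
  rewrite probE /sim_out2 /simulation2 !expect_bind /=.
  apply: eq_avg => r _; rewrite expect_bind /=.
  by rewrite (expect_solo _ (fun x : bool * store * nat =>
    (accepts C [:: x.1.2 0; x.1.2 1; x.1.2 2; [:: Nat.lxor r (gi_j i (gi_c i))]])%:R)%R).
(* [gind_indist] puts the observed party first, whereas Bob is the second process. *)
by rewrite probE /view_out2 expect_bind /run_protocol /exec expect_run_swap.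
Qed.

End Simulators.

Lemma gind_private : privately_computes (OT beta) ots otc ->
  privately_computes (GInd beta) (gind_alice ots otc) (gind_bob ots otc).
Proof.
move=> [S1 [S2 [[t1 h1] [t2 h2] i1 i2]]].
exists (gind_sim S1 S2 true), (gind_sim S1 S2 false); split.
- exact: gind_polytime1 h1 h2.
- exact: gind_polytime2 h1 h2.
- exact: gind_indist1 h1 h2 i1 i2.
- exact: gind_indist2 h1 h2 i1 i2.
Qed.

Lemma gind_run_bounds i : gind_legal beta i ->
  every (fun t => [&& halted t,
      work t <= \sum_(1 <= a < (gi_c i).+1)
        (310 * (gi_w i a).+1 + 2 * WOT (gi_w i a) (gi_k i)) + 46
    & comm (gi_b i) t <= \sum_(1 <= a < (gi_c i).+1) COT (gi_w i a) (gi_k i)])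
    (run_protocol (F := GInd beta) (gind_alice ots otc) (gind_bob ots otc) i).
Proof.
move=> leg; have [hu hv] := share_lt leg.
exact: (every_gind_run OT_work OT_comm leg true hu hv).
Qed.

Lemma gind_has_work : (exists a w0 : nat, forall w k : nat, w0 <= w -> w <= a * WOT w k) ->
  exists A : nat, has_work (F := GInd beta) (gind_alice ots otc) (gind_bob ots otc)
    (fun i => A * \sum_(1 <= l < (gi_c i).+1) WOT (gi_w i l) (gi_k i)).
Proof.
(* For all w, w <= (a + w0) WOT: by the Omega hypothesis if w >= w0, by positivity of WOT below. The
   extra 1 covers the successor in [(gi_w i a).+1], and 46 is charged to the first level. *)
move=> [a [w0 Hw]]; exists (310 * (a + w0 + 1) + 2 + 46) => i leg.
apply: every_imp (gind_run_bounds leg) => t /and3P[h1 h2 _]; split=> //.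
apply: leq_trans h2 _.
have pos l : 1 <= l <= gi_c i -> 0 < WOT (gi_w i l) (gi_k i).
  exact: (WOT_gt0 OT_work leg).
rewrite [leqRHS]mulnDl leq_add //.
  rewrite big_distrr /= big_nat [leqRHS]big_nat; apply: leq_sum => l hl.
  have := pos l hl; set W := WOT _ _ => W0.
  have : gi_w i l <= (a + w0) * W.
    rewrite mulnDl; case: (leqP w0 (gi_w i l)) => h.
      by apply: leq_trans (Hw _ _ h) (leq_addr _ _).
    by apply: leq_trans (ltnW h) _; rewrite (leq_trans (leq_pmulr w0 W0)) ?leq_addl.
  by move=> h; rewrite mulnDl -mulnA mulnDl mul1n; lia.
rewrite leq_pmulr // (@leq_trans (WOT (gi_w i 1) (gi_k i))) //.
  by apply: pos; rewrite (c_gt0 leg).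
by apply: (@leq_sum_nat _ 1 (fun l => WOT (gi_w i l) (gi_k i))); rewrite (c_gt0 leg).
Qed.

(** The messages of the protocol are exactly those of the transfers, so the constant is 1. *)
Lemma gind_has_comm :
  exists A : nat, has_comm (F := GInd beta) (gind_alice ots otc) (gind_bob ots otc)
    (fun i => A * \sum_(1 <= l < (gi_c i).+1) COT (gi_w i l) (gi_k i)).
Proof.
exists 1 => i leg.
by apply: every_imp (gind_run_bounds leg) => t /and3P[_ _]; rewrite mul1n.
Qed.

End Main.

Theorem theorem3p3 (beta : nat) (ots otc : cmd) (WOT COT : nat -> nat -> nat)
  (OT_private : privately_computes (OT beta) ots otc)
  (OT_work : has_work (F := OT beta) ots otc (fun i => WOT (ot_w i) (ot_k i)))
  (OT_comm : has_comm (F := OT beta) ots otc (fun i => COT (ot_w i) (ot_k i)))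
  (OT_Omega : exists a w0 : nat, forall w k : nat,
     w0 <= w -> w <= a * WOT w k) :
  [/\ privately_computes (GInd beta) (gind_alice ots otc) (gind_bob ots otc),
      exists A : nat,
        has_work (F := GInd beta) (gind_alice ots otc) (gind_bob ots otc)
          (fun i => A * \sum_(1 <= l < (gi_c i).+1) WOT (gi_w i l) (gi_k i))
    & exists A : nat,
        has_comm (F := GInd beta) (gind_alice ots otc) (gind_bob ots otc)
          (fun i => A * \sum_(1 <= l < (gi_c i).+1) COT (gi_w i l) (gi_k i))].
Proof.
split.
- exact: gind_private OT_work OT_comm OT_private.
- exact: gind_has_work OT_work OT_comm OT_Omega.
- exact: gind_has_comm OT_work OT_comm.
Qed.
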